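(* There is a function $c$ of $d$ with $c(d)\to0$ as $d\to\infty$ such that the following holds. Let $\kappa,\sigma\geq1$ be such that $n=\kappa d\log d$ is an integer, let $\varepsilon=\sigma\sqrt{\log d}\,d^{-\kappa/32}$, let $M$ be a (deterministic) $d\times n$ real matrix all of whose columns have Euclidean norm at most $1$, let $R$ be a $d\times n$ random matrix with i.i.d. Gaussian entries $R_{i,j}\sim\mathcal N(0,\sigma^2/d)$, and let $Y$ be the random vector in $\{\pm1\}^n$, independent of $R$, whose distribution is the modification of the Gram-Schmidt walk distribution defined in the context. Then \[ \mathbf P_R\Big(\mathbf P_Y\big(\|(M+R)Y\|_\infty\leq\varepsilon\big)>0\Big)\geq1-c(d). \]
   Context: Here $d\geq3$, $[n]=\{1,\ldots,n\}$, $\mathbf P_R$ and $\mathbf P_Y$ denote probability with respect to $R$ and $Y$ respectively. Gram-Schmidt walk (GSW) algorithm for a matrix $N$ with $n$ columns. Set $X_1=\mathbf 0\in[-1,1]^n$, $t=1$, $\mathcal A_1=[n]$, pivot $p_1=n$. While $\mathcal A_t\neq\emptyset$: (1) let $u_t$ be a minimizer of $\|Nu\|_2$ over $u\in\mathbb{R}^n$ with $u(p_t)=1$ and $u(i)=0$ for all $i\notin\mathcal A_t$ (chosen by a fixed rule if not unique); (2) let $\Delta=\{\delta\in\mathbb{R}:X_t+\delta u_t\in[-1,1]^n\}$, $\delta^+=|\max\Delta|$, $\delta^-=|\min\Delta|$; (3) let (with fresh randomness) $\delta_t=\delta^+$ with probability $\delta^-/(\delta^-+\delta^+)$ and $\delta_t=-\delta^-$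 with probability $\delta^+/(\delta^-+\delta^+)$; (4) set $X_{t+1}=X_t+\delta_tu_t$, $\mathcal A_{t+1}=\{i\in[n]:|X_{t+1}(i)|<1\}$, $p_{t+1}=\max\mathcal A_{t+1}$ (if $\mathcal A_{t+1}\neq\emptyset$), and increase $t$ by $1$. The output is $X_{T+1}\in\{\pm1\}^n$, where $T$ is the number of steps, i.e. $\mathcal A_{T+1}=\emptyset$ for the first time. Distribution of $Y$. Let $\bar X\in\{\pm1\}^n$ be the output of the GSW algorithm run on the $(d+n)\times n$ matrix $\bar M=2^{-1/2}\begin{pmatrix}M\\ \mathrm{Id}_n\end{pmatrix}$, where $\mathrm{Id}_n$ is the $n\times n$ identity matrix. Let $V$ be defined by $2V=\mathbf E\|M\bar X\|_2^2$, let $C=(\log d)^2$, and let $B=\{x\in\{\pm1\}^n:\|Mx\|_2^2\leq2CV\}$. The distribution of $Y$ is given, for $A\subset\{\pm1\}^n$, by \[ \mathbf P(Y\in A)=W^{-1}\,\mathbf E\left[\mathbf 1_{\bar X\in A}\mathbf 1_{\bar X\in B}\exp\left(\frac{d\|M\bar X\|_2^2}{2\sigma^2n}\right)\right],\qquad W=\mathbf E\left[\mathbf 1_{\bar X\in B}\exp\left(\frac{d\|M\bar X\|_2^2}{2\sigma^2n}\right)\right]. \] *)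

(* Defs.v *)
From HB Require Import structures.
From mathcomp Require Export all_boot all_order all_algebra.
From mathcomp Require Export all_classical all_reals all_analysis.
Export Order.TTheory GRing.Theory Num.Theory.
Export numFieldNormedType.Exports.

Set Implicit Arguments.
Unset Strict Implicit.
Unset Printing Implicit Defensive.

Local Open Scope classical_set_scope.
Local Open Scope ring_scope.

(* The norm [`|v|] of the libraries on matrices is the sup norm. *)
Definition l2norm (K : realType) (m : nat) (v : 'cV[K]_m) : K :=
  Num.sqrt (\sum_(i < m) v i 0 ^+ 2).

Definition sign_vectors (K : realType) (n : nat) : set 'cV[K]_n :=
  [set x | forall i, x i 0 = 1 \/ x i 0 = -1].

(** ** The Gram-Schmidt walk *)

Definition alive (K : realType) (n : nat) (X : 'cV[K]_n) : {set 'I_n} :=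
  [set i | `|X i 0| < 1].

(* [None] exactly when the alive set is empty. *)
Definition pivot (n : nat) (A : {set 'I_n}) : option 'I_n :=
  [pick p in A | [forall q in A, (q <= p)%N]].

Definition feasible_directions (K : realType) (n : nat)
    (A : {set 'I_n}) (p : 'I_n) : set 'cV[K]_n :=
  [set u | u p 0 = 1 /\ forall i, i \notin A -> u i 0 = 0].

(* Ties between minimizers are broken by the choice operator [get], so the
   direction is a function of [N], [A] and [p] only. *)
Definition gsw_direction (K : realType) (m n : nat) (N : 'M[K]_(m, n))
    (A : {set 'I_n}) (p : 'I_n) : 'cV[K]_n :=
  get [set u | feasible_directions A p u /\
    forall v, feasible_directions A p v ->
      l2norm (N *m u) <= l2norm (N *m v)].

Definition step_sizes (K : realType) (n : nat) (X u : 'cV[K]_n) : set K :=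
  [set delta | forall i, -1 <= (X + delta *: u) i 0 <= 1].

(* [gsw_expect_from N f k X] is the expectation of [f] at the state reached from
   [X] after [k] steps of the walk, or at the final state if the walk stops
   earlier.  The active set and the pivot are functions of the current state:
   the initial pivot [n] is the largest index of the initial active set. *)
Fixpoint gsw_expect_from (K : realType) (m n : nat) (N : 'M[K]_(m, n))
    (f : 'cV[K]_n -> K) (k : nat) (X : 'cV[K]_n) : K :=
  match k, pivot (alive X) with
  | k'.+1, Some p =>
      let u := gsw_direction N (alive X) p in
      let dplus := `|sup (step_sizes X u)| in
      let dminus := `|inf (step_sizes X u)| in
      dminus / (dminus + dplus) * gsw_expect_from N f k' (X + dplus *: u) +
      dplus / (dminus + dplus) * gsw_expect_from N f k' (X - dminus *: u)
  | _, _ => f X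
  end.

(* Every step makes at least one alive coordinate equal to 1 or -1, and such
   coordinates never move again, so the walk stops after at most [n] steps and
   this is the expectation of [f] at its output. *)
Definition gsw_expect (K : realType) (m n : nat) (N : 'M[K]_(m, n))
    (f : 'cV[K]_n -> K) : K :=
  gsw_expect_from N f n 0.

(** ** The distribution of Y *)

Definition Mbar (K : realType) (d n : nat) (M : 'M[K]_(d, n)) :
    'M[K]_(d + n, n) :=
  (Num.sqrt 2)^-1 *: col_mx M 1%:M.

Definition Vpar (K : realType) (d n : nat) (M : 'M[K]_(d, n)) : K :=
  gsw_expect (Mbar M) (fun x => l2norm (M *m x) ^+ 2) / 2.

Definition Cpar (K : realType) (d : nat) : K := ln (d%:R : K) ^+ 2.

Definition Bset (K : realType) (d n : nat) (M : 'M[K]_(d, n)) : set 'cV[K]_n :=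
  [set x | sign_vectors x /\ l2norm (M *m x) ^+ 2 <= 2 * Cpar K d * Vpar M].

Definition tilt (K : realType) (d n : nat) (M : 'M[K]_(d, n)) (sigma : K)
    (x : 'cV[K]_n) : K :=
  expR (d%:R * l2norm (M *m x) ^+ 2 / (2 * sigma ^+ 2 * n%:R)).

Definition Wpar (K : realType) (d n : nat) (M : 'M[K]_(d, n)) (sigma : K) : K :=
  gsw_expect (Mbar M) (fun x => \1_(Bset M) x * tilt M sigma x).

Definition Ylaw (K : realType) (d n : nat) (M : 'M[K]_(d, n)) (sigma : K)
    (A : set 'cV[K]_n) : K :=
  (Wpar M sigma)^-1 *
  gsw_expect (Mbar M) (fun x => \1_A x * \1_(Bset M) x * tilt M sigma x).

Definition has_Ylaw (disp : measure_display) (T : measurableType disp)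
    (K : realType) (P : probability T K) (d n : nat) (M : 'M[K]_(d, n))
    (sigma : K) (Y : T -> 'cV[K]_n) : Prop :=
  (forall w, sign_vectors (Y w)) /\
  forall A : set 'cV[K]_n, A `<=` @sign_vectors K n ->
    measurable (Y @^-1` A) /\ P (Y @^-1` A) = (Ylaw M sigma A)%:E.

(** ** The Gaussian matrix *)

Definition mutually_independent (disp : measure_display)
    (T : measurableType disp) (K : realType) (P : probability T K)
    (I : finType) (X : I -> {RV P >-> K}) : Prop :=
  forall (J : {set I}) (E : I -> set K),
    (forall i, i \in J -> measurable (E i)) ->
    P (\bigcap_(i in [set` J]) (X i @^-1` E i)) =
    (\prod_(i in J) P (X i @^-1` E i))%E.

(* The second parameter of [normal_prob] is the standard deviation. *)
Definition iid_gaussian_entries (disp : measure_display)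
    (T : measurableType disp) (K : realType) (P : probability T K)
    (d n : nat) (s : K) (R : 'I_d -> 'I_n -> {RV P >-> K}) : Prop :=
  (forall i j (E : set K), measurable E ->
     distribution P (R i j) E = normal_prob 0 s E) /\
  mutually_independent (fun ij : 'I_d * 'I_n => R ij.1 ij.2).

Definition random_matrix (disp : measure_display)
    (T : measurableType disp) (K : realType) (P : probability T K)
    (d n : nat) (R : 'I_d -> 'I_n -> {RV P >-> K}) (w : T) : 'M[K]_(d, n) :=
  \matrix_(i, j) R i j w.

Definition sigma_of_entries (disp : measure_display)
    (T : measurableType disp) (K : realType) (P : probability T K)
    (d n : nat) (R : 'I_d -> 'I_n -> {RV P >-> K}) : set (set T) :=
  <<s [set G | exists i j (E : set K), measurable E /\ G = R i j @^-1` E] >>.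

Definition independent_of_matrix (disp : measure_display)
    (T : measurableType disp) (K : realType) (P : probability T K)
    (d n : nat) (R : 'I_d -> 'I_n -> {RV P >-> K}) (Y : T -> 'cV[K]_n) : Prop :=
  forall (G : set T) (A : set 'cV[K]_n),
    sigma_of_entries R G -> A `<=` @sign_vectors K n ->
    P (G `&` Y @^-1` A) = (P G * P (Y @^-1` A))%E.

(* Main.v *)
From HB Require Import structures.
Require Import Defs.
From mathcomp Require Import measurable_realfun ring lra.

(** The law of [Y] enters only through its support: with positive conditional
    probability [(M + R) Y] lies in the cube of radius [eps] exactly when some
    vector [x] of [Bset M] charged by the walk satisfies [|(M + R) x| <= eps]
    ([inner_gt0P]).  The existence of such an [x] is proved by the second moment
    method, applied to a weighted count of the good [x].

    Write [p] for the law of the walk, [q] for the square root of [ln d], and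
    [S ^+ 2 = sigma ^+ 2 * kappa * ln d], the variance of the entries of [R x].
    The count [weighted_bumps] gives to each [x] with a short image the weight
    [p x] times the indicator that [(M + R) x] lies in the cube, divided by the
    volume of the cube and by the Gaussian density of [R x] at its actual value.
    Under this division [(M + R) x] becomes uniform on the cube, so [x]
    contributes exactly [p x] to the mean whatever [M x] is ([bump_mean]); this
    replaces the exponential tilt in the law of [Y].  Keeping only
    [|M x|^2 <= 2 V q] loses mass [1/q] by Markov's inequality
    ([short_image_mass]) and stays inside [Bset M].

    A pair [x, y] contributes to the second moment [p x * p y] times the average
    over two independent uniform points of the cube of the joint density of
    [R x, R y] divided by the product of their densities.  With
    [rho = <x, y> / n] this is about [exp (d rho^2 / 2 + rho <M x, M y> / S^2)],
    because the cube is small compared with [S] ([bump_correlation],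
    [correlated_product_le]).  For fixed [y], both [<x, y>] and [<M x, M y>] are
    subgaussian under the walk, hence their squares have small exponential
    moments ([subgaussian_square_mgf]) and the pairs with [|rho| <= 1/2]
    contribute at most [1 + O(1/q)].  The other pairs have mass at most
    [2 exp (- n / 16)] ([chernoff]), while the trivial bound on a pair is
    [exp (3 n / 64)] ([bumps_le]): each row costs a factor of order [S / eps],
    and [(S / eps)^d] is [exp (n / 32)] up to smaller factors because [eps / S]
    is [d ^ (- kappa / 32)] divided by the square root of [kappa].  This is the
    place where the exponent [kappa / 32] is used.  The inequality
    [1_(Z > 0) >= 2 Z - Z ^+ 2] then yields the bound with [c d] of order [1/q].

    The remaining ingredient is that the output [x] of the walk on a matrix [N]
    with columns of norm at most 1 satisfies
    [E exp <v, N x> <= exp (|v|^2 / 2)] ([gsw_subgaussian]).  During the time a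
    coordinate [p] is the pivot, [N X] moves along the residuals of column [p]
    against the other alive columns, and these residuals grow by orthogonal
    increments as columns freeze.  A potential that mixes the moment generating
    function of a single sign of mean [X p] with the constant 1, in the
    proportions [|r|^2] and [1 - |r|^2] given by the current residual [r], is a
    martingale under the steps and can only decrease when an increment joins the
    residual ([phase_merge], [phase_claim_move]); the losses are paid by the
    shrinking projection of [v] on the alive columns. *)

Set Implicit Arguments.
Unset Strict Implicit.
Unset Printing Implicit Defensive.

Local Open Scope classical_set_scope.
Local Open Scope ring_scope.

(** * Moment generating function of a sign *)

Section Hoeffding.
Variable K : realType.
Implicit Types x g k t : K.

(** This is [E exp (g s)] for a random sign [s] of mean [x].  It is affine in
    [x], so it is a martingale when [x] is one. *)
Definition two_point_mgf (g x : K) : K :=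
  (1 + x) / 2 * expR g + (1 - x) / 2 * expR (- g).

Lemma nondecreasing_of_derive_ge0 (f f' : K -> K) :
  (forall t, is_derive t 1 f (f' t)) -> (forall t, 0 <= t -> 0 <= f' t) ->
  forall t, 0 <= t -> f 0 <= f t.
Proof.
move=> df f'0 t t0.
apply: (@ger0_derive1_ndecry K f 0) => //.
- move=> x; rewrite in_itv/= andbT => x0.
  by rewrite derive1E; have := df x; case=> _ ->; apply/f'0/ltW.
- apply: continuous_subspaceT => x.
  by apply: differentiable_continuous; apply/derivable1_diffP; have := df x; case.
Qed.

(** Hoeffding's inequality for a sign of mean [x].  With [G] the right-hand side
    and [h] the difference of the two sides, [h'' - h = G * (x + g) ^+ 2 >= 0].  The
    operator factors as [(D - 1) (D + 1)], so two integrations from 0, where [h]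
    and [h'] vanish, give first [h + h' >= 0] and then [h >= 0]. *)
Lemma two_point_mgf_le_pos x g : 0 <= g ->
  two_point_mgf g x <= expR (g * x + g ^+ 2 / 2).
Proof.
pose G := fun t : K => expR (t * x + t ^+ 2 / 2).
pose h := fun t : K => G t - two_point_mgf t x.
pose h' := fun t : K => G t * (x + t) - ((1 + x) / 2 * expR t - (1 - x) / 2 * expR (- t)).
have dG t : is_derive t 1 G (G t * (x + t)).
  rewrite /G; apply: is_derive_eq.
  by rewrite /GRing.scale/=; field.
have dh t : is_derive t 1 h (h' t).
  by rewrite /h /two_point_mgf; apply: is_derive_eq; by rewrite /h' /GRing.scale/=; field.
have dh' t : is_derive t 1 h' (G t * (x + t) ^+ 2 + G t - two_point_mgf t x).
  by rewrite /h' /two_point_mgf; apply: is_derive_eq; by rewrite /GRing.scale/=; field.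
have h0 : h 0 = 0.
  by rewrite /h /G /two_point_mgf !mul0r expr0n/= mul0r addr0 oppr0 expR0; field.
have h'0 : h' 0 = 0.
  by rewrite /h' /G !mul0r expr0n/= mul0r addr0 oppr0 expR0; field.
pose a := fun t : K => (h t + h' t) * expR (- t).
have da t : is_derive t 1 a (G t * (x + t) ^+ 2 * expR (- t)).
  rewrite /a; apply: is_derive_eq; rewrite /GRing.scale/= /h; ring.
have a_ge t : 0 <= t -> 0 <= h t + h' t.
  move=> t0; have := nondecreasing_of_derive_ge0 da.
  move=> /(_ _ t t0); rewrite /a h0 h'0 addr0 mul0r pmulr_lge0 ?expR_gt0//; apply.
  by move=> s _; apply: mulr_ge0; rewrite ?expR_ge0 // mulr_ge0 ?sqr_ge0 ?expR_ge0.
pose b := fun t : K => h t * expR t.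
have db t : is_derive t 1 b ((h t + h' t) * expR t).
  by rewrite /b; apply: is_derive_eq; rewrite /GRing.scale/=; ring.
move=> g0; have := nondecreasing_of_derive_ge0 db.
move=> /(_ _ g g0); rewrite /b h0 mul0r pmulr_lge0 ?expR_gt0// /h subr_ge0; apply.
by move=> s s0; rewrite mulr_ge0 ?expR_ge0// a_ge.
Qed.

Lemma two_point_mgf_le x g : two_point_mgf g x <= expR (g * x + g ^+ 2 / 2).
Proof.
have [g0|/ltW g0] := leP 0 g; first exact: two_point_mgf_le_pos.
have -> : two_point_mgf g x = two_point_mgf (- g) (- x).
  by rewrite /two_point_mgf !opprK; ring.
rewrite (le_trans (two_point_mgf_le_pos _ _)) ?oppr_ge0//.
by rewrite mulrNN sqrrN.
Qed.

Lemma expR_convex (a b p q : K) : 0 <= p -> 0 <= q -> p + q = 1 ->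
  expR (p * a + q * b) <= p * expR a + q * expR b.
Proof.
move=> p0 q0 pq.
pose m := p * a + q * b.
(* The tangent of the exponential at [m]. *)
have F t : expR m * (1 + (t - m)) <= expR t.
  have -> : expR t = expR m * expR (t - m) by rewrite -expRD addrC subrK.
  by rewrite ler_pM2l ?expR_gt0 ?expR_ge1Dx.
rewrite -/m.
have -> : expR m = p * (expR m * (1 + (a - m))) + q * (expR m * (1 + (b - m))).
  rewrite mulrCA [q * _]mulrCA -mulrDr.
  suff -> : p * (1 + (a - m)) + q * (1 + (b - m)) = 1 by rewrite mulr1.
  rewrite /m (_ : q = 1 - p); last by rewrite -pq addrC addKr.
  by ring.
by rewrite lerD ?ler_wpM2l.
Qed.

Lemma two_point_mgf_ge x g : `|x| <= 1 -> expR (g * x) <= two_point_mgf g x.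
Proof.
rewrite ler_norml => /andP[x1 x2].
have -> : g * x = (1 + x) / 2 * g + (1 - x) / 2 * (- g) by field.
by apply: expR_convex; [lra|lra|field].
Qed.

End Hoeffding.

(** * Inner products and projections on spans of columns *)

Section InnerProduct.
Variables (K : realType).

Definition dot (m : nat) (x y : 'cV[K]_m) : K := \sum_i x i 0 * y i 0.

Variables (m : nat).
Implicit Types x y z : 'cV[K]_m.

Lemma dotC x y : dot x y = dot y x.
Proof. by apply: eq_bigr => i _; rewrite mulrC. Qed.

Lemma dotDl x y z : dot (x + y) z = dot x z + dot y z.
Proof. by rewrite /dot -big_split/=; apply: eq_bigr => i _; rewrite mxE mulrDl. Qed.

Lemma dotZl a x y : dot (a *: x) y = a * dot x y.
Proof. by rewrite /dot mulr_sumr; apply: eq_bigr => i _; rewrite mxE mulrA. Qed.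

Lemma dotNl x y : dot (- x) y = - dot x y.
Proof. by rewrite -scaleN1r dotZl mulN1r. Qed.

Lemma dotBl x y z : dot (x - y) z = dot x z - dot y z.
Proof. by rewrite dotDl dotNl. Qed.

Lemma dotDr x y z : dot x (y + z) = dot x y + dot x z.
Proof. by rewrite dotC dotDl !(dotC x). Qed.

Lemma dotZr a x y : dot x (a *: y) = a * dot x y.
Proof. by rewrite dotC dotZl dotC. Qed.

Lemma dotBr x y z : dot x (y - z) = dot x y - dot x z.
Proof. by rewrite dotC dotBl !(dotC x). Qed.

Lemma dot0r x : dot x 0 = 0.
Proof. by rewrite -(subrr x) dotBr subrr. Qed.

Lemma dot_ge0 x : 0 <= dot x x.
Proof. by apply: sumr_ge0 => i _; rewrite -expr2 sqr_ge0. Qed.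

Lemma dot_eq0 x : dot x x = 0 -> x = 0.
Proof.
move=> /eqP; rewrite psumr_eq0 => [/allP x0|i _]; last by rewrite -expr2 sqr_ge0.
apply/matrixP => i j; rewrite !mxE ord1.
by have := x0 i (mem_index_enum _); rewrite /= mulf_eq0 orbb => /eqP.
Qed.

Lemma l2norm_sqr x : l2norm x ^+ 2 = dot x x.
Proof.
rewrite sqr_sqrtr; first by apply: eq_bigr => i _; rewrite expr2.
by apply: sumr_ge0 => i _; rewrite sqr_ge0.
Qed.

Lemma cauchy_schwarz x y : dot x y ^+ 2 <= dot x x * dot y y.
Proof.
have [y0|] := eqVneq (dot y y) 0.
  by rewrite (dot_eq0 y0) !dot0r mulr0 expr0n.
rewrite neq_lt ltNge dot_ge0/= => y0.
rewrite -subr_ge0 -(pmulr_rge0 _ y0).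
have := dot_ge0 (dot y y *: x - dot x y *: y).
rewrite !(dotBl, dotBr, dotZl, dotZr) (dotC y x).
by set a := dot x x; set b := dot y y; set c := dot x y; congr (0 <= _); ring.
Qed.

End InnerProduct.

Section Projection.
Variables (K : realType) (m n : nat) (N : 'M[K]_(m, n)).
Implicit Types (A B : {set 'I_n}) (w y q : 'cV[K]_m) (z : 'cV[K]_n).

Definition supported_on A z := forall i, i \notin A -> z i 0 = 0.

Definition in_span A y := exists2 z, supported_on A z & y = N *m z.

Definition is_proj A w q :=
  in_span A q /\ forall i, i \in A -> dot (w - q) (col i N) = 0.

Lemma dot_mulmx w z : dot w (N *m z) = \sum_j z j 0 * dot w (col j N).
Proof.
rewrite /dot; under eq_bigr do rewrite mxE mulr_sumr.
rewrite exchange_big; apply: eq_bigr => j _; rewrite mulr_sumr.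
by apply: eq_bigr => i _; rewrite mxE; ring.
Qed.

Lemma in_span_sub A B y : A \subset B -> in_span A y -> in_span B y.
Proof.
move=> /fintype.subsetP AB [z zA ->]; exists z => // i iB; apply: zA.
by apply: contra iB; exact: AB.
Qed.

Lemma in_spanD A y y' : in_span A y -> in_span A y' -> in_span A (y + y').
Proof.
move=> [z zA ->] [z' z'A ->]; exists (z + z'); last by rewrite mulmxDr.
by move=> i iA; rewrite mxE zA// z'A// addr0.
Qed.

Lemma in_spanZ A a y : in_span A y -> in_span A (a *: y).
Proof.
move=> [z zA ->]; exists (a *: z); last by rewrite -scalemxAr.
by move=> i iA; rewrite mxE zA// mulr0.
Qed.

Lemma in_spanB A y y' : in_span A y -> in_span A y' -> in_span A (y - y').
Proof. by move=> Ay Ay'; rewrite -scaleN1r; apply/in_spanD/in_spanZ. Qed.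

Lemma in_span_col A i : i \in A -> in_span A (col i N).
Proof.
move=> iA; exists (delta_mx i 0); last by rewrite colE.
by move=> j jA; rewrite mxE; case: eqP => // ji; rewrite ji iA in jA.
Qed.

Lemma proj_orth A w q y : is_proj A w q -> in_span A y -> dot (w - q) y = 0.
Proof.
move=> [_ qA] [z zA ->]; rewrite dot_mulmx big1// => j _.
by have [/qA->|/zA->] := boolP (j \in A); rewrite ?mulr0 ?mul0r.
Qed.

Lemma proj_dot A w q y : is_proj A w q -> in_span A y -> dot w y = dot q y.
Proof. by move=> qA yA; apply/eqP; rewrite -subr_eq0 -dotBl (proj_orth qA). Qed.

(** Here [<q, y> = <w, y> = |y|^2], so [|q - y|^2 = |q|^2 - |y|^2]. *)
Lemma proj_norm_le A w q y : is_proj A w q -> in_span A y ->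
  dot w y = dot y y -> dot y y <= dot q q.
Proof.
move=> qA yA wy; have := dot_ge0 (q - y).
rewrite !(dotBl, dotBr) -(proj_dot qA yA) (dotC y q) -(proj_dot qA yA) wy.
by rewrite subrr subr0 subr_ge0.
Qed.

Lemma proj_norm_le_self A w q : is_proj A w q -> dot q q <= dot w w.
Proof.
move=> qA; have := dot_ge0 (w - q).
rewrite dotBr (proj_orth qA (proj1 qA)) subr0.
by rewrite dotBl [dot q w]dotC (proj_dot qA (proj1 qA)) subr_ge0.
Qed.

Lemma proj_norm_mono A B w q q' : A \subset B ->
  is_proj A w q -> is_proj B w q' -> dot q q <= dot q' q'.
Proof.
move=> AB qA q'B; apply: (proj_norm_le q'B); first exact: in_span_sub AB (proj1 qA).
by apply: (proj_dot qA); case: qA.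
Qed.

(** Gram-Schmidt: adding an index to [A] adds the multiple of the residual of
    its column that removes the remaining correlation with it. *)
Lemma proj_exists A w : exists q, is_proj A w q.
Proof.
have [k] := ubnP #|A|; elim: k => // k IH in A w *; rewrite ltnS => Ak.
have [->|/set0Pn[p pA]] := eqVneq A finset.set0.
  exists 0; split; last by move=> i; rewrite inE.
  by exists 0; [move=> i _; rewrite mxE|rewrite mulmx0].
have Apk : (#|A :\ p| < k)%N by rewrite (leq_trans _ Ak)// [#|A|](cardsD1 p) pA.
have ApA : A :\ p \subset A by exact: subsetDl.
have [q qP] := IH _ w Apk; have [g gP] := IH _ (col p N) Apk.
pose r := col p N - g.
have rA : in_span A r.
  by apply: in_spanB; [exact: in_span_col|exact: in_span_sub ApA (proj1 gP)].
have rp : dot r (col p N) = dot r r.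
  by rewrite {3}/r dotBr (proj_orth gP (proj1 gP)) subr0.
pose t := dot (w - q) r / dot r r.
exists (q + t *: r); split.
  by apply: in_spanD; [exact: in_span_sub ApA (proj1 qP)|exact: in_spanZ].
move=> i iA; rewrite opprD addrA dotBl dotZl.
have [->|ip] := eqVneq i p; last first.
  have iAp : i \in A :\ p by rewrite !inE ip.
  by rewrite (proj2 qP)// (proj2 gP)// mulr0 subr0.
have -> : dot (w - q) (col p N) = dot (w - q) r.
  by rewrite dotBr (proj_orth qP (proj1 gP)) subr0.
rewrite rp /t; have [r0|r0] := eqVneq (dot r r) 0.
  by rewrite (dot_eq0 r0) !dot0r mulr0 subr0.
by rewrite divfK// subrr.
Qed.

End Projection.

(** * One step of the walk *)

Section Steps.
Variables (K : realType) (n : nat).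
Implicit Types (X u : 'cV[K]_n) (A : {set 'I_n}) (p : 'I_n).

Lemma pivotP A p : pivot A = Some p -> p \in A /\ forall q, q \in A -> (q <= p)%N.
Proof.
rewrite /pivot; case: pickP => // x /andP[xA /forallP mx] [<-]; split => // q qA.
by have /implyP := mx q; apply.
Qed.

Lemma pivot_None A : pivot A = None -> A = finset.set0.
Proof.
rewrite /pivot; case: pickP => // noA _; apply/eqP/negPn/negP => /set0Pn[i iA].
case: (@arg_maxnP _ i (mem A) (fun j : 'I_n => j : nat) iA) => j jA jmax.
have := noA j; rewrite (jA : j \in A)/= => /forallP; apply => q.
by apply/implyP => qA; exact: jmax.
Qed.

Lemma pivot_sub A A' p : pivot A = Some p -> A' \subset A -> p \in A' ->
  pivot A' = Some p.
Proof.
move=> /pivotP[pA pmax] /fintype.subsetP A'A pA'.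
case E: (pivot A') => [p'|]; last by move/pivot_None: E pA' => ->; rewrite inE.
have [p'A' p'max] := pivotP E; congr Some; apply/val_inj/eqP.
by rewrite eqn_leq p'max// pmax// A'A.
Qed.

Definition in_cube X := forall i, `|X i 0| <= 1.

Lemma step_sizesP X u (delta : K) :
  step_sizes X u delta <-> in_cube (X + delta *: u).
Proof. by split=> H i; have := H i; rewrite ler_norml. Qed.

(** Alive coordinates are at positive distance from the faces of the cube, and
    there are finitely many of them. *)
Lemma room_to_move X u : in_cube X -> (forall i, i \notin alive X -> u i 0 = 0) ->
  exists2 delta, 0 < delta & in_cube (X + delta *: u).
Proof.
move=> cX u0.
pose f i : K := (1 - `|X i 0|) / (1 + `|u i 0|).
pose delta := \big[Num.min/1]_(i in alive X) f i.
have den i : 0 < 1 + `|u i 0| by rewrite ltr_wpDr.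
exists delta.
  rewrite lt_bigmin// => i; rewrite inE => Xi.
  by rewrite divr_gt0// subr_gt0.
move=> i; rewrite !mxE; have [iA|iA] := boolP (i \in alive X); last first.
  by rewrite u0// mulr0 addr0.
have delta0 : 0 <= delta.
  by apply: le_bigmin => // j _; rewrite divr_ge0 ?subr_ge0// ltW.
have : delta <= f i by exact: bigmin_le_cond.
rewrite ler_pdivlMr// => H.
rewrite (le_trans (ler_normD _ _))// normrM (ger0_norm delta0).
have := normr_ge0 (u i 0); nra.
Qed.

(** The largest step is attained since the cube is closed, and it freezes a
    coordinate: otherwise there would still be room to move. *)
Lemma max_step X u p : in_cube X -> p \in alive X -> `|u p 0| = 1 ->
    (forall i, i \notin alive X -> u i 0 = 0) ->
  let X' := X + `|sup (step_sizes X u)| *: u in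
  [/\ 0 < `|sup (step_sizes X u)|, in_cube X' & alive X' \proper alive X].
Proof.
move=> cX pA up u0; set S := step_sizes X u.
have S0 : S 0 by apply/step_sizesP; rewrite scale0r addr0.
have Sub : has_ubound S.
  (* The pivot coordinate moves at unit speed in an interval of length 2. *)
  exists 2 => delta /step_sizesP/(_ p); rewrite !mxE => H.
  have : `|delta| <= 2.
    rewrite -[delta]mulr1 normrM normr1 -up -normrM.
    rewrite -[delta * _](addKr (X p 0)) (le_trans (ler_normD _ _))// normrN.
    by have := cX p; lra.
  by apply: le_trans; exact: ler_norm.
have supS : has_sup S by split => //; exists 0.
have sup0 : 0 <= sup S by apply: ub_le_sup.
rewrite (ger0_norm sup0).
have cS : in_cube (X + sup S *: u).
  move=> i; rewrite !mxE; apply/ler_addgt0Pr => e e0.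
  have d0 : 0 < e / (1 + `|u i 0|) by rewrite divr_gt0// ltr_wpDr.
  have [x Sx xs] := sup_adherent d0 supS.
  have /step_sizesP/(_ i) := Sx; rewrite !mxE => Hx.
  have xs' : x <= sup S by apply: ub_le_sup.
  have -> : X i 0 + sup S * u i 0 = (X i 0 + x * u i 0) + (sup S - x) * u i 0 by ring.
  rewrite (le_trans (ler_normD _ _))// lerD// normrM ger0_norm ?subr_ge0//.
  have : sup S - x <= e / (1 + `|u i 0|) by lra.
  rewrite ler_pdivlMr ?ltr_wpDr//.
  by have := normr_ge0 (u i 0); nra.
have aS : alive (X + sup S *: u) \subset alive X.
  apply/fintype.subsetP => i; apply: contraTT => iA; rewrite inE !mxE u0//.
  by rewrite mulr0 addr0; move: iA; rewrite inE.
have aN : alive (X + sup S *: u) <> alive X.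
  (* If no coordinate froze, a longer step would be possible. *)
  move=> E; have [|e e0] := @room_to_move (X + sup S *: u) u cS.
    by rewrite E.
  rewrite -addrA -scalerDl => /step_sizesP Se.
  have : sup S + e <= sup S by apply: ub_le_sup.
  by rewrite gerDl leNgt e0.
split => //.
  rewrite lt_neqAle sup0 andbT; apply/eqP => s0.
  by apply: aN; rewrite -s0 scale0r addr0.
by rewrite finset.properEneq aS andbT; apply/eqP.
Qed.

(** The downward step along [u] is the upward step along [- u], so every fact
    about the former follows from [max_step]. *)
Lemma min_step X u : `|inf (step_sizes X u)| = `|sup (step_sizes X (- u))|.
Proof.
rewrite /inf normrN; congr (`|sup _|); apply/seteqP; split => [_ [x Sx <-]|x Sx].
  by move=> i; have := Sx i; rewrite scaleNr scalerN opprK.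
exists (- x); last by rewrite opprK.
by move=> i; have := Sx i; rewrite scaleNr scalerN.
Qed.

End Steps.

Section Direction.
Variables (K : realType) (m n : nat) (N : 'M[K]_(m, n)).

(** The minimization over feasible directions is the least squares problem
    whose solution makes [N u] the residual of the pivot column.  The minimizer
    itself need not be unique, but its image is. *)
Lemma gsw_directionP (A : {set 'I_n}) (p : 'I_n) : p \in A ->
  let u := gsw_direction N A p in
  feasible_directions A p u /\
  forall g, is_proj N (A :\ p) (col p N) g -> N *m u = col p N - g.
Proof.
move=> pA u.
have feasE g : is_proj N (A :\ p) (col p N) g ->
  exists u0, [/\ feasible_directions A p u0, N *m u0 = col p N - g &
    forall v, feasible_directions A p v ->
    dot (N *m v) (N *m v) =
      dot (N *m u0) (N *m u0) + dot (N *m (v - u0)) (N *m (v - u0))].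
  move=> gP; have [[z zA gz] _] := gP.
  (* [z] expresses the projection [g] of the pivot column in the other columns. *)
  exists (delta_mx p 0 - z); have Nu : N *m (delta_mx p 0 - z) = col p N - g.
    by rewrite mulmxBr -colE gz.
  split => //.
    split; first by rewrite !mxE eqxx/= zA ?subr0// !inE eqxx.
    move=> i iA; rewrite !mxE zA ?subr0.
      by case: eqP => // ip; rewrite ip pA in iA.
    by rewrite !inE negb_and iA orbT.
  move=> v [vp vA]; rewrite Nu.
  have -> : N *m v = (col p N - g) + N *m (v - (delta_mx p 0 - z)).
    by rewrite -Nu -mulmxDr addrC subrK.
  set y := N *m _.
  have yS : in_span N (A :\ p) y.
    eexists; last reflexivity.
    move=> i; rewrite !mxE; have [->|ip] := eqVneq i p.
      by rewrite vp zA ?inE ?eqxx//= subr0 subrr.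
    rewrite !inE ip/= => iA; rewrite vA// zA ?inE ?ip//.
    by rewrite subrr subr0.
  have := proj_orth gP yS; move: (col p N - g) => r ry.
  by rewrite !(dotDl, dotDr) (dotC y) ry addr0 add0r.
have [g gP] := proj_exists N (A :\ p) (col p N).
have l2E x y : (l2norm x <= l2norm y) = (dot x x <= dot y y :> K) :> bool.
  by rewrite -!l2norm_sqr ler_sqr// nnegrE sqrtr_ge0.
have : feasible_directions A p u /\
    forall v, feasible_directions A p v -> l2norm (N *m u) <= l2norm (N *m v).
  apply: (@getPex _ [set u | feasible_directions A p u /\ forall v,
     feasible_directions A p v -> l2norm (N *m u) <= l2norm (N *m v)]).
  have [u0 [u0f _ u0m]] := feasE _ gP; exists u0; split => // v /u0m vE.
  by rewrite l2E vE lerDl dot_ge0.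
move=> [uf um]; split => // {}g {}gP.
have [u0 [u0f <- u0m]] := feasE _ gP.
have := um _ u0f; rewrite l2E (u0m _ uf) gerDl => le0.
have : N *m (u - u0) = 0 by apply/dot_eq0/eqP; rewrite eq_le le0 dot_ge0.
by rewrite mulmxBr => /eqP; rewrite subr_eq0 => /eqP.
Qed.

End Direction.

(** * A potential for the time during which the pivot is fixed *)

Lemma expR_le_affine (K : realType) (eta t : K) : 0 <= eta <= 1 ->
  expR (eta * t) <= eta * expR t + (1 - eta).
Proof.
move=> /andP[e0 e1]; have := @expR_convex K t 0 eta (1 - eta).
by rewrite mulr0 addr0 expR0 mulr1; apply; rewrite ?subr_ge0// addrC subrK.
Qed.

(** A residual of squared norm [eta] and slope [gamma] is extended by an
    orthogonal increment of squared norm [omega] and slope [w]; the slopes are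
    averaged with weights [eta] and [omega].  For each value of the sign of mean
    [x], convexity of the exponential separates the two parts, and Hoeffding's
    inequality bounds the part of the increment by [omega]; the term
    [omega * w ^+ 2 / 2] subtracted from the offset is the cost of this bound. *)
Lemma phase_merge (K : realType) (eta omega gamma w kappa x : K) :
    0 <= eta -> 0 <= omega -> 0 < eta + omega -> `|x| <= 1 ->
  (eta + omega) *
    (expR ((eta * kappa - omega * w * x - omega * w ^+ 2 / 2) / (eta + omega)) *
     two_point_mgf ((eta * gamma + omega * w) / (eta + omega)) x) <=
  eta * (expR kappa * two_point_mgf gamma x) + omega.
Proof.
move=> e0 o0 eo x1.
set k' := _ / _; set g' := _ / _.
(* Convexity for a fixed value [s] of the sign. *)
have h (s : K) : (eta + omega) * expR (k' + s * g') <=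
    eta * expR (kappa + s * gamma) + omega * expR (s * w - w * x - w ^+ 2 / 2).
  have -> : k' + s * g' = eta / (eta + omega) * (kappa + s * gamma) +
      omega / (eta + omega) * (s * w - w * x - w ^+ 2 / 2).
    by rewrite /k' /g'; field; rewrite gt_eqF.
  rewrite mulrC -ler_pdivlMr// (le_trans (expR_convex _ _ _ _ _))//.
  - by rewrite divr_ge0// ltW.
  - by rewrite divr_ge0// ltW.
  - by rewrite -mulrDl divff// gt_eqF.
  - by rewrite mulrDl mulrAC (mulrAC omega).
have split_mgf (k g : K) : expR k * two_point_mgf g x =
    (1 + x) / 2 * expR (k + 1 * g) + (1 - x) / 2 * expR (k + -1 * g).
  by rewrite /two_point_mgf mul1r mulN1r !expRD; ring.
rewrite !split_mgf.
have hoeff : (1 + x) / 2 * expR (1 * w - w * x - w ^+ 2 / 2) +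
    (1 - x) / 2 * expR (-1 * w - w * x - w ^+ 2 / 2) <= 1.
  have := two_point_mgf_le x w.
  rewrite -(@ler_pM2l _ (expR (- (w * x + w ^+ 2 / 2)))) ?expR_gt0//.
  rewrite -expRD addNr expR0; apply: le_trans; rewrite split_mgf.
  by rewrite [- _ + 1 * w](_ : _ = 1 * w - w * x - w ^+ 2 / 2);
    [rewrite [- _ + -1 * w](_ : _ = -1 * w - w * x - w ^+ 2 / 2)|]; rewrite //; ring.
have := h 1; have := h (-1).
move: hoeff; rewrite ler_norml in x1; case/andP: x1 => x1 x2.
set a := expR _; set b := expR _; set c := expR _; set d := expR _; set e := expR _.
set f := expR _ => H1 H2 H3.
have X1 : 0 <= (1 + x) / 2 by lra.
have X2 : 0 <= (1 - x) / 2 by lra.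
have := ler_wpM2l X1 H3; have := ler_wpM2l X2 H2; have := ler_wpM2l o0 H1.
move: ((1 + x) / 2) ((1 - x) / 2) => y z; lra.
Qed.

Lemma gsw_expect_from_ge0 (K : realType) (m n : nat) (N : 'M[K]_(m, n))
    (f : 'cV[K]_n -> K) k X :
  (forall x, 0 <= f x) -> 0 <= gsw_expect_from N f k X.
Proof.
move=> f0; elim: k X => [|k IH] X //=; case: pivot => // p.
by rewrite addr_ge0// mulr_ge0// divr_ge0// addr_ge0.
Qed.

Section Potential.
Variables (K : realType) (m n : nat) (N : 'M[K]_(m, n)) (v : 'cV[K]_m).
Hypothesis col_le1 : forall j, dot (col j N) (col j N) <= 1.
Implicit Types (X : 'cV[K]_n) (A : {set 'I_n}) (p : 'I_n).

Let mgf k X := gsw_expect_from N (fun x => expR (dot v (N *m x))) k X.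

(** The potential while [p] is the pivot and [A] the alive set.  Here [e] stands
    for the conditional expectation of [exp <v, N x>] at the final state [x], [q]
    is the part of [v] that the alive columns other than [p] can still reach, and
    [r] is the residual along which [N X] moves, and [gamma] is the coefficient
    of [v] along [r].  The last factor mixes the
    moment generating function of a sign of mean [X p], of weight [|r|^2], with
    the constant 1.  The offset [kappa] is arbitrary because a later alive set
    requires the claim with an offset that depends on the current [X p]. *)
Definition phase_claim A p X (e : K) := forall q g r (gamma kappa : K),
  is_proj N (A :\ p) v q -> is_proj N (A :\ p) (col p N) g ->
  r = col p N - g -> dot v r = dot r r * gamma ->
  expR (dot r r * kappa + dot r r * gamma * X p 0) * e <=
  expR (dot v (N *m X) + dot q q / 2) *
    (dot r r * (expR kappa * two_point_mgf gamma (X p 0)) + (1 - dot r r)).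

Definition phase_bound k X := in_cube X ->
  forall p, pivot (alive X) = Some p -> phase_claim (alive X) p X (mgf k X).

Definition total_bound k X := in_cube X ->
  forall q, is_proj N (alive X) v q ->
  mgf k X <= expR (dot v (N *m X) + dot q q / 2).

Lemma residual_norm A p g : is_proj N A (col p N) g ->
  0 <= dot (col p N - g) (col p N - g) <= 1.
Proof.
move=> gP; rewrite dot_ge0/= (le_trans _ (col_le1 p))// -subr_ge0.
have := proj_dot gP (proj1 gP).
rewrite !(dotBl, dotBr) [dot g (col p N)]dotC => ->.
by rewrite subrr subr0 opprB addrC subrK dot_ge0.
Qed.

(** Since [|r| <= 1], Jensen's inequality bounds the prefactor of the claim by
    its mixture; this is the claim once the pivot is frozen. *)
Lemma phase_claim_at_stop A p X g r (gamma kappa : K) : in_cube X ->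
  is_proj N A (col p N) g -> r = col p N - g ->
  expR (dot r r * kappa + dot r r * gamma * X p 0) <=
    dot r r * (expR kappa * two_point_mgf gamma (X p 0)) + (1 - dot r r).
Proof.
move=> cX gP rE.
have r01 := residual_norm gP; rewrite -rE in r01.
rewrite -mulrA -mulrDr (le_trans (expR_le_affine _ r01))// lerD2r.
rewrite ler_wpM2l ?dot_ge0// expRD ler_wpM2l ?expR_ge0//.
exact: two_point_mgf_ge.
Qed.

(** The offset [- (gamma * x + gamma ^+ 2 / 2)] normalizes the sign part of the
    mixture to at most 1 by Hoeffding's inequality.  What remains is
    [|q'|^2 + |r|^2 * gamma^2], the squared norm of a vector of the alive span,
    bounded by that of the projection of [v]. *)
Lemma total_bound_of_phase k X : phase_bound k X -> total_bound k X.
Proof.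
move=> ph cX q qP.
case E : (pivot (alive X)) => [p|]; last first.
  have -> : mgf k X = expR (dot v (N *m X)).
    by rewrite /mgf; case: k {ph} => //= k; rewrite E.
  by rewrite ler_expR lerDl divr_ge0 ?dot_ge0.
have [pA _] := pivotP E.
have [q' q'P] := proj_exists N (alive X :\ p) v.
have [g gP] := proj_exists N (alive X :\ p) (col p N).
pose r := col p N - g; pose gamma := dot v r / dot r r.
have vr : dot v r = dot r r * gamma.
  rewrite /gamma; have [r0|r0] := eqVneq (dot r r) 0.
    by rewrite (dot_eq0 r0) !dot0r mul0r.
  by rewrite mulrC divfK.
have := ph cX p E q' g r gamma (- (gamma * X p 0 + gamma ^+ 2 / 2)) q'P gP erefl vr.
set e := expR _; set f := expR _.
have ge1 : 0 <= dot r r <= 1 by exact: residual_norm gP.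
set b := (X in f * X) => H.
have b1 : b <= 1.
  have h1 : expR (- (gamma * X p 0 + gamma ^+ 2 / 2)) * two_point_mgf gamma (X p 0) <= 1.
    rewrite expRN ler_pdivrMl ?expR_gt0// mulr1; exact: two_point_mgf_le.
  have := ler_wpM2l (dot_ge0 r) h1; rewrite /b; lra.
have {b1}H : e * mgf k X <= f.
  by rewrite (le_trans H)// ler_piMr// expR_ge0.
have -> : mgf k X = expR (dot r r * gamma ^+ 2 / 2) * (e * mgf k X).
  by rewrite mulrA /e -expRD [X in expR X](_ : _ = 0) ?expR0 ?mul1r//; field.
rewrite (le_trans (ler_wpM2l (expR_ge0 _) H))// /f -expRD ler_expR addrCA lerD2l.
rewrite -mulrDl ler_pM2r ?invr_gt0//.
have grS : in_span N (alive X) (q' + gamma *: r).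
  have sub : alive X :\ p \subset alive X by exact: subsetDl.
  apply: in_spanD; first exact: in_span_sub sub (proj1 q'P).
  by apply/in_spanZ/in_spanB; [exact: in_span_col|exact: in_span_sub sub (proj1 gP)].
have rq : dot q' r = 0 by rewrite dotC (proj_orth gP (proj1 q'P)).
have nE : dot (q' + gamma *: r) (q' + gamma *: r) = dot r r * gamma ^+ 2 + dot q' q'.
  move: (r) rq => s sq.
  by rewrite !(dotDl, dotDr, dotZl, dotZr) (dotC s) sq; ring.
rewrite -nE; apply: (proj_norm_le qP grS).
by rewrite nE dotDr dotZr vr (proj_dot q'P (proj1 q'P)); ring.
Qed.

(** The claim for the alive set before a step follows from the bounds for the
    alive set after it.  If [p] is frozen, the total bound applies, and the
    projection of [v] only shrank.  Otherwise the residual grows by an increment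
    [w] orthogonal to [r] and lying in the old span; [phase_merge] handles the
    mixture at the cost [|w|^2 * c^2 / 2], where [c] is the slope of [v] along
    [w], and this is at most half of the decrease [|q|^2 - |q'|^2] because [w] is
    orthogonal to [q']. *)
Lemma phase_claim_move k X A p : total_bound k X -> phase_bound k X ->
  in_cube X -> pivot A = Some p -> alive X \subset A -> phase_claim A p X (mgf k X).
Proof.
move=> tot ph cX Ap AX q g r gamma kappa qP gP rE vr.
have r01 : 0 <= dot r r <= 1 by rewrite rE; exact: residual_norm gP.
have [pX|pX] := boolP (p \in alive X); last first.
  have [q' q'P] := proj_exists N (alive X) v.
  have sub : alive X \subset A :\ p.
    apply/fintype.subsetP => i iX; rewrite !inE (fintype.subsetP AX)// andbT.
    by apply: contraNneq pX => <-.
  have qq := proj_norm_mono sub q'P qP.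
  rewrite mulrC; apply: ler_pM; rewrite ?expR_ge0//.
  - by apply: gsw_expect_from_ge0 => x; exact: expR_ge0.
  - by rewrite (le_trans (tot cX q' q'P))// ler_expR lerD2l ler_pM2r ?invr_gt0.
  - exact: phase_claim_at_stop cX gP _.
have Xp := pivot_sub Ap AX pX.
have sub : alive X :\ p \subset A :\ p by exact: finset.setSD.
have [q' q'P] := proj_exists N (alive X :\ p) v.
have [g' g'P] := proj_exists N (alive X :\ p) (col p N).
pose r' := col p N - g'; pose w := r' - r.
have wE : w = g - g' by rewrite /w /r' rE opprB addrC addrA subrK.
have wS : in_span N (A :\ p) w.
  by rewrite wE; apply: in_spanB; [case: gP|exact: in_span_sub sub (proj1 g'P)].
have rw : dot r w = 0 by rewrite rE; exact: proj_orth gP wS.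
have r'E : dot r' r' = dot r r + dot w w.
  have -> : r' = r + w by rewrite /w addrC subrK.
  move: (r) (w) rw => s t st.
  by rewrite !(dotDl, dotDr) (dotC t) st; ring.
have q'w : dot q' w = 0.
  have q'r' : dot q' r' = 0 by rewrite dotC (proj_orth g'P (proj1 q'P)).
  have q'r : dot q' r = 0.
    by rewrite dotC rE (proj_orth gP (in_span_sub sub (proj1 q'P))).
  by rewrite /w dotBr q'r' q'r subrr.
have vw : dot v w = dot (q - q') w by rewrite dotBl q'w subr0 (proj_dot qP wS).
have qq' : dot (q - q') (q - q') = dot q q - dot q' q'.
  rewrite !(dotBl, dotBr) (dotC q' q).
  have -> : dot q q' = dot q' q'; last by ring.
  by rewrite -(proj_dot qP (in_span_sub sub (proj1 q'P))) (proj_dot q'P (proj1 q'P)).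
pose c := dot v w / dot w w.
have vc : dot v w = dot w w * c.
  rewrite /c; have [w0|w0] := eqVneq (dot w w) 0.
    by rewrite (dot_eq0 w0) !dot0r mul0r.
  by rewrite mulrC divfK.
(* The projection of [v] loses at least its component along [w]. *)
have qc : dot q' q' + dot w w * c ^+ 2 <= dot q q.
  rewrite -lerBrDl -qq'; have [w0|w0] := eqVneq (dot w w) 0.
    by rewrite w0 mul0r dot_ge0.
  rewrite -(@ler_pM2r _ (dot w w)); last by rewrite lt_neqAle eq_sym w0 dot_ge0.
  have := cauchy_schwarz (q - q') w; rewrite -vw vc.
  by congr (_ <= _); ring.
(* A vanishing new residual forces [r = w = 0], and the sign part of both
   mixtures disappears. *)
have [r'0|r'0] := eqVneq (dot r' r') 0.
  have [r0 w0] : dot r r = 0 /\ dot w w = 0.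
    have := dot_ge0 r; have := dot_ge0 w; rewrite r'E in r'0; lra.
  have := ph cX p Xp q' g' r' 0 0 q'P g'P erefl; rewrite r'0 (dot_eq0 r'0) dot0r mulr0.
  move=> /(_ erefl); rewrite r0 !(mul0r, add0r, expR0, mul1r, mulr1) subr0 !mulr1.
  move=> H; rewrite (le_trans H)// ler_expR lerD2l ler_pM2r ?invr_gt0//.
  by rewrite w0 mul0r addr0 in qc.
have r'p : 0 < dot r r + dot w w by rewrite -r'E lt_neqAle eq_sym r'0 dot_ge0.
have vr' : dot v r' = dot r' r' * ((dot r r * gamma + dot w w * c) / dot r' r').
  rewrite mulrC divfK// -vr -vc -dotDr /w addrC subrK//.
have := ph cX p Xp q' g' r' _
  ((dot r r * kappa - dot w w * c * X p 0 - dot w w * c ^+ 2 / 2) / dot r' r')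
  q'P g'P erefl vr'.
set e := mgf k X => H.
have := phase_merge gamma c kappa (dot_ge0 r) (dot_ge0 w) r'p (cX p).
rewrite -r'E => M.
have {}H : expR (dot r r * kappa + dot r r * gamma * X p 0 - dot w w * c ^+ 2 / 2) * e <=
   expR (dot v (N *m X) + dot q' q' / 2) *
     (dot r r * (expR kappa * two_point_mgf gamma (X p 0)) + (1 - dot r r)).
  move: H; rewrite [X in expR X * e](_ : _ =
    dot r r * kappa + dot r r * gamma * X p 0 - dot w w * c ^+ 2 / 2).
    move=> H; rewrite (le_trans H)// ler_wpM2l ?expR_ge0//.
    rewrite (le_trans (_ : _ <= dot r r * (expR kappa * two_point_mgf gamma (X p 0)) +
      dot w w + (1 - dot r' r')))// ?lerD2r// r'E; lra.
  by field.
have -> : expR (dot r r * kappa + dot r r * gamma * X p 0) =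
  expR (dot w w * c ^+ 2 / 2) *
  expR (dot r r * kappa + dot r r * gamma * X p 0 - dot w w * c ^+ 2 / 2).
  by rewrite -expRD; congr expR; ring.
rewrite -mulrA (le_trans (ler_wpM2l (expR_ge0 _) H))// [leLHS]mulrA -expRD ler_wpM2r//.
  by apply: le_trans (phase_claim_at_stop gamma kappa cX gP rE); exact: expR_ge0.
rewrite ler_expR; lra.
Qed.

End Potential.

(** * Law and subgaussianity of the walk *)

Section Walk.
Variables (K : realType) (m n : nat) (N : 'M[K]_(m, n)).
Implicit Types (X : 'cV[K]_n) (p : 'I_n).

Lemma gsw_step X p : in_cube X -> pivot (alive X) = Some p ->
  exists u dp dm, [/\ feasible_directions (alive X) p u,
    forall g, is_proj N (alive X :\ p) (col p N) g -> N *m u = col p N - g,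
    0 < dp, 0 < dm &
    [/\ in_cube (X + dp *: u), in_cube (X - dm *: u),
    alive (X + dp *: u) \proper alive X, alive (X - dm *: u) \proper alive X &
    forall f k, gsw_expect_from N f k.+1 X =
      dm / (dm + dp) * gsw_expect_from N f k (X + dp *: u) +
      dp / (dm + dp) * gsw_expect_from N f k (X - dm *: u)]].
Proof.
move=> cX E; have [pA _] := pivotP E.
have [uf ur] := gsw_directionP N pA.
set u := gsw_direction _ _ _ in uf ur.
exists u, `|sup (step_sizes X u)|, `|inf (step_sizes X u)|.
have [up u0] := uf.
have [|dp0 cp ap] := max_step cX pA _ u0; first by rewrite up normr1.
have [||dm0 cm am] := @max_step _ _ X (- u) p cX pA.
- by rewrite mxE normrN up normr1.
- by move=> i iA; rewrite mxE u0// oppr0.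
rewrite min_step; rewrite -min_step scalerN in dm0 cm am *.
split => //; split => //.
by move=> f k /=; rewrite E.
Qed.

Lemma stopped_sign X : in_cube X -> alive X = finset.set0 -> sign_vectors X.
Proof.
move=> cX A0 i; have : i \notin alive X by rewrite A0 inE.
rewrite inE -leNgt => X1; have {X1} : `|X i 0| = 1 by apply/eqP; rewrite eq_le cX X1.
by case: (ger0P (X i 0)) => _; [left|right; lra].
Qed.

Lemma gsw_law_from k X : in_cube X -> (#|alive X| <= k)%N ->
  exists s : seq (K * 'cV[K]_n),
    (forall c, c \in s -> 0 <= c.1 /\ sign_vectors c.2) /\
    forall f, gsw_expect_from N f k X = \sum_(c <- s) c.1 * f c.2.
Proof.
have stop X' : in_cube X' -> alive X' = finset.set0 ->
    forall c, c \in [:: (1 : K, X')] -> 0 <= c.1 /\ sign_vectors c.2.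
  by move=> cX' A0 c; rewrite inE => /eqP -> /=; split => //; exact: stopped_sign.
elim: k X => [|k IH] X cX.
  rewrite leqn0 cards_eq0 => /eqP A0; exists [:: (1, X)]; split; first exact: stop.
  by move=> f; rewrite big_seq1/= mul1r.
case E : (pivot (alive X)) => [p|] Xk; last first.
  exists [:: (1, X)]; split; first exact/stop/pivot_None.
  by move=> f; rewrite big_seq1/= E mul1r.
have [u [dp [dm [_ _ dp0 dm0 [cp cm ap am fE]]]]] := gsw_step cX E.
have [||s1 [s1P s1E]] := IH (X + dp *: u) => //.
  by rewrite -ltnS (leq_trans (proper_card ap)).
have [||s2 [s2P s2E]] := IH (X - dm *: u) => //.
  by rewrite -ltnS (leq_trans (proper_card am)).
exists ([seq (dm / (dm + dp) * c.1, c.2) | c <- s1] ++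
        [seq (dp / (dm + dp) * c.1, c.2) | c <- s2]); split.
  move=> c; rewrite mem_cat => /orP[] /mapP[c' c's ->]/=.
    have [c'0 ?] := s1P c' c's; split => //.
    by rewrite mulr_ge0// divr_ge0// ?addr_ge0// ltW.
  have [c'0 ?] := s2P c' c's; split => //.
  by rewrite mulr_ge0// divr_ge0// ?addr_ge0// ltW.
move=> f; rewrite fE s1E s2E big_cat/= !big_map/= !mulr_sumr.
by congr (_ + _); apply: eq_bigr => c _; rewrite mulrA.
Qed.

Lemma gsw_expect_from_cst k X : in_cube X -> gsw_expect_from N (fun=> 1) k X = 1.
Proof.
elim: k X => // k IH X cX; case E : (pivot (alive X)) => [p|]; last by rewrite /= E.
have [u [dp [dm [_ _ dp0 dm0 [cp cm _ _ ->]]]]] := gsw_step cX E.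
by rewrite !IH// !mulr1 -mulrDl divff// gt_eqF// addr_gt0.
Qed.

Lemma in_cube0 : in_cube (0 : 'cV[K]_n).
Proof. by move=> i; rewrite mxE normr0. Qed.

(** The output of the walk has a finitely supported law, so that its
    expectations are finite sums that commute with integrals over the randomness
    of the Gaussian matrix. *)
Lemma gsw_law : exists (k : nat) (w : 'I_k -> K) (x : 'I_k -> 'cV[K]_n),
  [/\ forall i, 0 <= w i, forall i, sign_vectors (x i), \sum_i w i = 1 &
  forall f, gsw_expect N f = \sum_i w i * f (x i)].
Proof.
have [|s [sP sE]] := @gsw_law_from n 0 in_cube0.
  by rewrite (leq_trans (max_card _))// card_ord.
exists (size s), (fun i => (tnth (in_tuple s) i).1), (fun i => (tnth (in_tuple s) i).2).
have E f : gsw_expect N f =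
    \sum_(i < size s) (tnth (in_tuple s) i).1 * f (tnth (in_tuple s) i).2.
  by rewrite /gsw_expect sE big_tnth.
split => //.
- by move=> i; have [] := sP _ (mem_tnth i (in_tuple s)).
- by move=> i; have [] := sP _ (mem_tnth i (in_tuple s)).
rewrite -(gsw_expect_from_cst n in_cube0) [RHS]E.
by apply: eq_bigr => i _; rewrite mulr1.
Qed.

Hypothesis col_le1 : forall j, dot (col j N) (col j N) <= 1.
Variable v : 'cV[K]_m.

(** Induction on the number of remaining steps.  Within a step [N X] moves by
    [delta * r] and [X p] by [delta], so that [exp (<v, N X> - |r|^2 * gamma * X p)]
    does not change, and the last factor of the claim is affine in [X p], whose
    expected change is zero. *)
Lemma phase_boundP k X : phase_bound N v k X.
Proof.
elim: k X => [|k IH] X cX p E q g r gamma kappa qP gP rE vr.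
  have R := phase_claim_at_stop col_le1 gamma kappa cX gP rE.
  rewrite [leLHS]mulrC /= [expR (dot v _ + _)]expRD -[leRHS]mulrA.
  rewrite ler_wpM2l ?expR_ge0// (le_trans R)//.
  rewrite ler_peMl ?(le_trans (expR_ge0 _) R)// -expR0 ler_expR.
  by rewrite divr_ge0 ?dot_ge0.
have [u [dp [dm [[up u0] uE dp0 dm0 [cp cm ap am ->]]]]] := gsw_step cX E.
have tot Y := total_bound_of_phase col_le1 (IH Y).
have step Y : in_cube Y -> alive Y \proper alive X -> phase_claim N v (alive X) p Y _ :=
  fun cY aY => phase_claim_move col_le1 (tot Y) (IH Y) cY E (proper_sub aY).
have H d : in_cube (X + d *: u) -> alive (X + d *: u) \proper alive X ->
  expR (dot r r * kappa + dot r r * gamma * X p 0) *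
   gsw_expect_from N (fun x => expR (dot v (N *m x))) k (X + d *: u) <=
  expR (dot v (N *m X) + dot q q / 2) *
    (dot r r * (expR kappa * two_point_mgf gamma (X p 0 + d)) + (1 - dot r r)).
  move=> cd ad; have := step _ cd ad q g r gamma kappa qP gP rE vr.
  rewrite !mxE up mulr1 mulmxDr -scalemxAr (uE g gP) -rE dotDr dotZr vr.
  have -> : expR (dot r r * kappa + dot r r * gamma * (X p 0 + d)) =
      expR (dot r r * gamma * d) * expR (dot r r * kappa + dot r r * gamma * X p 0).
    by rewrite -expRD; congr expR; ring.
  have -> : expR (dot v (N *m X) + d * (dot r r * gamma) + dot q q / 2) =
      expR (dot r r * gamma * d) * expR (dot v (N *m X) + dot q q / 2).
    by rewrite -expRD; congr expR; ring.
  by rewrite -[leLHS]mulrA -[leRHS]mulrA ler_pM2l ?expR_gt0.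
have Hp := H dp cp ap; have Hm : _ := H (- dm) _ _.
rewrite scaleNr in Hm; have {Hm} := Hm cm am.
move: Hp; set a := expR _; set b := expR (dot v _ + _).
set ep := gsw_expect_from _ _ _ _; set em := gsw_expect_from _ _ _ _.
move=> Hp Hm.
have wp : 0 <= dm / (dm + dp) by rewrite divr_ge0// ?addr_ge0// ltW.
have wm : 0 <= dp / (dm + dp) by rewrite divr_ge0// ?addr_ge0// ltW.
rewrite mulrDr mulrCA [a * _ in X in _ + X]mulrCA.
rewrite (le_trans (lerD (ler_wpM2l wp Hp) (ler_wpM2l wm Hm)))//.
rewrite le_eqVlt; apply/orP; left; apply/eqP.
rewrite /two_point_mgf; field.
by rewrite gt_eqF// addr_gt0.
Qed.

Theorem gsw_subgaussian :
  gsw_expect N (fun x => expR (dot v (N *m x))) <= expR (dot v v / 2).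
Proof.
have [q qP] := proj_exists N (alive (0 : 'cV[K]_n)) v.
have := total_bound_of_phase col_le1 (@phase_boundP n 0) in_cube0 qP.
rewrite mulmx0 dot0r add0r => H; rewrite (le_trans H)// ler_expR.
by rewrite ler_pM2r ?invr_gt0// (proj_norm_le_self qP).
Qed.

End Walk.

(** * Gaussian moment generating functions *)

Section Mbar.
Variables (K : realType) (d n : nat) (M : 'M[K]_(d, n)).
Hypothesis colM : forall j, l2norm (col j M) <= 1.

Lemma dot_col_mx (a b : 'cV[K]_d) (x y : 'cV[K]_n) :
  dot (col_mx a x) (col_mx b y) = dot a b + dot x y.
Proof.
rewrite /dot big_split_ord/=; congr (_ + _); apply: eq_bigr => i _.
  by rewrite !col_mxEu.
by rewrite !col_mxEd.
Qed.

Lemma Mbar_col_le1 j : dot (col j (Mbar M)) (col j (Mbar M)) <= 1.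
Proof.
have -> : col j (Mbar M) = (Num.sqrt 2)^-1 *: col_mx (col j M) (delta_mx j 0).
  rewrite /Mbar linearZ/=; congr (_ *: _); rewrite colE mul_col_mx -colE.
  by rewrite mul1mx.
rewrite dotZl dotZr mulrA -expr2 exprVn sqr_sqrtr// dot_col_mx.
have h1 : dot (col j M) (col j M) <= 1.
  by rewrite -l2norm_sqr expr_le1// ?sqrtr_ge0.
have -> : dot (delta_mx j 0 : 'cV[K]_n) (delta_mx j 0) = 1.
  rewrite /dot (bigD1 j)//= big1 => [|i ij].
    by rewrite !mxE !eqxx/= mulr1 addr0.
  by rewrite !mxE (negbTE ij)/= mul0r.
lra.
Qed.

Lemma dot_Mbar (a : 'cV[K]_d) (b x : 'cV[K]_n) :
  dot (Num.sqrt 2 *: col_mx a b) (Mbar M *m x) = dot a (M *m x) + dot b x.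
Proof.
rewrite /Mbar -scalemxAl mul_col_mx mul1mx dotZl dotZr mulrA divff ?mul1r ?dot_col_mx//.
Qed.

(** The factor [2^(-1/2)] in [Mbar M] normalizes its columns and is absorbed by
    the test vector, which turns [|v|^2 / 2] into [|a|^2 + |b|^2]. *)
Lemma Mbar_mgf (a : 'cV[K]_d) (b : 'cV[K]_n) :
  gsw_expect (Mbar M) (fun x => expR (dot a (M *m x) + dot b x)) <=
  expR (dot a a + dot b b).
Proof.
have := gsw_subgaussian Mbar_col_le1 (Num.sqrt 2 *: col_mx a b).
under [X in gsw_expect _ X]eq_fun do rewrite dot_Mbar.
rewrite dotZl dotZr mulrA -expr2 sqr_sqrtr// dot_col_mx.
by rewrite mulrAC divff// mul1r.
Qed.

End Mbar.

Section GaussianMgf.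
Variable K : realType.
Notation mu := (@lebesgue_measure K).

Lemma normal_peakE (s : K) : 0 < s -> normal_peak s = (Num.sqrt (pi *+ 2))^-1 / s.
Proof.
move=> s0; rewrite /normal_peak -mulrnAr sqrtrM ?sqr_ge0// sqrtr_sqr.
by rewrite gtr0_norm// invfM mulrC.
Qed.

Local Open Scope ereal_scope.

Lemma integral_scaled_normal_pdf (m s C : K) (f : K -> K) : (s != 0)%R -> (0 <= C)%R ->
  (forall x, f x = C * normal_pdf m s x)%R -> \int[mu]_x (f x)%:E = C%:E.
Proof.
move=> s0 C0 fE; under eq_integral do rewrite fE EFinM.
rewrite ge0_integralZl//.
- by rewrite integral_normal_pdf mule1.
- by apply/measurable_EFinP; exact: measurable_normal_pdf.
- by move=> x _; rewrite lee_fin normal_pdf_ge0.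
Qed.

(** Completing the square, the integrand is a multiple of the density of the
    normal law of mean [c]. *)
Lemma normal_mgf (c : K) :
  \int[mu]_x (expR (c * x) * normal_pdf 0 1 x)%:E = (expR (c ^+ 2 / 2))%:E.
Proof.
apply: (@integral_scaled_normal_pdf c 1) => // x.
rewrite !normal_pdfE// mulrCA [RHS]mulrCA; congr (_ * _)%R.
by rewrite /normal_fun -!expRD; congr expR; rewrite !expr1n; field.
Qed.

(** The integrand is [s] times the centred normal density of variance
    [s ^+ 2 = (1 - 2 c)^-1], and [s <= 1 + 2 c] on the given range. *)
Lemma normal_square_mgf (c : K) : (0 <= c <= 4^-1)%R ->
  \int[mu]_x (expR (c * x ^+ 2) * normal_pdf 0 1 x)%:E <= (1 + 2 * c)%:E.
Proof.
move=> /andP[c0 c4].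
have q0 : (0 < 1 - 2 * c)%R by lra.
pose s := ((Num.sqrt (1 - 2 * c))^-1)%R.
have s0 : (0 < s)%R by rewrite invr_gt0 sqrtr_gt0.
have s2 : (s ^+ 2 = (1 - 2 * c)^-1)%R by rewrite /s exprVn sqr_sqrtr// ltW.
rewrite (@integral_scaled_normal_pdf 0 s s) ?gt_eqF ?(ltW s0)//.
  rewrite lee_fin -ler_sqr ?nnegrE ?(ltW s0)//; last lra.
  rewrite s2 -[leLHS]mul1r ler_pdivrMr//.
  have c2 : (c ^+ 2 <= c * 4^-1)%R by rewrite expr2 ler_wpM2l.
  nra.
move=> x; rewrite !normal_pdfE ?gt_eqF// mulrCA.
rewrite /normal_fun /normal_peak [RHS]mulrA; congr (_ * _)%R.
  rewrite -!mulrnAr expr1n mul1r sqrtrM ?sqr_ge0// sqrtr_sqr gtr0_norm// invfM.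
  by rewrite mulrA divff ?gt_eqF// mul1r.
rewrite -expRD; congr expR; rewrite s2 expr1n !subr0.
by field; rewrite gt_eqF.
Qed.

End GaussianMgf.

(** * Finitely supported subgaussian laws *)

Section FiniteSubgaussian.
Variables (K : realType) (I : finType) (w z : I -> K) (tau : K).
Hypothesis w0 : forall i, 0 <= w i.
Hypothesis mgf : forall l, \sum_i w i * expR (l * z i) <= expR (l ^+ 2 * tau).

(** Linearization of the square: [exp (theta z^2)] is the mean of
    [exp (sqrt (2 theta) z g)] over a standard Gaussian [g].  Summing over [i]
    first leaves the exponential moment of a multiple of [g ^+ 2]. *)
Lemma subgaussian_square_mgf (theta : K) :
    0 <= tau -> 0 <= theta -> 8 * (theta * tau) <= 1 ->
  \sum_i w i * expR (theta * z i ^+ 2) <= 1 + 4 * (theta * tau).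
Proof.
move=> tau0 theta0 small.
(* [c ^+ 2 / 2 = theta], so that [normal_mgf] produces [exp (theta z^2)]. *)
pose c := Num.sqrt (2 * theta).
have c2 : c ^+ 2 = 2 * theta by rewrite /c sqr_sqrtr// mulr_ge0.
pose F i x := w i * (expR (c * z i * x) * normal_pdf 0 1 x).
have F0 i x : 0 <= F i x by rewrite !mulr_ge0 ?expR_ge0 ?normal_pdf_ge0.
have mE (a : K) : measurable_fun setT (fun x : K => expR (a * x)).
  by apply: measurableT_comp => //; exact: mulrl_measurable.
have mF i : measurable_fun setT (F i).
  apply: measurable_funM => //; apply: measurable_funM => //.
  exact: measurable_normal_pdf.
have intF i : (\int[lebesgue_measure]_x (F i x)%:E = (w i * expR (theta * z i ^+ 2))%:E)%E.
  under eq_integral do rewrite /F EFinM.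
  rewrite ge0_integralZl//.
  - by rewrite normal_mgf -EFinM exprMn c2; congr (_ * expR _)%:E; field.
  - apply/measurable_EFinP.
    by apply: measurable_funM; [exact: mE|exact: measurable_normal_pdf].
  - by move=> x _; rewrite lee_fin mulr_ge0 ?expR_ge0 ?normal_pdf_ge0.
  - by rewrite lee_fin.
rewrite -lee_fin -sumEFin; under eq_bigr do rewrite -intF.
rewrite -ge0_integral_sum//; last 2 first.
- by move=> i; apply/measurable_EFinP; exact: mF.
- by move=> i x _; rewrite lee_fin.
have -> : 1 + 4 * (theta * tau) = 1 + 2 * (2 * theta * tau) by ring.
apply: le_trans (normal_square_mgf _); last first.
  by rewrite !mulr_ge0//=; lra.
apply: ge0_le_integral => //.
- by move=> x _; apply: sume_ge0 => i _; rewrite lee_fin.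
- by apply: emeasurable_sum => i; apply/measurable_EFinP; exact: mF.
- apply/measurable_EFinP/measurable_funM; last exact: measurable_normal_pdf.
  apply: measurableT_comp => //; exact: measurable_funM.
move=> x _; rewrite sumEFin lee_fin /F.
have -> : \sum_i w i * (expR (c * z i * x) * normal_pdf 0 1 x) =
    (\sum_i w i * expR (c * x * z i)) * normal_pdf 0 1 x.
  by rewrite mulr_suml; apply: eq_bigr => i _; rewrite mulrA [c * z i * x]mulrAC.
rewrite ler_wpM2r ?normal_pdf_ge0//.
rewrite (le_trans (mgf _))// ler_expR exprMn c2.
by rewrite le_eqVlt; apply/orP; left; apply/eqP; ring.
Qed.

(** Each of the two tails is bounded with the optimal parameter
    [l = a / (2 tau)]. *)
Lemma chernoff (a : K) : 0 < tau -> 0 <= a ->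
  \sum_(i | a <= `|z i|) w i <= 2 * expR (- (a ^+ 2 / (4 * tau))).
Proof.
move=> tau0 a0; pose l := a / (2 * tau).
have l0 : 0 <= l by rewrite divr_ge0// mulr_ge0// ltW.
have tail (b : bool) : \sum_(i | a <= (-1) ^+ b * z i) w i <= expR (- (a ^+ 2 / (4 * tau))).
  apply: (@le_trans _ _ (expR (- (l * a)) * \sum_i w i * expR (l * (-1) ^+ b * z i))).
    rewrite mulr_sumr [leLHS]big_mkcond/=; apply: ler_sum => i _.
    have e0 : 0 <= expR (- (l * a)) * (w i * expR (l * (-1) ^+ b * z i)).
      by rewrite !mulr_ge0 ?expR_ge0.
    case: ifP => // ai; rewrite mulrCA -expRD ler_peMr// -[X in X <= _]expR0 ler_expR.
    by rewrite addrC subr_ge0 -mulrA ler_wpM2l.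
  rewrite (le_trans (ler_wpM2l (expR_ge0 _) (mgf _)))// -expRD ler_expR.
  rewrite le_eqVlt; apply/orP; left; apply/eqP.
  by rewrite exprMn sqrr_sign mulr1 /l; field; rewrite gt_eqF.
rewrite mulr_natl mulr2n; apply: le_trans (lerD (tail false) (tail true)).
rewrite [leLHS]big_mkcond [X in _ <= X + _]big_mkcond [X in _ <= _ + X]big_mkcond.
rewrite -big_split/=; apply: ler_sum => i _.
rewrite expr0 mul1r expr1 mulN1r.
have [zi|zi] := ger0P (z i).
  by case: ifP => _; rewrite ?add0r ?lerDl; case: ifP.
by case: ifP => _; rewrite ?addr0 ?lerDr; case: ifP.
Qed.

End FiniteSubgaussian.

(** * Densities and affine changes of variable *)

Section Density.
Context d (T : measurableType d) (K : realType).
Variables (mu nu : {measure set T -> \bar K}) (p : T -> K).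
Hypotheses (mp : measurable_fun setT p) (p0 : forall x, 0 <= p x).
Hypothesis nuE : forall A, measurable A -> nu A = (\int[mu]_(x in A) (p x)%:E)%E.
Local Open Scope ereal_scope.

Import HBNNSimple.

Let integral_density_nnsfun (h : {nnsfun T >-> K}) :
  \int[nu]_x (h x)%:E = \int[mu]_x ((h x)%:E * (p x)%:E).
Proof.
have mpE : measurable_fun setT (fun x => (p x)%:E) by exact/measurable_EFinP.
under [LHS]eq_integral do rewrite fimfunE -fsumEFin//.
rewrite [LHS]ge0_integral_fsum//; last 2 first.
  - by move=> r; exact/measurable_EFinP/measurableT_comp.
  - by move=> n x _; rewrite EFinM nnfun_muleindic_ge0.
under [RHS]eq_integral.
  move=> x xD; rewrite fimfunE -fsumEFin// ge0_mule_fsuml; last first.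
    by move=> r; rewrite EFinM nnfun_muleindic_ge0.
  over.
rewrite [RHS]ge0_integral_fsum//; last 2 first.
  - by move=> r; apply: emeasurable_funM => //; exact/measurable_EFinP/measurableT_comp.
  - move=> n x _; rewrite mule_ge0 //; last by rewrite lee_fin.
    by rewrite EFinM nnfun_muleindic_ge0.
apply: eq_fsbigr => r rh; rewrite integralZl_indic_nnsfun//.
have mr : measurable (h @^-1` [set r]) by [].
have r0 : (0 <= r)%R by move: rh; rewrite inE => -[t _ <-].
rewrite integral_indic// setIT nuE//.
under [RHS]eq_integral do rewrite EFinM -muleA.
rewrite ge0_integralZl//.
- congr (_ * _); rewrite integral_mkcond; apply: eq_integral => x _.
  by rewrite patchE indicE; case: ifP => _; rewrite ?mul1e ?mul0e.
- by apply: emeasurable_funM => //; exact/measurable_EFinP/measurable_indic.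
- by move=> x _; rewrite mule_ge0 ?lee_fin.
Qed.

(** The formula for indicators is the hypothesis; it passes to simple functions
    by linearity and to the limit by monotone convergence. *)
Lemma ge0_integral_density (f : T -> \bar K) :
  measurable_fun setT f -> (forall x, 0 <= f x) ->
  \int[nu]_x f x = \int[mu]_x (f x * (p x)%:E).
Proof.
move=> mf f0; pose h := nnsfun_approx measurableT mf.
have hf x : (h n x)%:E @[n --> \oo] --> f x by exact: cvg_nnsfun_approx.
have mpE : measurable_fun setT (fun x => (p x)%:E) by exact/measurable_EFinP.
transitivity (limn (fun n => \int[nu]_x (h n x)%:E)).
  rewrite -monotone_convergence//=.
  - by apply: eq_integral => x _; apply/esym/cvg_lim => //; exact: hf.
  - by move=> n; exact/measurable_EFinP/measurable_funTS.
  - by move=> n x _; rewrite lee_fin.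
  - by move=> x _ a b ab; rewrite lee_fin//; exact/lefP/nd_nnsfun_approx.
under eq_fun do rewrite integral_density_nnsfun.
rewrite -monotone_convergence//=.
- apply: eq_integral => x _; apply/cvg_lim => //.
  by apply: cvgeZr => //; exact: hf.
- by move=> n; apply: emeasurable_funM => //; exact/measurable_EFinP/measurable_funTS.
- by move=> n x _; rewrite mule_ge0 ?lee_fin.
- move=> x _ a b ab; rewrite lee_wpmul2r ?lee_fin//.
  by exact/lefP/nd_nnsfun_approx.
Qed.

End Density.

Section Affine.
Variable K : realType.
Notation mu := (@lebesgue_measure K).
Local Open Scope ereal_scope.

Lemma ge0_integral_normal (m s : K) (f : K -> \bar K) :
  measurable_fun setT f -> (forall x, 0 <= f x) ->
  \int[normal_prob m s]_x f x = \int[mu]_x (f x * (normal_pdf m s x)%:E).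
Proof.
move=> mf f0.
by apply: (@ge0_integral_density _ _ _ mu (normal_prob m s) (normal_pdf m s)) => // *;
  [exact: measurable_normal_pdf|exact: normal_pdf_ge0].
Qed.

(** Both sides are measures that agree on half-open intervals. *)
Lemma lebesgue_measure_affine (a b : K) (A : set K) : (0 < a)%R -> measurable A ->
  mu A = a%:E * mu ((fun x : K => a * x + b)%R @^-1` A).
Proof.
move=> a0 mA.
have mf : measurable_fun setT ((fun x : K => a * x + b)%R : measurableTypeR K -> measurableTypeR K).
  by apply: measurable_funD => //; exact: mulrl_measurable.
pose phi : {mfun measurableTypeR K >-> measurableTypeR K} :=
  HB.pack (fun x : K => (a * x + b)%R) (isMeasurableFun.Build _ _ _ _ _ mf).
have a0' : (0 <= a)%R by exact: ltW.
pose nu : {measure set (measurableTypeR K) -> \bar K} :=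
  mscale (NngNum a0') (pushforward mu phi).
rewrite [LHS](@lebesgue_measure_unique _ (nu (measurable_funP phi))) ?ocitvP//=.
move=> _ [[c e] _ <-]/=.
rewrite /nu /mscale/= /pushforward.
have -> : phi @^-1` `]c, e] = `]((c - b) / a)%R, ((e - b) / a)%R]%classic.
  apply/seteqP; split => x /=; rewrite !in_itv/= => /andP[].
    by rewrite ltr_pdivrMr// ler_pdivlMr// ltrBlDr lerBrDr mulrC => -> ->.
  by rewrite ltr_pdivrMr// ler_pdivlMr// ltrBlDr lerBrDr mulrC => -> ->.
rewrite !lebesgue_measure_itv/= !lte_fin ltr_pM2r ?invr_gt0// ltrD2r.
case: ifP => _; last by rewrite mule0.
by rewrite -!EFinB -EFinM; congr (_%:E); field; rewrite gt_eqF.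
Qed.

Lemma ge0_integral_affine (a b : K) (f : K -> \bar K) : (0 < a)%R ->
  measurable_fun setT f -> (forall x, 0 <= f x) ->
  \int[mu]_x f x = a%:E * \int[mu]_x f (a * x + b)%R.
Proof.
move=> a0 mfF f0.
have mf : measurable_fun setT ((fun x : K => a * x + b)%R : measurableTypeR K -> measurableTypeR K).
  by apply: measurable_funD => //; exact: mulrl_measurable.
pose phi : {mfun measurableTypeR K >-> measurableTypeR K} :=
  HB.pack (fun x : K => (a * x + b)%R) (isMeasurableFun.Build _ _ _ _ _ mf).
have a0' : (0 <= a)%R by exact: ltW.
pose nu : {measure set (measurableTypeR K) -> \bar K} :=
  mscale (NngNum a0') (pushforward mu phi).
transitivity (\int[nu (measurable_funP phi)]_x f x).
  apply: eq_measure_integral => A mA _.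
  exact: lebesgue_measure_affine.
by rewrite /nu ge0_integral_mscale//= ge0_integral_pushforward.
Qed.

End Affine.

(** * Independent sigma-algebras *)

Section Independence.
Context disp (T : measurableType disp) (K : realType) (P : probability T K).

Definition indep_families (C D : set (set T)) :=
  forall A B, C A -> D B -> P (A `&` B) = (P A * P B)%E.

Lemma indep_familiesC C D : indep_families C D -> indep_families D C.
Proof. by move=> CD A B DA CB; rewrite setIC muleC CD. Qed.

(** Dynkin's argument: for fixed [B], the sets independent of [B] form a
    lambda-system containing the pi-system [C]. *)
Lemma indep_sigma_l (C D : set (set T)) : setI_closed C ->
  C `<=` measurable -> D `<=` measurable -> indep_families C D ->
  indep_families <<s C >> D.
Proof.
move=> CI Cm Dm CD A B sA DB.
have mB := Dm _ DB.
pose H : set (set T) := [set A | measurable A /\ P (A `&` B) = (P A * P B)%E].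
suff: <<s C >> `<=` H by move=> /(_ _ sA)[].
apply: lambda_system_subset => //; last first.
  by move=> E CE; split; [exact: Cm|exact: CD].
have Pfin E : measurable E -> P E \is a fin_num by move=> mE; exact: fin_num_measure.
split => //.
- by split => //; rewrite setTI probability_setT mul1e.
- move=> E F FE [mE PE] [mF PF]; split; first exact: measurableD.
  have mFB : measurable (F `&` B) by exact: measurableI.
  have mEB : measurable (E `&` B) by exact: measurableI.
  have finE : (P E < +oo)%E by rewrite -ge0_fin_numE ?Pfin.
  have finEB : (P (E `&` B) < +oo)%E by rewrite -ge0_fin_numE ?Pfin.
  have -> : (E `\` F) `&` B = (E `&` B) `\` F.
    by apply/seteqP; split => x [[]].
  rewrite (measureD mEB mF finEB) (measureD mE mF finE) setIAC.
  rewrite (setIidr FE) [X in (X - _)%E]PE [X in (_ - X)%E]PF.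
  by rewrite muleBl ?Pfin // fin_num_adde_defr // Pfin.
- move=> F ndF HF; have mF n : measurable (F n) by have [] := HF n.
  split; first exact: bigcup_measurable.
  have mU : measurable (\bigcup_n F n) by exact: bigcup_measurable.
  have c1 : P (F n `&` B) @[n --> \oo] --> P ((\bigcup_n F n) `&` B).
    rewrite setI_bigcupl; apply: nondecreasing_cvg_mu.
    + by move=> n; exact: measurableI.
    + by apply: bigcup_measurable => n _; exact: measurableI.
    + by move=> m n mn; apply/subsetPset; apply: setSI; exact/subsetPset/ndF.
  have c2 : P (F n `&` B) @[n --> \oo] --> (P (\bigcup_n F n) * P B)%E.
    under eq_fun do rewrite (proj2 (HF _)).
    apply: cvgeZr; first exact: Pfin.
    exact: nondecreasing_cvg_mu.
  by rewrite -(cvg_lim _ c1)// -(cvg_lim _ c2).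
Qed.

Lemma indep_sigma (C D : set (set T)) : setI_closed C -> setI_closed D ->
  C `<=` measurable -> D `<=` measurable -> indep_families C D ->
  indep_families <<s C >> <<s D >>.
Proof.
move=> CI DI Cm Dm CD.
apply: indep_sigma_l => //.
  by apply: smallest_sub => //; exact: sigma_algebra_measurable.
by apply/indep_familiesC/indep_sigma_l => //; exact: indep_familiesC.
Qed.

(** Measurability with respect to the sigma-algebra generated by [C], for
    functions on the original space; by [sub_measurableP] this is measurability
    on the space equipped with the coarser structure, so closure under sums and
    products is inherited. *)
Definition sub_measurable (C : set (set T)) (f : T -> measurableTypeR K) :=
  forall E, measurable E -> <<s C >> (f @^-1` E).

Lemma sub_measurableP C f : sub_measurable C f <->
  measurable_fun [set: g_sigma_algebraType C] (f : g_sigma_algebraType C -> measurableTypeR K).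
Proof.
split => [mf _ E mE|mf E mE]; first by rewrite setTI; exact: mf.
by have := mf measurableT E mE; rewrite setTI.
Qed.

Lemma sub_measurableT C f : C `<=` measurable -> sub_measurable C f ->
  measurable_fun setT f.
Proof.
move=> Cm fC _ E mE; rewrite setTI.
have : <<s C >> (f @^-1` E) by exact: fC.
by apply: smallest_sub => //; exact: sigma_algebra_measurable.
Qed.

Section Pair.
Variables (C D : set (set T)) (f g : T -> measurableTypeR K).
Hypotheses (Cm : C `<=` measurable) (Dm : D `<=` measurable).
Hypothesis CD : indep_families <<s C >> <<s D >>.
Hypotheses (fC : sub_measurable C f) (gD : sub_measurable D g).
Local Open Scope ereal_scope.

(** The law of [(f, g)] agrees with the product measure on rectangles, hence
    everywhere, and Tonelli's theorem applies. *)
Lemma ge0_integral_indep_pair (mu nu : probability (measurableTypeR K) K)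
    (F : measurableTypeR K * measurableTypeR K -> \bar K) :
  (forall E, measurable E -> P (f @^-1` E) = mu E) ->
  (forall E, measurable E -> P (g @^-1` E) = nu E) ->
  measurable_fun setT F -> (forall x, 0 <= F x) ->
  \int[P]_w F (f w, g w) = \int[mu]_x \int[nu]_y F (x, y).
Proof.
move=> fmu gnu mF F0.
have mf := sub_measurableT Cm fC; have mg := sub_measurableT Dm gD.
have mfg : measurable_fun setT (fun w => (f w, g w)) by exact: measurable_fun_pair.
pose phi : {mfun T >-> (measurableTypeR K * measurableTypeR K)%type} :=
  HB.pack (fun w => (f w, g w)) (isMeasurableFun.Build _ _ _ _ _ mfg).
rewrite -(@fubini_tonelli1 _ _ _ _ _ mu nu)//.
transitivity (\int[distribution P phi]_z F z).
  by rewrite ge0_integral_distribution.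
apply: eq_measure_integral => A mA _; apply/esym.
apply: product_measure_unique => // E1 E2 mE1 mE2 /=.
rewrite /distribution /pushforward.
have -> : phi @^-1` (E1 `*` E2) = (f @^-1` E1) `&` (g @^-1` E2) by [].
by rewrite CD ?fmu ?gnu//; [exact: fC|exact: gD].
Qed.

Lemma ge0_integral_indep_mul : (forall x, 0 <= f x)%R -> (forall x, 0 <= g x)%R ->
  \int[P]_w (f w * g w)%:E = \int[P]_w (f w)%:E * \int[P]_w (g w)%:E.
Proof.
move=> f0 g0.
have mf := sub_measurableT Cm fC; have mg := sub_measurableT Dm gD.
pose pf : {mfun T >-> measurableTypeR K} := HB.pack f (isMeasurableFun.Build _ _ _ _ _ mf).
pose pg : {mfun T >-> measurableTypeR K} := HB.pack g (isMeasurableFun.Build _ _ _ _ _ mg).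
have mA : measurable_fun setT (fun y : K => `|y|%:E).
  by apply/measurable_EFinP; exact: normr_measurable.
transitivity (\int[P]_w (`|f w|%:E * `|g w|%:E)).
  by apply: eq_integral => w _; rewrite EFinM !ger0_norm.
rewrite (@ge0_integral_indep_pair (distribution P pf) (distribution P pg)
  (fun z => `|z.1|%:E * `|z.2|%:E))//=; last first.
  apply: emeasurable_funM; apply/measurable_EFinP.
    exact: (measurableT_comp (@normr_measurable _ _)).
  exact: (measurableT_comp (@normr_measurable _ _)).
under eq_integral do rewrite ge0_integralZl//=.
rewrite ge0_integralZr//=; last first.
  by apply: integral_ge0 => y _.
rewrite !ge0_integral_distribution//=.
by congr (_ * _); apply: eq_integral => w _; rewrite /= ger0_norm.
Qed.

End Pair.

End Independence.

(** * Disjoint blocks of independent variables *)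

Section Blocks.
Context disp (T : measurableType disp) (K : realType) (P : probability T K).
Variables (I : finType) (X : I -> {RV P >-> K}).

(** The events that constrain each coordinate of a block separately: a
    pi-system generating the sigma-algebra of the block. *)
Definition cylinders (S : {set I}) : set (set T) :=
  [set G | exists2 E : I -> set K, (forall i, measurable (E i)) &
    G = \bigcap_(i in [set` S]) (X i @^-1` E i)].

Lemma cylinders_setI S : setI_closed (cylinders S).
Proof.
move=> _ _ [E mE ->] [F mF ->]; exists (fun i => E i `&` F i).
  by move=> i; exact: measurableI.
by rewrite -bigcapI.
Qed.

Lemma cylinders_measurable S : cylinders S `<=` measurable.
Proof.
move=> _ [E mE ->]; apply: fin_bigcap_measurable => // i _.
by rewrite -[X in measurable X]setTI; exact: (measurable_funP (X i)).
Qed.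

Lemma cylinders_sub (S S' : {set I}) : S \subset S' -> cylinders S `<=` cylinders S'.
Proof.
move=> /fintype.subsetP SS' _ [E mE ->].
exists (fun i => if i \in S then E i else setT).
  by move=> i; case: ifP.
apply/seteqP; split => x Ex i /= iS.
  by case: ifPn => // iS0; exact: Ex.
by have := Ex i (SS' _ iS); rewrite /= iS.
Qed.

Lemma sub_measurable_cylinders (S S' : {set I}) (f : T -> K) : S \subset S' ->
  sub_measurable (cylinders S) f -> sub_measurable (cylinders S') f.
Proof.
move=> SS' fS E mE; have := fS E mE.
by apply: sub_sigma_algebra2; exact: cylinders_sub.
Qed.

Lemma sub_measurable_coord (S : {set I}) i : i \in S -> sub_measurable (cylinders S) (X i).
Proof.
move=> iS E mE; apply: sub_sigma_algebra.
exists (fun j => if j == i then E else setT); first by move=> j; case: ifP.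
apply/seteqP; split => x Ex; last by have := Ex i iS; rewrite /= eqxx.
by move=> j _ /=; case: eqP => // ->.
Qed.

Hypothesis indepX : mutually_independent X.

Lemma cylinders_indep (S S' : {set I}) : (forall i, i \in S -> i \notin S') ->
  indep_families P (cylinders S) (cylinders S').
Proof.
move=> SS' _ _ [E mE ->] [F mF ->].
have notS i : i \in S' -> (i \in S) = false.
  by move=> iS'; apply: contraTF iS' => /SS'.
pose G i := if i \in S then E i else F i.
have mG i : measurable (G i) by rewrite /G; case: ifP.
have -> : \bigcap_(i in [set` S]) (X i @^-1` E i) `&`
    \bigcap_(i in [set` S']) (X i @^-1` F i) =
    \bigcap_(i in [set` S :|: S']) (X i @^-1` G i).
  apply/seteqP; split => [x [Ex Fx] i /=|x Gx].
    rewrite inE /G => /orP[iS|iS']; first by rewrite iS; exact: Ex.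
    by rewrite (notS i iS'); exact: Fx.
  split => i /= iS.
    by have := Gx i; rewrite /= inE iS /G iS; apply.
  by have := Gx i; rewrite /= inE iS orbT /G (notS i iS); apply.
rewrite !indepX// (eq_bigl [predU S & S']); last by move=> i; rewrite !inE.
rewrite bigU/=; last by apply/pred0P => i /=; apply/negP => /andP[/SS'/negP].
congr (_ * _)%E; apply: eq_bigr => i iS; rewrite /G.
  by rewrite iS.
by rewrite (notS i iS).
Qed.

Lemma blocks_indep (S S' : {set I}) : (forall i, i \in S -> i \notin S') ->
  indep_families P <<s cylinders S >> <<s cylinders S' >>.
Proof.
move=> SS'; apply: indep_sigma; try exact: cylinders_setI; try exact: cylinders_measurable.
exact: cylinders_indep.
Qed.

End Blocks.

(** * Sums of independent centred normal variables *)

Section NormalConvolution.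
Variable K : realType.
Notation mu := (@lebesgue_measure K).
Local Open Scope ereal_scope.

Lemma ge0_integral_opp (f : K -> \bar K) :
  measurable_fun setT f -> (forall x, 0 <= f x) ->
  \int[mu]_x f x = \int[mu]_x f (- x)%R.
Proof.
move=> mf f0.
transitivity (\int[pushforward mu (-%R : measurableTypeR K -> measurableTypeR K)]_x f x).
  by apply: eq_measure_integral => A mA _; rewrite /= lebesgue_measureN.
by rewrite ge0_integral_pushforward.
Qed.

Lemma ge0_integral_shift (b : K) (f : K -> \bar K) :
  measurable_fun setT f -> (forall x, 0 <= f x) ->
  \int[mu]_x f x = \int[mu]_x f (x + b)%R.
Proof.
move=> mf f0; rewrite (@ge0_integral_affine _ 1 b)// mul1e.
by apply: eq_integral => x _; rewrite mul1r.
Qed.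

(** As a function of [x], the product of the two densities is a multiple of a
    normal density centred at [z a^2 / (a^2 + b^2)]. *)
Lemma normal_pdf_convolution (a b z : K) : (0 < a)%R -> (0 < b)%R ->
  \int[mu]_x (normal_pdf 0 b (z - x) * normal_pdf 0 a x)%:E =
  (normal_pdf 0 (Num.sqrt (a ^+ 2 + b ^+ 2)) z)%:E.
Proof.
move=> a0 b0; set c := Num.sqrt _.
have c2 : (c ^+ 2 = a ^+ 2 + b ^+ 2)%R by rewrite sqr_sqrtr// addr_ge0 ?sqr_ge0.
have c0 : (0 < c)%R by rewrite sqrtr_gt0 addr_gt0 ?exprn_gt0.
have ab0 : (0 < a ^+ 2 + b ^+ 2)%R by rewrite addr_gt0 ?exprn_gt0.
apply: (@integral_scaled_normal_pdf _ (z * a ^+ 2 / c ^+ 2)%R (a * b / c)%R).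
- by rewrite gt_eqF// divr_gt0// mulr_gt0.
- exact: normal_pdf_ge0.
move=> x; rewrite !normal_pdfE ?gt_eqF// ?divr_gt0 ?mulr_gt0//.
rewrite !normal_peakE ?divr_gt0 ?mulr_gt0//; set q := (Num.sqrt _)^-1%R.
rewrite mulrACA [RHS]mulrACA; congr (_ * _)%R.
  by field; rewrite !gt_eqF.
rewrite /normal_fun -!expRD; congr expR.
have -> : ((a * b / c) ^+ 2 = a ^+ 2 * b ^+ 2 / (a ^+ 2 + b ^+ 2))%R.
  by rewrite expr_div_n c2 exprMn.
rewrite c2; field.
by rewrite !gt_eqF.
Qed.

Lemma ge0_integral_normal_add (a b : K) (F : K -> \bar K) : (0 < a)%R -> (0 < b)%R ->
  measurable_fun setT F -> (forall x, 0 <= F x) ->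
  \int[normal_prob 0 a]_x \int[normal_prob 0 b]_y F (x + y)%R =
  \int[normal_prob 0 (Num.sqrt (a ^+ 2 + b ^+ 2))]_z F z.
Proof.
move=> a0 b0 mF F0.
have mpdf s : measurable_fun setT (fun x : K => (normal_pdf 0 s x)%:E).
  by apply/measurable_EFinP; exact: measurable_normal_pdf.
have pdf0 s x : 0 <= (normal_pdf 0 s x)%:E by rewrite lee_fin normal_pdf_ge0.
have mFa x : measurable_fun setT (fun y : K => F (x + y)%R).
  by apply: measurableT_comp => //; exact: measurable_funD.
have madd : measurable_fun setT (fun z : K * K => (z.1 + z.2)%R).
  exact: measurable_funD.
have mFs : measurable_fun setT (fun z : K * K => F (z.1 + z.2)%R).
  exact: (measurableT_comp mF madd).
pose H (z : K * K) := F z.1 * (normal_pdf 0 b (z.1 - z.2))%:E * (normal_pdf 0 a z.2)%:E.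
have mH : measurable_fun setT H.
  apply: emeasurable_funM; [apply: emeasurable_funM|].
  - exact: (measurableT_comp mF measurable_fst).
  - apply: (measurableT_comp (mpdf b)); exact: measurable_funB.
  - exact: (measurableT_comp (mpdf a) measurable_snd).
have H0 z : 0 <= H z by rewrite /H !mule_ge0.
transitivity (\int[mu]_x \int[mu]_z H (z, x)).
  rewrite ge0_integral_normal//; last 2 first.
  - exact: (@measurable_fun_fubini_tonelli_F _ _ _ _ _ (normal_prob 0 b)
      (fun z : K * K => F (z.1 + z.2)%R)).
  - by move=> x; apply: integral_ge0 => y _; exact: F0.
  apply: eq_integral => x _; rewrite ge0_integral_normal//.
  rewrite (@ge0_integral_shift (- x)); last 2 first.
  - exact: emeasurable_funM.
  - by move=> y; rewrite mule_ge0.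
  rewrite -ge0_integralZr//.
  - by apply: eq_integral => z _; rewrite /H addrCA subrr addr0.
  - apply: emeasurable_funM.
      apply: measurableT_comp => //; apply: measurable_funD => //.
      exact: measurable_funD.
    by apply: (measurableT_comp (mpdf b)); exact: measurable_funD.
  - by move=> y _; rewrite mule_ge0.
rewrite -(@fubini_tonelli _ _ _ _ _ mu mu H)//.
rewrite ge0_integral_normal//; apply: eq_integral => z _.
under eq_integral do rewrite /H/= -muleA.
rewrite ge0_integralZl//.
- by congr (_ * _); rewrite -normal_pdf_convolution//.
- apply: emeasurable_funM; last exact: mpdf.
  by apply: (measurableT_comp (mpdf b)); exact: measurable_funB.
- by move=> x _; rewrite mule_ge0.
Qed.

End NormalConvolution.

Section NormalSums.
Context disp (T : measurableType disp) (K : realType) (P : probability T K).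

Definition has_normal_law (f : T -> measurableTypeR K) (s : K) :=
  forall E, measurable E -> P (f @^-1` E) = normal_prob 0 s E.

Lemma ge0_integral_normal_law f s (F : K -> \bar K) :
  measurable_fun setT f -> has_normal_law f s ->
  measurable_fun setT F -> (forall x, 0 <= F x)%E ->
  (\int[P]_w F (f w) = \int[normal_prob 0 s]_x F x)%E.
Proof.
move=> mf fs mF F0.
pose pf : {mfun T >-> measurableTypeR K} := HB.pack f (isMeasurableFun.Build _ _ _ _ _ mf).
rewrite -(ge0_integral_distribution pf)//.
by apply: eq_measure_integral => A mA _; exact: fs.
Qed.

Lemma has_normal_lawN f s : 0 < s -> has_normal_law f s -> has_normal_law (\- f) s.
Proof.
move=> s0 fs E mE.
have mN : measurable ((-%R : K -> K) @^-1` E).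
  by rewrite -[X in measurable X]setTI; exact: oppr_measurable.
have := fs _ mN; rewrite -comp_preimage => ->.
rewrite /normal_prob integral_mkcond [RHS]integral_mkcond/= ge0_integral_opp/=.
- apply: eq_integral => x _; rewrite !patchE.
  have -> : (- x \in (-%R : K -> K) @^-1` E) = (x \in E).
    by apply/idP/idP; rewrite !inE /= opprK.
  case: ifP => // _; congr (_%:E); rewrite !normal_pdfE ?gt_eqF//.
  by rewrite /normal_fun !subr0 sqrrN.
- apply/(measurable_restrictT _ _).1 => //.
  by apply/measurable_EFinP/measurable_funTS; exact: measurable_normal_pdf.
- by move=> x; rewrite patchE; case: ifP => // _; rewrite lee_fin normal_pdf_ge0.
Qed.

Lemma has_normal_lawD (C D : set (set T)) (f g : T -> measurableTypeR K) a b :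
  C `<=` measurable -> D `<=` measurable -> indep_families P <<s C >> <<s D >> ->
  sub_measurable C f -> sub_measurable D g ->
  0 < a -> 0 < b -> has_normal_law f a -> has_normal_law g b ->
  has_normal_law (f \+ g) (Num.sqrt (a ^+ 2 + b ^+ 2)).
Proof.
move=> Cm Dm CD fC gD a0 b0 fa gb E mE.
have mf := sub_measurableT Cm fC; have mg := sub_measurableT Dm gD.
have mfg : measurable ((f \+ g) @^-1` E).
  by rewrite -[X in measurable X]setTI; exact: measurable_funD.
have mI : measurable_fun setT (fun x : measurableTypeR K => (\1_E x : K)%:E).
  by apply/measurable_EFinP; exact: measurable_indic.
set c := Num.sqrt _.
have -> : normal_prob 0 c E = (\int[normal_prob 0 c]_x (\1_E x : K)%:E)%E.
  by rewrite integral_indic// setIT.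
have -> : P ((f \+ g) @^-1` E) = (\int[P]_w (\1_E (f w + g w)%R : K)%:E)%E.
  rewrite -(setIT ((f \+ g) @^-1` E)) -integral_indic//.
rewrite -ge0_integral_normal_add//.
pose F (z : measurableTypeR K * measurableTypeR K) := (\1_E (z.1 + z.2)%R : K)%:E.
rewrite -(@ge0_integral_indep_pair _ _ _ P C D f g Cm Dm CD fC gD
  (normal_prob 0 a) (normal_prob 0 b) F)//.
- by apply: (measurableT_comp mI); exact: measurable_funD.
- by move=> z; rewrite lee_fin.
Qed.

End NormalSums.

(** * Two correlated Gaussians *)

Section PlaneIntegrals.
Variable K : realType.
Notation mu := (@lebesgue_measure K).
Notation KK := (measurableTypeR K * measurableTypeR K)%type.

(** The change of variables [u = (a + b) / 2], [v = (a - b) / 2], of Jacobian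
    [1/2], as a composition of two shears and a scaling of one variable. *)
Lemma ge0_integral_sum_difference (G : KK -> \bar K) :
  measurable_fun setT G -> (forall z, 0 <= G z)%E ->
  (\int[mu]_u \int[mu]_v G (u, v) =
   \int[mu]_b \int[mu]_a ((2^-1)%:E * G (((a + b) / 2)%R, ((a - b) / 2)%R)))%E.
Proof.
move=> mG G0.
have mshift : measurable_fun setT (fun z : KK => ((z.1 + z.2)%R, z.2) : KK).
  by apply: measurable_fun_pair => //; exact: measurable_funD.
have mGs : measurable_fun setT (fun z : KK => G ((z.1 + z.2)%R, z.2)).
  exact: (measurableT_comp mG mshift).
rewrite (@fubini_tonelli _ _ _ _ _ mu mu G)//.
(* [b = u - v] replaces [u], and then [v = (a - b) / 2] brings in [a]. *)
transitivity (\int[mu]_v \int[mu]_b G ((b + v)%R, v))%E.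
  apply: eq_integral => v _.
  rewrite (@ge0_integral_shift _ v (fun u => G (u, v)))//.
  by apply: (measurableT_comp mG); exact: measurable_fun_pair.
rewrite -(@fubini_tonelli _ _ _ _ _ mu mu (fun z => G ((z.1 + z.2)%R, z.2)))//.
apply: eq_integral => b _.
have mb : measurable_fun setT (fun v : measurableTypeR K => G ((b + v)%R, v)).
  by apply: (measurableT_comp mG); apply: measurable_fun_pair => //; exact: measurable_funD.
rewrite (@ge0_integral_affine _ 2^-1 (- b / 2) (fun v => G ((b + v)%R, v)))//.
rewrite -ge0_integralZl//.
- by apply: eq_integral => a _; congr (_ * G (_, _))%E; field.
- by apply: (measurableT_comp mb); exact: measurable_funD.
Qed.

(** By symmetry the integral equals that of [cosh (m t)], which is at most
    [cosh (m c)] on the interval, and Hoeffding's inequality for a fair sign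
    bounds this by a Gaussian. *)
Lemma box_mgf (m c : K) : 0 < c ->
  (\int[mu]_t (\1_`[- c, c] t * expR (m * t))%:E <=
   (2 * c * expR (m ^+ 2 * c ^+ 2 / 2))%:E)%E.
Proof.
move=> c0; set J := (\int[mu]_t _)%E.
have mI : measurable_fun setT (\1_`[- c, c] : K -> K) by exact: measurable_indic.
have mE (a : K) : measurable_fun setT (fun t : K => expR (a * t)).
  by apply: measurableT_comp => //; exact: mulrl_measurable.
have mf (a : K) : measurable_fun setT (fun t : K => (\1_`[- c, c] t * expR (a * t))%:E).
  by apply/measurable_EFinP/measurable_funM => //; exact: mE.
have J' : J = (\int[mu]_t (\1_`[- c, c] t * expR (- m * t))%:E)%E.
  rewrite /J ge0_integral_opp.
  - apply: eq_integral => t _; rewrite mulrN mulNr; congr (_ * _)%:E.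
    by rewrite !indicE !mem_setE !in_itv/= lerN2 lerNl andbC.
  - exact: mf.
  - by move=> t; rewrite lee_fin mulr_ge0 ?expR_ge0.
have JJ : (J + J <= (4 * c * expR (m ^+ 2 * c ^+ 2 / 2))%:E)%E.
  rewrite {2}J' -ge0_integralD//; last 2 first.
  - exact: mf.
  - exact: mf.
  apply: (@le_trans _ _ (\int[mu]_t (2 * expR (m ^+ 2 * c ^+ 2 / 2) * \1_`[- c, c] t)%:E)%E).
    apply: ge0_le_integral => //.
    - by move=> t _; rewrite -EFinD lee_fin addr_ge0 ?mulr_ge0 ?expR_ge0.
    - by apply: emeasurable_funD; exact: mf.
    - by apply/measurable_EFinP; apply: measurable_funM.
    move=> t _; rewrite -EFinD lee_fin -mulrDr mulrC indicE mem_setE in_itv/=.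
    case: (boolP (- c <= t <= c)) => [/andP[t1 t2]|_]; last by rewrite !mulr0.
    rewrite !mulr1.
    have x1 : `|t / c| <= 1.
      by rewrite ler_norml ler_pdivlMr// ler_pdivrMr// mulN1r mul1r t1 t2.
    have e1 := two_point_mgf_ge (m * c) x1.
    have e2 : expR (- (m * c) * (t / c)) <= two_point_mgf (- (m * c)) (t / c).
      exact: two_point_mgf_ge.
    have e3 := two_point_mgf_le 0 (m * c).
    rewrite mulr0 add0r exprMn in e3.
    have E1 : m * c * (t / c) = m * t by field; rewrite gt_eqF.
    have E2 : - (m * c) * (t / c) = - m * t by field; rewrite gt_eqF.
    rewrite E1 in e1; rewrite E2 in e2.
    move: e1 e2 e3; rewrite /two_point_mgf !opprK; lra.
  under eq_integral do rewrite EFinM.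
  rewrite ge0_integralZl//.
  - rewrite integral_indic//= setIT lebesgue_measure_itv/= lte_fin.
    rewrite ifT; last by lra.
    by rewrite -EFinB -EFinM lee_fin; lra.
  - by apply/measurable_EFinP.
have J0 : (0 <= J)%E by apply: integral_ge0 => t _; rewrite lee_fin mulr_ge0 ?expR_ge0.
move: J0 JJ; case: (J) => [j| |]//; rewrite -EFinD !lee_fin; lra.
Qed.

(** On the left is the joint density at [(a, b)] of two Gaussians [U + V] and
    [U - V] of variance [S ^+ 2] and correlation [rho].  Its quotient by the
    product of the marginal densities is the factor on the right times
    [exp (- rho^2 (a^2 + b^2) / (2 S^2 (1 - rho^2)))], which is at most 1. *)
Lemma correlated_density_le (S rho alpha beta a b : K) :
    0 < S -> 0 < alpha -> 0 < beta -> rho ^+ 2 < 1 ->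
    alpha ^+ 2 = S ^+ 2 * (1 + rho) / 2 -> beta ^+ 2 = S ^+ 2 * (1 - rho) / 2 ->
  2^-1 * (normal_pdf 0 alpha ((a + b) / 2) * normal_pdf 0 beta ((a - b) / 2)) <=
  (Num.sqrt (1 - rho ^+ 2))^-1 * expR (rho / (S ^+ 2 * (1 - rho ^+ 2)) * (a * b)) *
    (normal_pdf 0 S a * normal_pdf 0 S b).
Proof.
move=> S0 alpha0 beta0 rho1 alpha2 beta2.
have D0 : 0 < 1 - rho ^+ 2 by rewrite subr_gt0.
have r0 : 0 < Num.sqrt (1 - rho ^+ 2) by rewrite sqrtr_gt0.
have ab : alpha * beta = S ^+ 2 * Num.sqrt (1 - rho ^+ 2) / 2.
  apply/eqP; rewrite -(@eqrXn2 _ 2)//; last 2 first.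
  - by rewrite mulr_ge0// ltW.
  - by rewrite divr_ge0// mulr_ge0 ?sqr_ge0// ltW.
  rewrite exprMn alpha2 beta2 !exprMn sqr_sqrtr ?ltW//.
  by apply/eqP; field.
rewrite !normal_pdfE ?gt_eqF// !normal_peakE//.
set q := (Num.sqrt (pi *+ 2))^-1; set r := Num.sqrt (1 - _) in r0 ab *.
have q0 : 0 <= q by rewrite invr_ge0 sqrtr_ge0.
have -> : forall A B : K, 2^-1 * (q / alpha * A * (q / beta * B)) =
    r^-1 * (q / S) ^+ 2 * (A * B).
  move=> A B; transitivity (2^-1 * q ^+ 2 / (alpha * beta) * (A * B)).
    by field; rewrite !gt_eqF.
  by rewrite ab; field; rewrite !gt_eqF.
have -> : forall A B C : K, r^-1 * A * (q / S * B * (q / S * C)) =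
    r^-1 * (q / S) ^+ 2 * (A * (B * C)).
  by move=> A B C; field; rewrite !gt_eqF.
rewrite ler_wpM2l ?mulr_ge0 ?sqr_ge0 ?invr_ge0 ?(ltW r0) ?(ltW S0)//.
rewrite /normal_fun -!expRD ler_expR.
have p1 : 0 < 1 + rho by have := sqr_ge0 (rho + 1); nra.
have p2 : 0 < 1 - rho by have := sqr_ge0 (rho - 1); nra.
rewrite alpha2 beta2 !subr0 -subr_ge0.
have -> : rho / (S ^+ 2 * (1 - rho ^+ 2)) * (a * b) +
   (- a ^+ 2 / (S ^+ 2 *+ 2) + - b ^+ 2 / (S ^+ 2 *+ 2)) -
   (- ((a + b) / 2) ^+ 2 / (S ^+ 2 * (1 + rho) / 2 *+ 2) +
    - ((a - b) / 2) ^+ 2 / (S ^+ 2 * (1 - rho) / 2 *+ 2)) =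
   rho ^+ 2 * (a ^+ 2 + b ^+ 2) / (2 * S ^+ 2 * (1 - rho ^+ 2)).
  field; rewrite !gt_eqF//= -!mulr_natl ?mulr_gt0//.
apply: divr_ge0; first by rewrite mulr_ge0 ?sqr_ge0// addr_ge0 ?sqr_ge0.
by apply: mulr_ge0; [rewrite mulr_ge0 ?sqr_ge0|exact: ltW].
Qed.

End PlaneIntegrals.

(** * The normalized indicator of the cube, one coordinate at a time *)

Section Bump.
Variables (K : realType) (eps S : K).
Hypotheses (eps0 : 0 < eps) (S0 : 0 < S).
Notation mu := (@lebesgue_measure K).
Notation KK := (measurableTypeR K * measurableTypeR K)%type.
Notation box := (\1_`[- eps, eps] : K -> K).

(** The indicator that [m + a] lies in [[-eps, eps]], divided by [2 * eps] and
    by the centred normal density of standard deviation [S] at [a].  Under that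
    density it weights [a] so that [m + a] becomes uniform on the interval. *)
Definition bump (m a : K) : K :=
  box (m + a) * ((2 * eps * normal_peak S)^-1 * expR (a ^+ 2 / (S ^+ 2 *+ 2))).

Lemma box_sqr_le (m a : K) : - eps <= m + a <= eps ->
  a ^+ 2 <= 2 * (eps ^+ 2 + m ^+ 2).
Proof.
move=> ma; have : (m + a) ^+ 2 <= eps ^+ 2.
  by rewrite -[leLHS]real_normK ?num_real// ler_sqr ?nnegrE ?(ltW eps0)// ler_norml.
by have := sqr_ge0 (a + 2 * m); lra.
Qed.

Lemma bump_ge0 m a : 0 <= bump m a.
Proof.
by rewrite !mulr_ge0 ?expR_ge0// invr_ge0 !mulr_ge0 ?normal_peak_ge0// ltW.
Qed.

Lemma bump_pdf m a : bump m a * normal_pdf 0 S a = (2 * eps)^-1 * box (m + a).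
Proof.
have q0 : 0 < normal_peak S by rewrite normal_peak_gt0// gt_eqF.
rewrite normal_pdfE ?gt_eqF// /bump /normal_fun subr0 mulNr expRN.
by field; rewrite !gt_eqF// expR_gt0.
Qed.

Lemma measurable_box m : measurable_fun setT (fun a : K => box (m + a)).
Proof.
by apply: measurableT_comp; [exact: measurable_indic|exact: measurable_funD].
Qed.

Lemma measurable_bump m : measurable_fun setT (bump m).
Proof.
apply: measurable_funM; first exact: measurable_box.
apply: measurable_funM => //; apply: measurableT_comp => //.
by apply: measurable_funM => //; exact: measurable_funX.
Qed.

Lemma bump_mean m : (\int[normal_prob 0 S]_a (bump m a)%:E = 1)%E.
Proof.
rewrite ge0_integral_normal; last 2 first.
- by apply/measurable_EFinP; exact: measurable_bump.
- by move=> x; rewrite lee_fin bump_ge0.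
under eq_integral do rewrite -EFinM bump_pdf EFinM.
rewrite ge0_integralZl//; last 2 first.
- by apply/measurable_EFinP; exact: measurable_box.
- by rewrite lee_fin invr_ge0 mulr_ge0// ltW.
rewrite (@ge0_integral_shift _ (- m)); last 2 first.
- by apply/measurable_EFinP; exact: measurable_box.
- by move=> x; rewrite lee_fin.
under eq_integral do rewrite addrC subrK.
rewrite integral_indic//= setIT lebesgue_measure_itv/= lte_fin.
rewrite ifT; last by have := eps0; lra.
by rewrite -EFinB -EFinM; congr (_%:E); field; rewrite gt_eqF.
Qed.

Lemma shifted_box_mgf m c :
  (\int[mu]_a (box (m + a) * expR (c * a))%:E <=
   (2 * eps * expR (- (c * m) + c ^+ 2 * eps ^+ 2 / 2))%:E)%E.
Proof.
rewrite (@ge0_integral_shift _ (- m)); last 2 first.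
- apply/measurable_EFinP/measurable_funM; first exact: measurable_box.
  by apply: measurableT_comp => //; exact: mulrl_measurable.
- by move=> x; rewrite lee_fin mulr_ge0 ?expR_ge0.
have E x : (box (m + (x - m)) * expR (c * (x - m)))%:E =
   ((expR (- (c * m)))%:E * (box x * expR (c * x))%:E)%E.
  rewrite -EFinM; congr (_%:E); rewrite addrC subrK mulrCA -expRD; congr (_ * expR _).
  by ring.
under eq_integral do rewrite E.
rewrite ge0_integralZl//.
- rewrite expRD mulrCA EFinM lee_wpmul2l ?lee_fin ?expR_ge0//.
  exact: box_mgf.
- apply/measurable_EFinP/measurable_funM => //.
  by apply: measurableT_comp => //; exact: mulrl_measurable.
Qed.

(** The two weights turn the Gaussian factors of [correlated_density_le] into
    uniform laws, so what remains is the mean of [exp (l a b)] with [m + a] and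
    [m' + b] uniform.  Integrating [a] and then [b] by [shifted_box_mgf] gives
    the main term [exp (l m m')], with an error that is quadratic in [l * eps]. *)
Lemma bump_correlation (rho alpha beta l m m' : K) :
    0 < alpha -> 0 < beta -> rho ^+ 2 < 1 ->
    alpha ^+ 2 = S ^+ 2 * (1 + rho) / 2 -> beta ^+ 2 = S ^+ 2 * (1 - rho) / 2 ->
    l = rho / (S ^+ 2 * (1 - rho ^+ 2)) ->
  (\int[normal_prob 0 alpha]_u \int[normal_prob 0 beta]_v
     (bump m (u + v) * bump m' (u - v))%:E <=
   ((Num.sqrt (1 - rho ^+ 2))^-1 *
    expR (l * (m * m') + l ^+ 2 * eps ^+ 2 * (eps ^+ 2 + m ^+ 2 + m' ^+ 2)))%:E)%E.
Proof.
move=> alpha0 beta0 rho1 alpha2 beta2 lE.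
have D0 : 0 < 1 - rho ^+ 2 by rewrite subr_gt0.
set r := Num.sqrt (1 - rho ^+ 2).
have r0 : 0 < r by rewrite sqrtr_gt0.
have mpdf s : measurable_fun setT (fun x : K => (normal_pdf 0 s x)%:E).
  by apply/measurable_EFinP; exact: measurable_normal_pdf.
pose B (z : KK) : \bar K := (bump m (z.1 + z.2) * bump m' (z.1 - z.2))%:E.
have mB : measurable_fun setT B.
  apply/measurable_EFinP/measurable_funM.
    by apply: (measurableT_comp (measurable_bump m)); exact: measurable_funD.
  by apply: (measurableT_comp (measurable_bump m')); exact: measurable_funB.
have B0 z : (0 <= B z)%E by rewrite lee_fin mulr_ge0 ?bump_ge0.
pose G (z : KK) : \bar K :=
  (B z * (normal_pdf 0 beta z.2)%:E * (normal_pdf 0 alpha z.1)%:E)%E.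
have mG : measurable_fun setT G.
  apply: emeasurable_funM; first apply: emeasurable_funM => //.
    exact: (measurableT_comp (mpdf beta) measurable_snd).
  exact: (measurableT_comp (mpdf alpha) measurable_fst).
have G0 z : (0 <= G z)%E.
  by apply: mule_ge0; [apply: mule_ge0 => //|]; rewrite lee_fin normal_pdf_ge0.
have -> : (\int[normal_prob 0 alpha]_u \int[normal_prob 0 beta]_v
     (bump m (u + v) * bump m' (u - v))%:E = \int[mu]_u \int[mu]_v G (u, v))%E.
  rewrite ge0_integral_normal; last 2 first.
  - exact: (@measurable_fun_fubini_tonelli_F _ _ _ _ _ (normal_prob 0 beta) B).
  - by move=> x; apply: integral_ge0 => y _; exact: (B0 (x, y)).
  apply: eq_integral => u _; have mBu : measurable_fun setT (fun v : K => B (u, v)).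
    exact: (measurableT_comp mB (measurable_pair1 u)).
  rewrite ge0_integral_normal//; last by move=> v; exact: (B0 (u, v)).
  rewrite -ge0_integralZr //; first by exact: emeasurable_funM mBu (mpdf beta).
  - by move=> v _; apply: mule_ge0; [exact: (B0 (u, v))|rewrite lee_fin normal_pdf_ge0].
  - by rewrite lee_fin normal_pdf_ge0.
rewrite ge0_integral_sum_difference//.
pose k := (r^-1 * ((2 * eps)^-1 * (2 * eps)^-1)).
have k0 : 0 <= k by rewrite !mulr_ge0 ?invr_ge0 ?mulr_ge0 ?(ltW r0) ?(ltW eps0).
pose H (z : KK) : \bar K := (k * box (m' + z.1) * (box (m + z.2) * expR (l * z.1 * z.2)))%:E.
have mbox c (p : KK -> K) : measurable_fun setT p ->
    measurable_fun setT (fun z : KK => box (c + p z)).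
  by move=> mp; exact: (measurableT_comp (measurable_box c) mp).
have mH : measurable_fun setT H.
  apply/measurable_EFinP/measurable_funM; first by apply: measurable_funM => //; exact: mbox.
  apply: measurable_funM; first exact: mbox.
  apply: measurableT_comp => //; apply: measurable_funM => //.
  exact: measurable_funM.
have H0 z : (0 <= H z)%E.
  by rewrite lee_fin; apply: mulr_ge0; apply: mulr_ge0 => //; exact: expR_ge0.
have GH a b : ((2^-1)%:E * G (((a + b) / 2)%R, ((a - b) / 2)%R) <= H (b, a))%E.
  rewrite /G /H /B/= -!EFinM lee_fin.
  have -> : (a + b) / 2 + (a - b) / 2 = a by field.
  have -> : (a + b) / 2 - (a - b) / 2 = b by field.
  have := correlated_density_le a b S0 alpha0 beta0 rho1 alpha2 beta2.
  move=> /(ler_wpM2l (mulr_ge0 (bump_ge0 m a) (bump_ge0 m' b))) h.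
  have -> : 2^-1 * (bump m a * bump m' b * normal_pdf 0 beta ((a - b) / 2) *
      normal_pdf 0 alpha ((a + b) / 2)) = bump m a * bump m' b * (2^-1 *
      (normal_pdf 0 alpha ((a + b) / 2) * normal_pdf 0 beta ((a - b) / 2))) by ring.
  rewrite (le_trans h)// le_eqVlt; apply/orP; left; apply/eqP.
  rewrite -/r -lE.
  transitivity (r^-1 * expR (l * (a * b)) * (bump m a * normal_pdf 0 S a) *
    (bump m' b * normal_pdf 0 S b)); first by ring.
  rewrite !bump_pdf /k (_ : l * b * a = l * (a * b)); last by ring.
  by ring.
pose G' (z : KK) : \bar K :=
  ((2^-1)%:E * G (((z.2 + z.1) * 2^-1)%R, ((z.2 - z.1) * 2^-1)%R))%E.
have mG' : measurable_fun setT G'.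
  apply: measurable_funeM; apply: (measurableT_comp mG).
  apply: measurable_fun_pair; apply: measurable_funM => //.
    exact: measurable_funD.
  exact: measurable_funB.
have G'0 z : (0 <= G' z)%E by apply: mule_ge0 => //; rewrite lee_fin invr_ge0.
apply: (@le_trans _ _ (\int[mu]_b \int[mu]_a H (b, a))%E).
  apply: ge0_le_integral => //.
  - by move=> b _; apply: integral_ge0 => a _; exact: (G'0 (b, a)).
  - exact: (@measurable_fun_fubini_tonelli_F _ _ _ _ _ mu G').
  - exact: (@measurable_fun_fubini_tonelli_F _ _ _ _ _ mu H).
  move=> b _; apply: ge0_le_integral => //.
  - by move=> a _; exact: (G'0 (b, a)).
  - exact: (measurableT_comp mG' (measurable_pair1 b)).
  - exact: (measurableT_comp mH (measurable_pair1 b)).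
(* [c] bounds the part of the integral over [a] that does not depend on [b],
   using [b ^+ 2 <= 2 (eps ^+ 2 + m' ^+ 2)] on the support. *)
pose c := k * (2 * eps * expR (l ^+ 2 * eps ^+ 2 * (eps ^+ 2 + m' ^+ 2))).
have c0 : 0 <= c.
  by apply: mulr_ge0 => //; apply: mulr_ge0; [rewrite mulr_ge0// ltW|exact: expR_ge0].
have mbe (n s : K) : measurable_fun setT (fun a : K => (box (n + a) * expR (s * a))%:E).
  apply/measurable_EFinP/measurable_funM; first exact: measurable_box.
  by apply: measurableT_comp => //; exact: mulrl_measurable.
have be0 (n s a : K) : (0 <= (box (n + a) * expR (s * a))%:E)%E.
  by rewrite lee_fin mulr_ge0 ?expR_ge0.
apply: (@le_trans _ _ (\int[mu]_b (c%:E * (box (m' + b) * expR (- (l * m) * b))%:E))%E).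
  apply: ge0_le_integral => //.
  - by move=> b _; apply: integral_ge0 => a _; exact: H0.
  - exact: (@measurable_fun_fubini_tonelli_F _ _ _ _ _ mu H).
  - by apply: measurable_funeM; exact: mbe.
  move=> b _; rewrite /H/=; under eq_integral do rewrite EFinM.
  rewrite ge0_integralZl//; [|exact: mbe|by rewrite lee_fin mulr_ge0].
  have kb0 : (0 <= (k * box (m' + b))%:E)%E by rewrite lee_fin mulr_ge0.
  rewrite (le_trans (lee_wpmul2l kb0 (shifted_box_mgf _ _)))// -!EFinM lee_fin.
  rewrite /c !indicE mem_setE in_itv/=.
  case: (boolP (- eps <= m' + b <= eps)) => [m'b|_]; last by rewrite !(mulr0,mul0r).
  rewrite !mulr1 mul1r -[leRHS]mulrA ler_wpM2l// -[leRHS]mulrA.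
  rewrite ler_wpM2l ?mulr_ge0 ?(ltW eps0)// -expRD ler_expR.
  have bb := box_sqr_le m'b.
  have := ler_wpM2l (mulr_ge0 (sqr_ge0 l) (sqr_ge0 eps)) bb; lra.
rewrite ge0_integralZl//; last exact: mbe.
have c0E : (0 <= c%:E)%E by rewrite lee_fin.
rewrite (le_trans (lee_wpmul2l c0E (shifted_box_mgf _ _)))// -!EFinM lee_fin /c /k.
set x := expR _; set y := expR _; set z := expR _.
have -> : r^-1 * ((2 * eps)^-1 * (2 * eps)^-1) * (2 * eps * x) * (2 * eps * y) =
    r^-1 * (x * y) by field; rewrite !gt_eqF.
rewrite ler_wpM2l ?invr_ge0 ?(ltW r0)// /x /y /z -expRD ler_expR.
have := mulr_ge0 (mulr_ge0 (sqr_ge0 l) (sqr_ge0 eps)) (sqr_ge0 m); lra.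
Qed.

End Bump.

(** * Signed sums over blocks of Gaussian entries *)

Section BlockSums.
Context disp (T : measurableType disp) (K : realType) (P : probability T K).
Variables (I : finType) (X : I -> {RV P >-> K}) (s : K).
Hypotheses (s0 : 0 < s) (Xs : forall i, has_normal_law P (X i) s).
Hypothesis indepX : mutually_independent X.
Implicit Types S : {set I}.

Lemma sub_measurable_sum S (c : I -> K) :
  sub_measurable (cylinders X S) (fun w => \sum_(i in S) c i * X i w).
Proof.
apply/sub_measurableP; under eq_fun do rewrite big_mkcond/=.
apply: measurable_sum => i; have [iS|iS] := boolP (i \in S); last exact: measurable_cst.
apply: measurable_funM; first exact: measurable_cst.
by have /sub_measurableP := @sub_measurable_coord _ _ _ P I X S i iS.
Qed.

(** Adding one entry at a time: the new term and the sum over the rest of the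
    block depend on disjoint sets of entries. *)
Lemma block_sum_law S (c : I -> K) : (forall i, c i = 1 \/ c i = -1) ->
  (0 < #|S|)%N ->
  has_normal_law P (fun w => \sum_(i in S) c i * X i w) (s * Num.sqrt #|S|%:R).
Proof.
move=> c1; have term i : has_normal_law P (fun w => c i * X i w) s.
  have [->|->] := c1 i.
    rewrite (_ : (fun w => _) = X i :> (T -> K)); first exact: Xs.
    by apply/funext => w; rewrite mul1r.
  rewrite (_ : (fun w => _) = \- X i :> (T -> K)); first exact: has_normal_lawN.
  by apply/funext => w; rewrite mulN1r.
have [k] := ubnP #|S|; elim: k => // k IH in S *; rewrite ltnS => Sk S0.
have /set0Pn[i iS] : S != finset.set0 by rewrite -card_gt0.
have cS : #|S| = #|S :\ i|.+1 by rewrite (cardsD1 i) iS.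
have sumE : (fun w => \sum_(j in S) c j * X j w) =
    (fun w => c i * X i w) \+ (fun w => \sum_(j in S :\ i) c j * X j w).
  by apply/funext => w; rewrite (big_setD1 i).
have [S'0|S'0] := posnP #|S :\ i|.
  rewrite cS S'0 sqrtr1 mulr1 sumE.
  move/eqP: S'0; rewrite cards_eq0 => /eqP ->.
  rewrite (_ : _ \+ _ = (fun w => c i * X i w)); first exact: term.
  by apply/funext => w /=; rewrite big_set0 addr0.
have law' := IH (S :\ i) _ S'0.
have -> : s * Num.sqrt #|S|%:R = Num.sqrt (s ^+ 2 + (s * Num.sqrt #|S :\ i|%:R) ^+ 2).
  rewrite exprMn sqr_sqrtr ?ler0n// -[X in X + _]mulr1 -mulrDr.
  by rewrite sqrtrM ?sqr_ge0// sqrtr_sqr gtr0_norm// cS -natr1 addrC.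
rewrite sumE.
apply: (@has_normal_lawD _ _ _ _ (cylinders X [set i]%SET) (cylinders X (S :\ i))).
- exact: cylinders_measurable.
- exact: cylinders_measurable.
- by apply: blocks_indep => // j; rewrite !inE => /eqP ->; rewrite eqxx.
- have := @sub_measurable_sum [set i]%SET c.
  by under eq_fun do rewrite big_set1.
- exact: sub_measurable_sum.
- exact: s0.
- by rewrite mulr_gt0// sqrtr_gt0 ltr0n.
- exact: term.
- by apply: law'; rewrite -cS.
Qed.

End BlockSums.

(** * Rows of the Gaussian matrix *)

Section Rows.
Context disp (T : measurableType disp) (K : realType) (P : probability T K).
Variables (d n : nat) (s : K) (R : 'I_d -> 'I_n -> {RV P >-> K}).
Hypotheses (s0 : 0 < s) (iidR : iid_gaussian_entries s R).

Let X (ij : 'I_d * 'I_n) := R ij.1 ij.2.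

Let Xs ij : has_normal_law P (X ij) s.
Proof. by move=> E mE; exact: (proj1 iidR). Qed.

Let indepX : mutually_independent X.
Proof. exact: (proj2 iidR). Qed.

Definition row_entries (r : seq 'I_d) : {set 'I_d * 'I_n} :=
  finset (fun ij : 'I_d * 'I_n => ij.1 \in r).

Let cylinders_measurableX S : cylinders X S `<=` measurable.
Proof. exact: cylinders_measurable. Qed.

(** Distinct rows use disjoint sets of entries, so expectations factor over the
    rows. *)
Lemma row_product (G : 'I_d -> T -> K) (r : seq 'I_d) : uniq r ->
  (forall i w, 0 <= G i w) ->
  (forall i, sub_measurable (cylinders X (row_entries [:: i])) (G i)) ->
  sub_measurable (cylinders X (row_entries r)) (fun w => \prod_(i <- r) G i w) /\
  (\int[P]_w (\prod_(i <- r) G i w)%:E = \prod_(i <- r) \int[P]_w (G i w)%:E)%E.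
Proof.
move=> + G0 Gm; elim: r => [_|i r IH /= /andP[ir ur]].
  split; last first.
    under eq_integral do rewrite big_nil.
    by rewrite big_nil integral_cst//= mul1e probability_setT.
  apply/sub_measurableP; under eq_fun do rewrite big_nil.
  exact: measurable_cst.
have [Sm IE] := IH ur.
have iS : row_entries [:: i] \subset row_entries (i :: r).
  by apply/fintype.subsetP => ij; rewrite !inE => ->.
have rS : row_entries r \subset row_entries (i :: r).
  by apply/fintype.subsetP => ij; rewrite !inE => ->; rewrite orbT.
have G0p w : 0 <= \prod_(j <- r) G j w by apply: prodr_ge0 => j _.
split.
  apply/sub_measurableP; under eq_fun do rewrite big_cons.
  apply: measurable_funM.
    by have /sub_measurableP := sub_measurable_cylinders iS (Gm i).
  by have /sub_measurableP := sub_measurable_cylinders rS Sm.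
under eq_integral do rewrite big_cons.
rewrite big_cons -IE.
apply: (@ge0_integral_indep_mul _ _ _ P (cylinders X (row_entries [:: i]))
  (cylinders X (row_entries r))) => //; try exact: cylinders_measurable.
apply: blocks_indep => // ij; rewrite !inE => /eqP ->.
exact: ir.
Qed.

Definition row_dot (i : 'I_d) (x : 'cV[K]_n) (w : T) : K := \sum_j R i j w * x j 0.

Lemma row_sum (Q : pred 'I_n) (i : 'I_d) (F : 'I_d * 'I_n -> K) :
  \sum_(ij in [set ij : 'I_d * 'I_n | (ij.1 == i) && Q ij.2]%SET) F ij =
  \sum_(j | Q j) F (i, j).
Proof.
transitivity (\sum_(a | a == i) \sum_(j | Q j) F (a, j)).
  by rewrite pair_big/=; apply: eq_big => [[a b]|[a b] _]; rewrite ?inE.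
by rewrite big_pred1_eq.
Qed.

Lemma row_sub (Q : pred 'I_n) i :
  [set ij : 'I_d * 'I_n | (ij.1 == i) && Q ij.2]%SET \subset row_entries [:: i].
Proof. by apply/fintype.subsetP => ij; rewrite !inE => /andP[]. Qed.

Variables (eps : K) (eps0 : 0 < eps).
Hypothesis n0 : (0 < n)%N.
Let S := s * Num.sqrt n%:R.

Let S0 : 0 < S.
Proof. by rewrite mulr_gt0// sqrtr_gt0 ltr0n. Qed.

Lemma sign_dot (x : 'cV[K]_n) : sign_vectors x -> dot x x = n%:R.
Proof.
move=> sx; rewrite /dot (eq_bigr (fun=> 1)) ?sumr_const ?card_ord// => i _.
by case: (sx i) => ->; rewrite ?mulr1// mulrNN mulr1.
Qed.

Lemma card_row (Q : pred 'I_n) i :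
  #|[set ij : 'I_d * 'I_n | (ij.1 == i) && Q ij.2]%SET|%:R = \sum_(j | Q j) 1 :> K.
Proof. by rewrite -(row_sum Q i (fun=> 1)) sumr_const. Qed.

Lemma row_dot_law i x : sign_vectors x -> has_normal_law P (row_dot i x) S.
Proof.
move=> sx; have := @block_sum_law _ _ _ P _ X s s0 Xs indepX
  [set ij : 'I_d * 'I_n | (ij.1 == i) && predT ij.2]%SET (fun ij => x ij.2 0).
rewrite card_row sumr_const cardT size_enum_ord -/S.
have -> : (fun w => \sum_(ij in [set ij : 'I_d * 'I_n | (ij.1 == i) && predT ij.2]%SET)
    x ij.2 0 * X ij w) = row_dot i x.
  apply/funext => w; rewrite (row_sum predT i (fun ij => x ij.2 0 * X ij w)).
  by apply: eq_bigr => j _; rewrite mulrC.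
apply => //.
by rewrite -(ltr0n K) card_row sumr_const cardT size_enum_ord ltr0n.
Qed.

Lemma row_dot_sub i x : sub_measurable (cylinders X (row_entries [:: i])) (row_dot i x).
Proof.
apply: (sub_measurable_cylinders (row_sub predT i)).
have := @sub_measurable_sum _ _ _ P _ X
  [set ij : 'I_d * 'I_n | (ij.1 == i) && predT ij.2]%SET (fun ij => x ij.2 0).
congr sub_measurable; apply/funext => w.
rewrite (row_sum predT i (fun ij => x ij.2 0 * X ij w)).
by apply: eq_bigr => j _; rewrite mulrC.
Qed.

Lemma measurable_row_dot i x : measurable_fun setT (row_dot i x).
Proof. exact: (sub_measurableT (@cylinders_measurableX _) (@row_dot_sub i x)). Qed.

Lemma bump_sub i x m :
  sub_measurable (cylinders X (row_entries [:: i])) (fun w => bump eps S m (row_dot i x w)).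
Proof.
move=> E mE; have mb := measurable_bump eps S m measurableT mE; rewrite setTI in mb.
exact: (@row_dot_sub i x _ mb).
Qed.

Lemma mean_bumps (m : 'I_d -> K) x : sign_vectors x ->
  (\int[P]_w (\prod_i bump eps S (m i) (row_dot i x w))%:E = 1)%E.
Proof.
move=> sx; have b0 c a : 0 <= bump eps S c a by exact: bump_ge0.
have [_ ->] := @row_product (fun i w => bump eps S (m i) (row_dot i x w))
  (index_enum _) (index_enum_uniq _) (fun i w => b0 _ _) (fun i => @bump_sub i x (m i)).
apply: big1 => i _.
rewrite (@ge0_integral_normal_law _ _ _ P (row_dot i x) S (fun a => (bump eps S (m i) a)%:E)).
- exact: bump_mean.
- exact: measurable_row_dot.
- exact: row_dot_law.
- by apply/measurable_EFinP; exact: measurable_bump.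
- by move=> a; rewrite lee_fin bump_ge0.
Qed.

(** Let [U] and [V] be the parts of [<R i, x>] coming from the coordinates where
    [x] and [y] agree and disagree.  They are independent Gaussians, and the
    inner products of the row with [x] and [y] are [U + V] and [U - V].  The
    numbers of such coordinates are [n (1 + rho) / 2] and [n (1 - rho) / 2]. *)
Lemma row_correlation i x y (rho l m m' : K) : sign_vectors x -> sign_vectors y ->
  dot x y = n%:R * rho -> rho ^+ 2 < 1 -> l = rho / (S ^+ 2 * (1 - rho ^+ 2)) ->
  (\int[P]_w (bump eps S m (row_dot i x w) * bump eps S m' (row_dot i y w))%:E <=
   ((Num.sqrt (1 - rho ^+ 2))^-1 *
    expR (l * (m * m') + l ^+ 2 * eps ^+ 2 * (eps ^+ 2 + m ^+ 2 + m' ^+ 2)))%:E)%E.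
Proof.
move=> sx sy xy rho1 lE.
pose agree := [pred j | x j 0 == y j 0].
pose A := [set ij : 'I_d * 'I_n | (ij.1 == i) && agree ij.2]%SET.
pose D := [set ij : 'I_d * 'I_n | (ij.1 == i) && predC agree ij.2]%SET.
pose U w := \sum_(ij in A) x ij.2 0 * X ij w.
pose V w := \sum_(ij in D) x ij.2 0 * X ij w.
have UE w : U w = \sum_(j | agree j) x j 0 * R i j w.
  exact: (row_sum agree i (fun ij => x ij.2 0 * X ij w)).
have VE w : V w = \sum_(j | predC agree j) x j 0 * R i j w.
  exact: (row_sum (predC agree) i (fun ij => x ij.2 0 * X ij w)).
have xE w : row_dot i x w = U w + V w.
  rewrite UE VE /row_dot (bigID agree)/=.
  by congr (_ + _); apply: eq_bigr => j _; rewrite mulrC.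
have yE w : row_dot i y w = U w - V w.
  rewrite UE VE /row_dot (bigID agree)/= -sumrN.
  congr (_ + _); apply: eq_bigr => j; first by move=> /eqP ->; rewrite mulrC.
  by case: (sx j) => ->; case: (sy j) => ->; rewrite ?eqxx// => _; ring.
have p1 : 0 < 1 + rho by have := sqr_ge0 (rho + 1); nra.
have p2 : 0 < 1 - rho by have := sqr_ge0 (rho - 1); nra.
have n0K : 0 < n%:R :> K by rewrite ltr0n.
have cA : #|A|%:R = n%:R * (1 + rho) / 2 :> K.
  have -> : n%:R * (1 + rho) = n%:R + dot x y by rewrite xy; ring.
  rewrite /A card_row big_mkcond/=.
  have -> : n%:R = \sum_(j < n) 1 :> K by rewrite sumr_const card_ord.
  rewrite /dot -big_split/= mulr_suml; apply: eq_bigr => j _.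
  by case: (sx j) => ->; case: (sy j) => ->; case: eqP => //; lra.
have cD : #|D|%:R = n%:R * (1 - rho) / 2 :> K.
  have -> : n%:R * (1 - rho) = n%:R - dot x y by rewrite xy; ring.
  rewrite /D card_row big_mkcond/=.
  have -> : n%:R = \sum_(j < n) 1 :> K by rewrite sumr_const card_ord.
  rewrite /dot -sumrB/= mulr_suml; apply: eq_bigr => j _.
  by case: (sx j) => ->; case: (sy j) => ->; case: eqP => //=; lra.
have A0 : (0 < #|A|)%N by rewrite -(ltr0n K) cA divr_gt0// mulr_gt0.
have D0 : (0 < #|D|)%N by rewrite -(ltr0n K) cD divr_gt0// mulr_gt0.
pose alpha := s * Num.sqrt #|A|%:R; pose beta := s * Num.sqrt #|D|%:R.
have alpha0 : 0 < alpha by rewrite mulr_gt0// sqrtr_gt0 ltr0n.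
have beta0 : 0 < beta by rewrite mulr_gt0// sqrtr_gt0 ltr0n.
have alpha2 : alpha ^+ 2 = S ^+ 2 * (1 + rho) / 2.
  by rewrite /alpha /S !exprMn !sqr_sqrtr ?ler0n// cA; ring.
have beta2 : beta ^+ 2 = S ^+ 2 * (1 - rho) / 2.
  by rewrite /beta /S !exprMn !sqr_sqrtr ?ler0n// cD; ring.
have Ulaw : has_normal_law P U alpha by apply: block_sum_law => // ij; exact: sx.
have Vlaw : has_normal_law P V beta by apply: block_sum_law => // ij; exact: sx.
apply: le_trans (bump_correlation eps0 S0 m m' alpha0 beta0 rho1 alpha2 beta2 lE).
under eq_integral do rewrite xE yE.
pose F (z : measurableTypeR K * measurableTypeR K) : \bar K :=
  (bump eps S m (z.1 + z.2) * bump eps S m' (z.1 - z.2))%:E.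
have mF : measurable_fun setT F.
  apply/measurable_EFinP/measurable_funM.
    by apply: (measurableT_comp (measurable_bump eps S m)); exact: measurable_funD.
  by apply: (measurableT_comp (measurable_bump eps S m')); exact: measurable_funB.
have F0 z : (0 <= F z)%E by rewrite lee_fin mulr_ge0 ?bump_ge0.
have UV : indep_families P <<s cylinders X A >> <<s cylinders X D >>.
  by apply: blocks_indep => // ij; rewrite !inE => /andP[-> ->].
have Usub : sub_measurable (cylinders X A) U by exact: sub_measurable_sum.
have Vsub : sub_measurable (cylinders X D) V by exact: sub_measurable_sum.
rewrite (ge0_integral_indep_pair (@cylinders_measurableX A) (@cylinders_measurableX D)
  UV Usub Vsub Ulaw Vlaw mF F0).
exact: lexx.
Qed.

Lemma correlated_bumps x y (rho l : K) (m m' : 'I_d -> K) :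
  sign_vectors x -> sign_vectors y ->
  dot x y = n%:R * rho -> rho ^+ 2 < 1 -> l = rho / (S ^+ 2 * (1 - rho ^+ 2)) ->
  (\int[P]_w ((\prod_i bump eps S (m i) (row_dot i x w)) *
              (\prod_i bump eps S (m' i) (row_dot i y w)))%:E <=
   (\prod_i ((Num.sqrt (1 - rho ^+ 2))^-1 *
    expR (l * (m i * m' i) + l ^+ 2 * eps ^+ 2 * (eps ^+ 2 + m i ^+ 2 + m' i ^+ 2))))%:E)%E.
Proof.
move=> sx sy xy rho1 lE.
under eq_integral do rewrite -big_split/=.
have G0 i w : 0 <= bump eps S (m i) (row_dot i x w) * bump eps S (m' i) (row_dot i y w).
  by rewrite mulr_ge0 ?bump_ge0.
have [|_ ->] := @row_product (fun i w => bump eps S (m i) (row_dot i x w) *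
   bump eps S (m' i) (row_dot i y w)) (index_enum _) (index_enum_uniq _) G0.
  move=> i; apply/sub_measurableP/measurable_funM.
    by have /sub_measurableP := @bump_sub i x (m i).
  by have /sub_measurableP := @bump_sub i y (m' i).
suff: (0 <= \prod_i \int[P]_w (bump eps S (m i) (row_dot i x w) *
      bump eps S (m' i) (row_dot i y w))%:E /\
    \prod_i \int[P]_w (bump eps S (m i) (row_dot i x w) *
      bump eps S (m' i) (row_dot i y w))%:E <=
    (\prod_i ((Num.sqrt (1 - rho ^+ 2))^-1 * expR (l * (m i * m' i) +
      l ^+ 2 * eps ^+ 2 * (eps ^+ 2 + m i ^+ 2 + m' i ^+ 2))))%:E)%E.
  by case.
apply: (big_ind2 (fun a b => (0 <= a)%E /\ (a <= b%:E)%E)).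
- by rewrite lee_fin ler01.
- move=> a b c e [a0 ab] [c0 ce]; split; first exact: mule_ge0.
  by rewrite EFinM; exact: lee_pmul.
- move=> i _; split; last exact: row_correlation.
  by apply: integral_ge0 => w _; rewrite lee_fin.
Qed.

End Rows.

(** * Deterministic estimates *)

Section Estimates.
Variable K : realType.

Lemma inv_sqrt_onem_le (t : K) : 0 <= t -> t <= 2^-1 ->
  (Num.sqrt (1 - t))^-1 <= expR t.
Proof.
move=> t0 t1; have p : 0 < 1 - t by lra.
rewrite -[leRHS]invrK lef_pV2 ?posrE ?sqrtr_gt0 ?invr_gt0 ?expR_gt0//.
rewrite -expRN -ler_sqr ?nnegrE ?sqrtr_ge0 ?expR_ge0// sqr_sqrtr ?(ltW p)//.
rewrite (_ : expR (- t) ^+ 2 = (expR (2 * t))^-1); last first.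
  by rewrite -expRM_natl -expRN; congr expR; ring.
rewrite -[leRHS]invrK.
rewrite lef_pV2 ?posrE ?invr_gt0 ?expR_gt0//.
have := @expR_ge1Dx K (2 * t); apply: le_trans.
rewrite -[leLHS]mul1r ler_pdivrMr//; nra.
Qed.

(** On the support of the weight, [a ^+ 2 <= 2 (eps ^+ 2 + m ^+ 2)], which
    bounds the inverse density. *)
Lemma bump_le (eps S m a : K) : 0 < eps -> 0 < S ->
  bump eps S m a <= (2 * eps * normal_peak S)^-1 * expR ((eps ^+ 2 + m ^+ 2) / S ^+ 2).
Proof.
move=> eps0 S0; have q0 : 0 < normal_peak S by rewrite normal_peak_gt0// gt_eqF.
have i0 : 0 <= (2 * eps * normal_peak S)^-1.
  by rewrite invr_ge0 !mulr_ge0// ltW.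
rewrite /bump indicE mem_setE in_itv/=.
case: (boolP (- eps <= m + a <= eps)) => [ma|_]; last first.
  by rewrite mul0r mulr_ge0// expR_ge0.
rewrite mul1r ler_wpM2l// ler_expR; have aa := box_sqr_le eps0 ma.
have S2 : 0 < S ^+ 2 by rewrite exprn_gt0.
have S22 : 0 < S ^+ 2 *+ 2 by rewrite pmulrn_lgt0.
rewrite ler_pdivrMr// (_ : _ / _ * _ = 2 * (eps ^+ 2 + m ^+ 2))//.
by field; rewrite gt_eqF.
Qed.

(** The product over the rows of the bounds of [row_correlation].  The cross
    term [l <m, m'>], with [l] about [rho / S^2], is split by the
    arithmetic-geometric inequality into a multiple of [rho ^+ 2] and a multiple
    of [<m, m'>^2], whose exponential moments are controlled separately; all other
    terms are multiples of [d * rho ^+ 2]. *)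
Lemma correlated_product_le (d : nat) (L S eps rho l : K) (m m' : 'I_d -> K) :
    (0 < d)%N -> 1 <= L -> 0 < S -> L <= S ^+ 2 -> 0 < eps -> eps ^+ 2 <= S ^+ 2 ->
    rho ^+ 2 <= 4^-1 -> l = rho / (S ^+ 2 * (1 - rho ^+ 2)) ->
    \sum_i m i ^+ 2 <= 4 * d%:R * Num.sqrt L ->
    \sum_i m' i ^+ 2 <= 4 * d%:R * Num.sqrt L ->
  \prod_i ((Num.sqrt (1 - rho ^+ 2))^-1 *
    expR (l * (m i * m' i) + l ^+ 2 * eps ^+ 2 * (eps ^+ 2 + m i ^+ 2 + m' i ^+ 2))) <=
  expR (38 * (d%:R * Num.sqrt L) * rho ^+ 2 +
        (\sum_i m i * m' i) ^+ 2 / (d%:R * Num.sqrt L * L ^+ 2)).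
Proof.
move=> d0 L1 S0 LS eps0 epsS rho4 lE mL m'L.
have L0 : 0 < L by lra.
set q := Num.sqrt L in mL m'L *; have q0 : 0 < q by rewrite sqrtr_gt0.
have q2 : q ^+ 2 = L by rewrite sqr_sqrtr// ltW.
have q1 : 1 <= q by rewrite -ler_sqr ?nnegrE ?(ltW q0)// q2 expr1n.
have d0K : 0 < d%:R :> K by rewrite ltr0n.
have S2 : 0 < S ^+ 2 by rewrite exprn_gt0.
set D := \sum_i m i * m' i.
have rr : (Num.sqrt (1 - rho ^+ 2))^-1 <= expR (rho ^+ 2).
  by apply: inv_sqrt_onem_le; [exact: sqr_ge0|lra].
apply: (@le_trans _ _ (\prod_(i < d) expR (rho ^+ 2 + (l * (m i * m' i) +
    l ^+ 2 * eps ^+ 2 * (eps ^+ 2 + m i ^+ 2 + m' i ^+ 2))))).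
  apply: ler_prod => i _; rewrite mulr_ge0 ?invr_ge0 ?sqrtr_ge0 ?expR_ge0//=.
  by rewrite [leRHS]expRD ler_wpM2r ?expR_ge0.
rewrite -expR_sum ler_expR big_split/= sumr_const card_ord -mulr_natl big_split/=.
rewrite -mulr_sumr -mulr_sumr -/D !big_split/= sumr_const card_ord -mulr_natl.
set A := \sum_(i < d) m i ^+ 2 in mL *; set A' := \sum_(i < d) m' i ^+ 2 in m'L *.
have D0 : 0 < 1 - rho ^+ 2 by lra.
pose u := (1 - rho ^+ 2)^-1.
have u0 : 0 < u by rewrite invr_gt0.
have u2 : u <= 2 by rewrite -[leRHS]invrK lef_pV2 ?posrE//; lra.
have lE' : l = rho * u / S ^+ 2 by rewrite lE /u; field; rewrite !gt_eqF.
have l2 : l ^+ 2 * S ^+ 2 <= 4 * rho ^+ 2 / S ^+ 2.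
  have -> : l ^+ 2 * S ^+ 2 = u ^+ 2 * (rho ^+ 2 / S ^+ 2).
    by rewrite lE'; field; rewrite gt_eqF.
  rewrite -mulrA ler_wpM2r ?divr_ge0 ?sqr_ge0//; nra.
(* The arithmetic-geometric inequality, with [l] about [rho / S ^+ 2]. *)
have t1 : l * D <= d%:R * q * rho ^+ 2 + D ^+ 2 / (d%:R * q * L ^+ 2).
  pose a := d%:R * q; have a0 : 0 < a by rewrite mulr_gt0.
  have h1 : l * D <= a * rho ^+ 2 + D ^+ 2 / (a * (S ^+ 2) ^+ 2).
    have := sqr_ge0 (a * rho - u / 2 * (D / S ^+ 2)).
    have e1 : l * D = rho * u * (D / S ^+ 2) by rewrite lE'; ring.
    have e2 : D ^+ 2 / (a * (S ^+ 2) ^+ 2) = (D / S ^+ 2) ^+ 2 / a.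
      by field; rewrite !gt_eqF.
    rewrite e1 e2; set x := D / S ^+ 2 => H.
    rewrite -(@ler_pM2l _ a)// mulrDr [a * (x ^+ 2 / a)]mulrC divfK ?gt_eqF//.
    have : u ^+ 2 / 4 * x ^+ 2 <= x ^+ 2.
      by rewrite -[leRHS]mul1r ler_wpM2r ?sqr_ge0//; nra.
    move: H; lra.
  rewrite (le_trans h1)// lerD2l ler_wpM2l ?sqr_ge0//.
  rewrite lef_pV2 ?posrE ?mulr_gt0 ?exprn_gt0// ler_wpM2l ?(ltW a0)//.
  by rewrite ler_sqr ?nnegrE ?(ltW L0) ?(ltW S2).
(* [36 = 4 * 9]: [l ^+ 2 * S ^+ 2 <= 4 * rho ^+ 2 / S ^+ 2], and each of [A], [A']
   is at most [4 * d * S ^+ 2]. *)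
have t2 : l ^+ 2 * eps ^+ 2 * (d%:R * eps ^+ 2 + A + A') <= 36 * d%:R * rho ^+ 2.
  have A0 : 0 <= A by apply: sumr_ge0 => i _; exact: sqr_ge0.
  have A'0 : 0 <= A' by apply: sumr_ge0 => i _; exact: sqr_ge0.
  have b1 : d%:R * eps ^+ 2 + A + A' <= 9 * d%:R * S ^+ 2.
    have : d%:R * eps ^+ 2 <= d%:R * S ^+ 2 by rewrite ler_wpM2l ?(ltW d0K).
    have : d%:R * q <= d%:R * S ^+ 2.
      rewrite ler_wpM2l ?(ltW d0K)// (le_trans _ LS)// -q2; nra.
    lra.
  have b2 : l ^+ 2 * eps ^+ 2 <= l ^+ 2 * S ^+ 2 by rewrite ler_wpM2l ?sqr_ge0.
  apply: (@le_trans _ _ ((4 * rho ^+ 2 / S ^+ 2) * (9 * d%:R * S ^+ 2))).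
    apply: ler_pM => //.
    - by apply: mulr_ge0; exact: sqr_ge0.
    - apply: addr_ge0 => //; apply: addr_ge0 => //.
      by apply: mulr_ge0; [exact: ltW|exact: sqr_ge0].
    - exact: le_trans l2.
  by rewrite le_eqVlt; apply/orP; left; apply/eqP; field; rewrite gt_eqF.
have t3 : d%:R * rho ^+ 2 <= d%:R * q * rho ^+ 2.
  by rewrite ler_wpM2r ?sqr_ge0// ler_peMr// ltW.
rewrite -/q; lra.
Qed.

End Estimates.

(** * The image of the walk under M *)

Section WalkLaw.
Variables (K : realType) (d n : nat) (M : 'M[K]_(d, n)).
Hypothesis colM : forall j, l2norm (col j M) <= 1.
Variables (I : finType) (w : I -> K) (x : I -> 'cV[K]_n).
Hypotheses (w0 : forall i, 0 <= w i) (w1 : \sum_i w i = 1).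
Hypothesis wE : forall f, gsw_expect (Mbar M) f = \sum_i w i * f (x i).

(** The identity block of [Mbar M] makes the output itself subgaussian. *)
Lemma walk_mgf (theta : 'cV[K]_n) l :
  \sum_i w i * expR (l * dot theta (x i)) <= expR (l ^+ 2 * dot theta theta).
Proof.
have := Mbar_mgf colM 0 (l *: theta); rewrite wE dotZl dotZr dot0r add0r mulrA -expr2.
apply: le_trans; rewrite le_eqVlt; apply/orP; left; apply/eqP.
by apply: eq_bigr => i _; rewrite [dot 0 _]dotC dot0r add0r dotZl.
Qed.

Lemma walk_image_mgf (theta : 'cV[K]_d) l :
  \sum_i w i * expR (l * dot theta (M *m x i)) <= expR (l ^+ 2 * dot theta theta).
Proof.
have := Mbar_mgf colM (l *: theta) 0; rewrite wE dotZl dotZr dot0r addr0 mulrA -expr2.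
apply: le_trans; rewrite le_eqVlt; apply/orP; left; apply/eqP.
by apply: eq_bigr => i _; rewrite [dot 0 _]dotC dot0r addr0 dotZl.
Qed.

Lemma VparE : 2 * Vpar M = \sum_i w i * dot (M *m x i) (M *m x i).
Proof.
rewrite /Vpar wE mulrC divfK//.
by apply: eq_bigr => i _; rewrite l2norm_sqr.
Qed.

Lemma Vpar_ge0 : 0 <= Vpar M.
Proof.
rewrite -(@pmulr_rge0 _ 2)// VparE.
by apply: sumr_ge0 => i _; rewrite mulr_ge0// dot_ge0.
Qed.

(** Each coordinate [y] of the image satisfies [E exp (y^2 / 8) <= 3/2], hence
    [E y^2 <= 4]. *)
Lemma Vpar_le : Vpar M <= 2 * d%:R.
Proof.
rewrite -(@ler_pM2l _ 2)// VparE.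
have coord (j : 'I_d) : \sum_i w i * (M *m x i) j 0 ^+ 2 <= 4.
  pose e : 'cV[K]_d := delta_mx j 0.
  have eE (y : 'cV[K]_d) : dot e y = y j 0.
    rewrite /dot (bigD1 j)//= big1 => [|i ij].
      by rewrite !mxE !eqxx mul1r addr0.
    by rewrite !mxE (negbTE ij)/= mul0r.
  have ee : dot e e = 1 by rewrite eE mxE !eqxx.
  have mgf l : \sum_i w i * expR (l * dot e (M *m x i)) <= expR (l ^+ 2 * 1).
    by rewrite -ee walk_image_mgf.
  have := @subgaussian_square_mgf K I w _ 1 w0 mgf 8^-1 ler01 _ _.
  rewrite invr_ge0 ler0n mulr1 divff// => /(_ isT (lexx _)) H.
  have : \sum_i w i * (1 + 8^-1 * (M *m x i) j 0 ^+ 2) <= 1 + 4 * 8^-1.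
    rewrite (le_trans _ H)//; apply: ler_sum => i _.
    by rewrite ler_wpM2l// eE expR_ge1Dx.
  under eq_bigr do rewrite mulrDr mulr1 mulrCA.
  rewrite big_split/= w1 -mulr_sumr; lra.
rewrite /dot; under eq_bigr do rewrite mulr_sumr.
rewrite exchange_big/=.
apply: (@le_trans _ _ (\sum_(j < d) 4)).
  by apply: ler_sum => j _; rewrite (le_trans _ (coord j)).
by rewrite sumr_const card_ord -mulr_natl; lra.
Qed.

Definition short_image (q : K) : pred I :=
  [pred i | dot (M *m x i) (M *m x i) <= 2 * Vpar M * q].

(** Markov's inequality, since [2 * Vpar M] is the mean of [|M x|^2]. *)
Lemma short_image_mass (q : K) : 0 < q ->
  1 - q^-1 <= \sum_(i | short_image q i) w i.
Proof.
move=> q0; rewrite lerBlDr -w1 (bigID (short_image q))/= lerD2l.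
(* When [Vpar M] vanishes, all charged points are in the kernel of [M]. *)
have [V0|V0] := eqVneq (Vpar M) 0.
  have z : \sum_i w i * dot (M *m x i) (M *m x i) = 0 by rewrite -VparE V0 mulr0.
  rewrite big1 ?invr_ge0 ?(ltW q0)// => i.
  rewrite /short_image/= V0 mulr0 mul0r -ltNge => xi.
  move/eqP: z; rewrite psumr_eq0 => [/allP z|j _]; last by rewrite mulr_ge0// dot_ge0.
  by have := z i (mem_index_enum _); rewrite /= mulf_eq0 (gt_eqF xi) orbF => /eqP.
have V1 : 0 < 2 * Vpar M by rewrite mulr_gt0// lt_neqAle eq_sym V0 Vpar_ge0.
rewrite -(@ler_pM2r _ (2 * Vpar M * q)) ?(mulr_gt0 V1 q0)//.
rewrite [leRHS]mulrC mulfK ?gt_eqF// {2}VparE mulr_suml.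
rewrite [leRHS](bigID (short_image q))/= -[leLHS]add0r lerD//.
  by apply: sumr_ge0 => i _; rewrite mulr_ge0// dot_ge0.
by apply: ler_sum => i; rewrite /short_image/= -ltNge => /ltW xi; rewrite ler_wpM2l.
Qed.

End WalkLaw.

(** * Moments of the weighted count *)

Section PairMoments.
Context disp (T : measurableType disp) (K : realType) (P : probability T K).
Variables (d n : nat) (kappa sigma : K) (R : 'I_d -> 'I_n -> {RV P >-> K}).
Hypotheses (d0 : (0 < d)%N) (kappa1 : 1 <= kappa) (sigma1 : 1 <= sigma).
Let L : K := ln d%:R.
Let q := Num.sqrt L.
Hypotheses (q1000 : 1000 <= q) (nE : n%:R = kappa * d%:R * L).
Let s := sigma / Num.sqrt d%:R.
Hypothesis iidR : iid_gaussian_entries s R.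
Let S := s * Num.sqrt n%:R.
Let eps := sigma * Num.sqrt L * (d%:R `^ (- kappa / 32)).

Let q_gt0 : 0 < q.
Proof. by apply: lt_le_trans q1000; rewrite ltr0n. Qed.

Let L_gt0 : 0 < L.
Proof. by rewrite -sqrtr_gt0 q_gt0. Qed.

Let q_sqr : q ^+ 2 = L.
Proof. by rewrite sqr_sqrtr// ltW// L_gt0. Qed.

Let L_ge1 : 1 <= L.
Proof. by rewrite -q_sqr; have := q1000; nra. Qed.

Let q_leL : 1000 * q <= L.
Proof. by rewrite -q_sqr; have := q1000; nra. Qed.

Let q_inv : q^-1 <= 1000^-1.
Proof. by rewrite lef_pV2 ?posrE ?q_gt0 ?ltr0n//; exact: q1000. Qed.

Let dK_gt0 : 0 < d%:R :> K.
Proof. by rewrite ltr0n. Qed.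

Let kappa_gt0 : 0 < kappa.
Proof. by rewrite (lt_le_trans _ kappa1). Qed.

Let sigma_gt0 : 0 < sigma.
Proof. by rewrite (lt_le_trans _ sigma1). Qed.

Let nK_gt0 : 0 < n%:R :> K.
Proof. by rewrite nE !mulr_gt0 ?kappa_gt0 ?dK_gt0 ?L_gt0. Qed.

Let dL_le_n : d%:R * L <= n%:R.
Proof.
by rewrite nE -mulrA ler_peMl// ltW// mulr_gt0 ?dK_gt0 ?L_gt0.
Qed.

Let S_gt0 : 0 < S.
Proof. by rewrite !mulr_gt0 ?sigma_gt0 ?invr_gt0 ?sqrtr_gt0 ?dK_gt0 ?nK_gt0. Qed.

Let S_sqr : S ^+ 2 = sigma ^+ 2 * kappa * L.
Proof.
rewrite /S /s !exprMn exprVn !sqr_sqrtr ?ler0n// nE; field.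
by rewrite gt_eqF ?dK_gt0.
Qed.

Lemma eps_gt0 : 0 < eps.
Proof. by rewrite !mulr_gt0 ?sigma_gt0 ?q_gt0// powR_gt0 ?dK_gt0. Qed.

Let eps_sqr : eps ^+ 2 = sigma ^+ 2 * L * expR (- (kappa * L / 16)).
Proof.
rewrite /eps /powR gt_eqF ?dK_gt0// !exprMn sqr_sqrtr ?(ltW L_gt0)//.
by rewrite -expRM_natl -/L; congr (_ * expR _); field.
Qed.

Let L_le_S : L <= S ^+ 2.
Proof.
rewrite S_sqr ler_peMl ?(ltW L_gt0)//.
by rewrite -[1]mulr1 ler_pM// expr_ge1// ltW ?sigma_gt0.
Qed.

Let eps_le_S : eps ^+ 2 <= S ^+ 2.
Proof.
rewrite eps_sqr S_sqr -[leRHS]mulrAC ler_wpM2l ?(mulr_ge0 (sqr_ge0 _) (ltW L_gt0))//.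
rewrite (le_trans _ kappa1)// -[leRHS]expR0 ler_expR oppr_le0.
by rewrite !mulr_ge0 ?(ltW L_gt0) ?(ltW kappa_gt0).
Qed.

(** The product over the rows of the weights of [R x]; for [u = M x] it vanishes
    unless [(M + R) x] lies in the cube of radius [eps]. *)
Definition bumps (x : 'cV[K]_n) (u : 'cV[K]_d) (w : T) : K :=
  \prod_j bump eps S (u j 0) (row_dot R j x w).

Lemma bumps_ge0 x u w : 0 <= bumps x u w.
Proof. by apply: prodr_ge0 => j _; apply: bump_ge0; exact: eps_gt0. Qed.

Lemma measurable_bumps x u : measurable_fun setT (bumps x u).
Proof.
apply: measurable_prod => j _; apply: (measurableT_comp (measurable_bump _ _ _)).
exact: measurable_row_dot.
Qed.

Lemma integral_bumps x u : sign_vectors x -> (\int[P]_w (bumps x u w)%:E = 1)%E.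
Proof.
move=> sx; apply: (mean_bumps _ iidR) => //.
- by rewrite mulr_gt0 ?sigma_gt0// invr_gt0 sqrtr_gt0 dK_gt0.
- exact: eps_gt0.
- by rewrite -(ltr0n K) nK_gt0.
Qed.

Let dot_sum_sqr (u : 'cV[K]_d) : \sum_j u j 0 ^+ 2 = dot u u.
Proof. by apply: eq_bigr => j _; rewrite expr2. Qed.

Lemma weakly_correlated_pair x y u v : sign_vectors x -> sign_vectors y ->
  4 * dot x y ^+ 2 <= n%:R ^+ 2 ->
  dot u u <= 4 * d%:R * q -> dot v v <= 4 * d%:R * q ->
  (\int[P]_w (bumps x u w * bumps y v w)%:E <=
   (expR (38 * (d%:R * q) / n%:R ^+ 2 * dot x y ^+ 2 +
          (d%:R * q * L ^+ 2)^-1 * dot u v ^+ 2))%:E)%E.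
Proof.
move=> sx sy xy uq vq; pose rho := dot x y / n%:R.
have n0 := nK_gt0.
have xyE : dot x y = n%:R * rho by rewrite /rho mulrC divfK// gt_eqF.
have rho4 : rho ^+ 2 <= 4^-1.
  rewrite /rho exprMn exprVn ler_pdivrMr ?exprn_gt0//; lra.
pose l := rho / (S ^+ 2 * (1 - rho ^+ 2)).
have rho1 : rho ^+ 2 < 1 by lra.
rewrite /bumps; apply: le_trans (correlated_bumps _ iidR _ _ _ _ sx sy xyE rho1 (erefl l)) _.
- by rewrite mulr_gt0 ?sigma_gt0// invr_gt0 sqrtr_gt0 dK_gt0.
- exact: eps_gt0.
- by rewrite -(ltr0n K) nK_gt0.
rewrite lee_fin; have [uq' vq'] : \sum_j u j 0 ^+ 2 <= 4 * d%:R * q /\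
    \sum_j v j 0 ^+ 2 <= 4 * d%:R * q by rewrite !dot_sum_sqr.
apply: le_trans (correlated_product_le d0 L_ge1 S_gt0 L_le_S eps_gt0 eps_le_S rho4
  (erefl l) uq' vq') _.
rewrite ler_expR le_eqVlt; apply/orP; left; apply/eqP.
rewrite -/q -[\sum_i _]/(dot u v); congr (_ + _); last by rewrite mulrC.
by rewrite xyE; field; rewrite gt_eqF.
Qed.

(** Each row contributes a factor of order [S / eps], bounded by
    [exp (kappa + kappa * L / 32)], and [d * kappa * L = n]: the main term is
    [n / 32].  The constants per row and [|u|^2 / S^2] are of order [d * kappa],
    at most [n / 64] in total because [L] is large. *)
Lemma bumps_le x u w : dot u u <= 4 * d%:R * q -> bumps x u w <= expR (3 * n%:R / 64).
Proof.
move=> uq; have [S0 e0] := (S_gt0, eps_gt0).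
have pk : (2 * eps * normal_peak S)^-1 <= expR (1 + kappa + kappa * L / 32).
  have E (a b c : K) : a != 0 -> b != 0 -> c != 0 ->
      (2 * a * (c^-1 / b))^-1 = c / 2 * (b / a) by move=> *; field; do ?[apply/andP; split].
  have p4 : Num.sqrt (pi *+ 2) <= 4 :> K.
    rewrite -ler_sqr ?nnegrE ?sqrtr_ge0// sqr_sqrtr ?(mulrn_wge0 _ (pi_ge0 _))//.
    by have := @pihalf_lt2 K; lra.
  have e2 : 2 <= expR 1 :> K by have := @expR_ge1Dx K 1; lra.
  have Se : S <= eps * expR (kappa + kappa * L / 32).
    rewrite -ler_sqr ?nnegrE ?(mulr_ge0 (ltW e0) (expR_ge0 _)) ?(ltW S0)//.
    rewrite S_sqr [leRHS]exprMn eps_sqr -expRM_natl.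
    have -> : sigma ^+ 2 * L * expR (- (kappa * L / 16)) *
        expR (2%:R * (kappa + kappa * L / 32)) =
        sigma ^+ 2 * L * expR (2 * kappa).
      by rewrite -mulrA -expRD; congr (_ * expR _); field.
    rewrite mulrAC ler_wpM2l ?(mulr_ge0 (sqr_ge0 _) (ltW L_gt0))//.
    have := @expR_ge1Dx K (2 * kappa); have := kappa_gt0; lra.
  have pi20 : 0 < Num.sqrt (pi *+ 2) :> K.
    by rewrite sqrtr_gt0; have := pi_gt0 K; lra.
  rewrite normal_peakE// E ?gt_eqF//.
  rewrite -addrA expRD; apply: ler_pM.
  - by rewrite divr_ge0 ?sqrtr_ge0.
  - by rewrite divr_ge0 ?(ltW S0) ?(ltW e0).
  - lra.
  - by rewrite ler_pdivrMr// mulrC.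
apply: (@le_trans _ _ (\prod_(j < d) expR (1 + kappa + kappa * L / 32 +
    (eps ^+ 2 + u j 0 ^+ 2) / S ^+ 2))).
  apply: ler_prod => j _; rewrite bump_ge0//= (le_trans (bump_le _ _ e0 S0))//.
  by rewrite [leRHS]expRD ler_wpM2r ?expR_ge0.
rewrite -expR_sum ler_expR big_split/= sumr_const card_ord -[_ *+ d]mulr_natl -mulr_suml.
rewrite big_split/= sumr_const card_ord -[eps ^+ 2 *+ d]mulr_natl dot_sum_sqr.
have S2 : 0 < S ^+ 2 by rewrite exprn_gt0.
have dK := dK_gt0.
have t1 : (d%:R * eps ^+ 2 + dot u u) / S ^+ 2 <= 5 * d%:R.
  rewrite ler_pdivrMr//.
  have : d%:R * eps ^+ 2 <= d%:R * S ^+ 2 by rewrite ler_wpM2l ?(ltW dK) ?eps_le_S.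
  have : d%:R * q <= d%:R * S ^+ 2.
    rewrite ler_wpM2l ?(ltW dK)// (le_trans _ L_le_S)//.
    by have := q_leL; have := q_gt0; lra.
  lra.
have t2 : d%:R <= d%:R * kappa by rewrite ler_peMr// ltW.
have t3 : 1000 * (d%:R * kappa) <= n%:R.
  have L1000 : 1000 <= L by have := q_leL; have := q1000; lra.
  rewrite nE; have := ler_wpM2l (mulr_ge0 (ltW dK) (ltW kappa_gt0)) L1000; lra.
have t4 : d%:R * (1 + kappa + kappa * L / 32) = d%:R + d%:R * kappa + n%:R / 32.
  by rewrite nE; field.
rewrite t4; lra.
Qed.

(** For strongly correlated pairs one of the two factors is bounded pointwise
    and the other integrates to 1. *)
Lemma crude_pair x y u v : sign_vectors y -> dot u u <= 4 * d%:R * q ->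
  (\int[P]_w (bumps x u w * bumps y v w)%:E <= (expR (3 * n%:R / 64))%:E)%E.
Proof.
move=> sy uq.
apply: (@le_trans _ _ (\int[P]_w ((expR (3 * n%:R / 64))%:E * (bumps y v w)%:E))%E).
  apply: ge0_le_integral => //.
  - by move=> w _; rewrite lee_fin mulr_ge0 ?bumps_ge0.
  - by apply/measurable_EFinP; apply: measurable_funM; exact: measurable_bumps.
  - by apply: measurable_funeM; apply/measurable_EFinP; exact: measurable_bumps.
  by move=> w _; rewrite lee_fin ler_wpM2r ?bumps_ge0// bumps_le.
rewrite ge0_integralZl//.
- by rewrite integral_bumps// mule1.
- by apply/measurable_EFinP; exact: measurable_bumps.
- by move=> w _; rewrite lee_fin bumps_ge0.
Qed.

Variable M : 'M[K]_(d, n).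
Hypothesis colM : forall j, l2norm (col j M) <= 1.
Variables (I : finType) (p : I -> K) (x : I -> 'cV[K]_n).
Hypotheses (p0 : forall i, 0 <= p i) (p1 : \sum_i p i = 1).
Hypotheses (sx : forall i, sign_vectors (x i)).
Hypothesis pE : forall f, gsw_expect (Mbar M) f = \sum_i p i * f (x i).

Let G := short_image M x q.

Lemma short_image_le i : G i -> dot (M *m x i) (M *m x i) <= 4 * d%:R * q.
Proof.
move=> Gi; rewrite (le_trans Gi)// ler_wpM2r ?(ltW q_gt0)//.
have := @Vpar_le K d n M colM I p x p0 p1 pE; lra.
Qed.

(** The mean of the exponential of a sum of two squares is at most the average
    of the means of the exponentials of their doubles.  The variance proxies of
    [<x, x i'>] and [<M x, M x i'>] are [n] and [|M x i'|^2 <= 4 d q], which makes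
    both exponents of order [1/q]. *)
Lemma weakly_correlated_sum i' : G i' ->
  \sum_(i | G i) p i * expR (38 * (d%:R * q) / n%:R ^+ 2 * dot (x i) (x i') ^+ 2 +
          (d%:R * q * L ^+ 2)^-1 * dot (M *m x i) (M *m x i') ^+ 2) <= 1 + 168 / q.
Proof.
move=> Gi'; pose t1 := 38 * (d%:R * q) / n%:R ^+ 2.
pose t2 := (d%:R * q * L ^+ 2)^-1; rewrite -/t1 -/t2.
have [q0 dK L0 n0] := And4 q_gt0 dK_gt0 L_gt0 nK_gt0.
have t10 : 0 <= t1.
  by apply: divr_ge0; [apply: mulr_ge0 => //; apply: mulr_ge0; exact: ltW|exact: sqr_ge0].
have t20 : 0 <= t2.
  by rewrite invr_ge0; apply: mulr_ge0; [apply: mulr_ge0; exact: ltW|exact: sqr_ge0].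
have t1n : t1 * n%:R <= 38 / q.
  rewrite (_ : t1 * n%:R = 38 * (d%:R * q) / n%:R); last first.
    by rewrite /t1; field; rewrite gt_eqF.
  rewrite -mulrA ler_wpM2l// ler_pdivrMr// [leRHS]mulrC ler_pdivlMr//.
  by rewrite -mulrA -expr2 q_sqr dL_le_n.
have bnd j z (tau : K) : 0 <= tau -> 8 * (2 * j * tau) <= 1 -> 0 <= j ->
    (forall l, \sum_i p i * expR (l * z i) <= expR (l ^+ 2 * tau)) ->
    \sum_i p i * expR (2 * j * z i ^+ 2) <= 1 + 8 * (j * tau).
  move=> tau0 jt j0 mgf.
  rewrite (le_trans (subgaussian_square_mgf p0 mgf tau0 _ jt)) ?mulr_ge0//; lra.
have b1 : \sum_i p i * expR (2 * t1 * dot (x i') (x i) ^+ 2) <= 1 + 304 / q.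
  apply: le_trans (bnd t1 (fun i => dot (x i') (x i)) n%:R _ _ t10 _) _.
  - exact: ltW.
  - have : 38 / q <= 38 / 1000 by rewrite ler_wpM2l// q_inv.
    lra.
  - move=> l; have := @walk_mgf K d n M colM I p x pE (x i') l.
    by rewrite (sign_dot (sx i')).
  - lra.
have sM : dot (M *m x i') (M *m x i') <= 4 * d%:R * q by exact: short_image_le.
have t2n : t2 * dot (M *m x i') (M *m x i') <= 4 / q.
  apply: (@le_trans _ _ (t2 * (4 * d%:R * q))); first by rewrite ler_wpM2l.
  rewrite (_ : t2 * _ = 4 / L ^+ 2); last by rewrite /t2; field; rewrite !gt_eqF.
  rewrite ler_wpM2l// lef_pV2 ?posrE ?exprn_gt0//.
  have := q_leL; have := L_ge1; nra.
have b2 : \sum_i p i * expR (2 * t2 * dot (M *m x i') (M *m x i) ^+ 2) <= 1 + 32 / q.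
  apply: le_trans (bnd t2 (fun i => dot (M *m x i') (M *m x i))
    (dot (M *m x i') (M *m x i')) _ _ t20 _) _.
  - exact: dot_ge0.
  - have : 4 / q <= 4 / 1000 by rewrite ler_wpM2l// q_inv.
    lra.
  - by move=> l; exact: (@walk_image_mgf K d n M colM I p x pE).
  - lra.
apply: (@le_trans _ _ (\sum_i (2^-1 * (p i * expR (2 * t1 * dot (x i') (x i) ^+ 2)) +
    2^-1 * (p i * expR (2 * t2 * dot (M *m x i') (M *m x i) ^+ 2))))).
  rewrite [leLHS]big_mkcond/=; apply: ler_sum => i _.
  set e1 := expR (2 * t1 * _); set e2 := expR (2 * t2 * _).
  have r0 : 0 <= 2^-1 * (p i * e1) + 2^-1 * (p i * e2).
    apply: addr_ge0; apply: mulr_ge0; rewrite ?invr_ge0//;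
      by apply: mulr_ge0 => //; exact: expR_ge0.
  case: ifP => // _.
  rewrite [leRHS](_ : _ = p i * (2^-1 * e1 + 2^-1 * e2)); last by ring.
  rewrite ler_wpM2l//.
  have := @expR_convex K (2 * t1 * dot (x i') (x i) ^+ 2)
    (2 * t2 * dot (M *m x i') (M *m x i) ^+ 2) 2^-1 2^-1.
  rewrite !invr_ge0 ler0n => /(_ isT isT) H; apply: le_trans (H _); last by field.
  rewrite ler_expR (dotC (x i)) (dotC (M *m x i)).
  by rewrite le_eqVlt; apply/orP; left; apply/eqP; field.
rewrite big_split/= -!mulr_sumr; lra.
Qed.

Lemma strongly_correlated_mass i' :
  \sum_(i | n%:R / 2 <= `|dot (x i') (x i)|) p i <= 2 * expR (- (n%:R / 16)).
Proof.
have n0 := nK_gt0.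
have mgf l : \sum_i p i * expR (l * dot (x i') (x i)) <= expR (l ^+ 2 * n%:R).
  have := @walk_mgf K d n M colM I p x pE (x i') l.
  by rewrite (sign_dot (sx i')).
have := chernoff p0 mgf n0 (a := n%:R / 2).
rewrite divr_ge0 ?(ltW n0)// => /(_ isT) H; rewrite (le_trans H)//.
rewrite ler_wpM2l// ler_expR le_eqVlt; apply/orP; left; apply/eqP.
by field; rewrite gt_eqF.
Qed.

(** Positivity of this sum forces some [x i] of positive weight to satisfy
    [|(M + R) x i| <= eps]. *)
Definition weighted_bumps (t : T) : K :=
  \sum_(i | G i) p i * bumps (x i) (M *m x i) t.

Lemma weighted_bumps_mean :
  (\int[P]_t (weighted_bumps t)%:E = (\sum_(i | G i) p i)%:E)%E.
Proof.
under eq_integral do rewrite /weighted_bumps -sumEFin -big_filter.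
rewrite ge0_integral_sum//; last 2 first.
- move=> i; apply/measurable_EFinP; apply: measurable_funM => //.
  exact: measurable_bumps.
- by move=> i t _; rewrite lee_fin mulr_ge0// bumps_ge0.
rewrite big_filter -sumEFin; apply: eq_bigr => i _.
under eq_integral do rewrite EFinM.
rewrite ge0_integralZl//; first by rewrite integral_bumps// mule1.
- by apply/measurable_EFinP; exact: measurable_bumps.
- by move=> t _; rewrite lee_fin bumps_ge0.
- by rewrite lee_fin.
Qed.

(** The square is a double sum over pairs.  For fixed [i'], the weakly
    correlated [i] give [1 + 168 / q], and the others give at most
    [2 exp (- n / 16 + 3 n / 64) <= 128 / q]. *)
Lemma weighted_bumps_second_moment :
  (\int[P]_t (weighted_bumps t ^+ 2)%:E <= (1 + 296 / q)%:E)%E.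
Proof.
have [q0 dK L0 n0] := And4 q_gt0 dK_gt0 L_gt0 nK_gt0.
pose phi i := bumps (x i) (M *m x i).
pose r := [seq i <- index_enum I | G i].
have E t : (weighted_bumps t ^+ 2)%:E =
    (\sum_(i' <- r) \sum_(i <- r) (p i' * p i)%:E * (phi i t * phi i' t)%:E)%E.
  rewrite /r big_filter expr2 /weighted_bumps mulr_suml -sumEFin.
  apply: eq_bigr => i' _; rewrite big_filter mulr_sumr -sumEFin; apply: eq_bigr => i _.
  by rewrite -EFinM; congr (_%:E); rewrite /phi; ring.
under eq_integral do rewrite E.
have mphi i : measurable_fun setT (phi i) by exact: measurable_bumps.
have phi0 i t : 0 <= phi i t by exact: bumps_ge0.
have mpp i i' : measurable_fun setT (fun t => (phi i t * phi i' t)%:E).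
  by apply/measurable_EFinP; exact: measurable_funM.
have pp0 i i' t : (0 <= (phi i t * phi i' t)%:E)%E by rewrite lee_fin mulr_ge0.
have ppe0 i i' : (0 <= (p i' * p i)%:E)%E by rewrite lee_fin mulr_ge0.
rewrite ge0_integral_sum//; last 2 first.
- by move=> i'; apply: emeasurable_sum => i; exact: measurable_funeM.
- by move=> i' t _; apply: sume_ge0 => i _; exact: mule_ge0.
pose far i i' := (n%:R / 2 <= `|dot (x i') (x i)|)%R.
pose near i i' := expR (38 * (d%:R * q) / n%:R ^+ 2 * dot (x i) (x i') ^+ 2 +
          (d%:R * q * L ^+ 2)^-1 * dot (M *m x i) (M *m x i') ^+ 2).
have pair i i' : G i -> G i' ->
    (\int[P]_t (phi i t * phi i' t)%:E <=
     (near i i' + (far i i')%:R * expR (3 * n%:R / 64))%:E)%E.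
  move=> Gi Gi'; have [fi|fi] := boolP (far i i').
    rewrite mul1r (le_trans (crude_pair _ _ (sx i') (short_image_le Gi)))//.
    by rewrite lee_fin lerDr expR_ge0.
  rewrite mul0r addr0; apply: weakly_correlated_pair => //.
  - move: fi; rewrite /far -ltNge (dotC (x i')) => fi.
    have : `|dot (x i) (x i')| ^+ 2 <= (n%:R / 2) ^+ 2.
      by rewrite ler_sqr ?nnegrE ?divr_ge0// ltW.
    rewrite real_normK ?num_real//; lra.
  - exact: short_image_le.
  - exact: short_image_le.
apply: (@le_trans _ _ (\sum_(i' | G i') \sum_(i | G i)
   (p i' * (p i * (near i i' + (far i i')%:R * expR (3 * n%:R / 64))))%:E)%E).
  rewrite big_filter; apply: lee_sum => i' Gi'.
  rewrite ge0_integral_sum//; last 2 first.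
  - by move=> i; exact: measurable_funeM.
  - by move=> i t _; exact: mule_ge0.
  rewrite big_filter; apply: lee_sum => i Gi; rewrite ge0_integralZl//.
  by rewrite mulrA [leRHS]EFinM lee_wpmul2l// pair.
under eq_bigr do rewrite sumEFin -mulr_sumr.
rewrite sumEFin lee_fin.
have tail i' : \sum_(i | G i) p i * ((far i i')%:R * expR (3 * n%:R / 64)) <= 128 / q.
  apply: (@le_trans _ _ ((\sum_(i | far i i') p i) * expR (3 * n%:R / 64))).
    rewrite mulr_suml [leLHS]big_mkcond [leRHS]big_mkcond/=; apply: ler_sum => i _.
    have e0 : 0 <= p i * expR (3 * n%:R / 64) by rewrite mulr_ge0 ?expR_ge0.
    by case: (far i i'); case: (G i); rewrite ?mul1r ?mul0r ?mulr0.
  rewrite (le_trans (ler_wpM2r (expR_ge0 _) (strongly_correlated_mass i')))//.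
  rewrite -[leLHS]mulrA -expRD.
  have -> : - (n%:R / 16) + 3 * n%:R / 64 = - (n%:R / 64) :> K by field.
  rewrite expRN.
  have e1 : q / 64 <= expR (n%:R / 64).
    have := @expR_ge1Dx K (n%:R / 64).
    have : q <= n%:R.
      rewrite (le_trans _ dL_le_n)//.
      have : 1 <= d%:R :> K by rewrite ler1n.
      by have := q_leL; nra.
    lra.
  have e2 : (expR (n%:R / 64))^-1 <= (q / 64)^-1.
    by rewrite lef_pV2 ?posrE ?expR_gt0// divr_gt0.
  by rewrite (le_trans (ler_wpM2l _ e2))// invfM invrK; lra.
have i'b i' : G i' ->
    \sum_(i | G i) p i * (near i i' + (far i i')%:R * expR (3 * n%:R / 64)) <=
    1 + 296 / q.
  move=> Gi'; under eq_bigr do rewrite mulrDr.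
  rewrite big_split/=; have := weakly_correlated_sum Gi'; have := tail i'.
  rewrite /near; lra.
apply: (@le_trans _ _ (\sum_(i' | G i') p i' * (1 + 296 / q))).
  by apply: ler_sum => i' Gi'; rewrite ler_wpM2l// i'b.
have b0 : 0 <= 1 + 296 / q by rewrite addr_ge0 ?ler01 ?divr_ge0 ?ler0n ?(ltW q0).
rewrite -mulr_suml; apply: ler_piMl; first exact: b0.
rewrite -p1 [leRHS](bigID G)/= lerDl.
by apply: sumr_ge0.
Qed.

End PairMoments.

(** * From the weighted count to the event *)

Lemma measurable_positive d (T : measurableType d) (K : realType) (Z : T -> K) :
  measurable_fun setT Z -> measurable [set t | (0 < Z t)%R].
Proof.
move=> mZ; have -> : [set t | (0 < Z t)%R] = Z @^-1` `]0, +oo[.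
  by apply/seteqP; split => t; rewrite /= in_itv/= andbT.
by rewrite -[X in measurable X]setTI; exact: mZ.
Qed.

(** Pointwise [2 Z <= 1 + Z ^+ 2] where [Z > 0], and [Z] vanishes elsewhere. *)
Lemma positive_probability_ge d (T : measurableType d) (K : realType)
    (P : probability T K) (Z : T -> K) : measurable_fun setT Z ->
  (forall t, 0 <= Z t) ->
  (2%:E * \int[P]_t (Z t)%:E <= P [set t | (0 < Z t)%R] + \int[P]_t (Z t ^+ 2)%:E)%E.
Proof.
move=> mZ Z0; set A := [set t | (0 < Z t)%R].
have mA : measurable A by exact: measurable_positive.
have mZE : measurable_fun setT (fun t => (Z t)%:E) by exact/measurable_EFinP.
have mZ2 : measurable_fun setT (fun t => (Z t ^+ 2)%:E).
  by apply/measurable_EFinP; exact: measurable_funX.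
have mIA : measurable_fun setT (fun t => (\1_A t : K)%:E).
  by apply/measurable_EFinP; exact: measurable_indic.
rewrite -ge0_integralZl//; last by move=> t _; rewrite lee_fin.
have -> : P A = (\int[P]_t (\1_A t : K)%:E)%E by rewrite integral_indic// setIT.
rewrite -ge0_integralD//; last by move=> t _; rewrite lee_fin sqr_ge0.
apply: ge0_le_integral => //.
- by move=> t _; rewrite -EFinM lee_fin mulr_ge0.
- exact: measurable_funeM.
- by apply: emeasurable_funD.
move=> t _; rewrite -EFinM -EFinD lee_fin indicE.
have [At|At] := boolP (t \in A); first by rewrite mulr1n; have := sqr_ge0 (Z t - 1); lra.
have -> : Z t = 0; last by rewrite mulr0 expr0n addr0.
apply/eqP; rewrite eq_le Z0 andbT leNgt; apply: contra At => Zt.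
by rewrite inE.
Qed.

Lemma mx_norm_col_le (K : realType) (m : nat) (v : 'cV[K]_m) (e : K) : 0 <= e ->
  (`|v| <= e) <-> (forall i, `|v i 0| <= e).
Proof.
move=> e0; rewrite /Num.norm/= mx_normrE; split => [ve i|ve].
  by apply: le_trans ve; apply: (le_bigmax _ (fun ij => `|v ij.1 ij.2|) (i, 0)).
apply: bigmax_le => // -[i j] _ /=; rewrite (ord1 j); exact: ve.
Qed.

Section Support.
Context disp (T : measurableType disp) (K : realType) (P : probability T K).
Variables (d n : nat) (sigma eps : K) (M : 'M[K]_(d, n)).
Variables (R : 'I_d -> 'I_n -> {RV P >-> K}) (Y : T -> 'cV[K]_n).
Hypotheses (eps0 : 0 <= eps) (Ylaw_Y : has_Ylaw P M sigma Y).
Variables (k : nat) (p : 'I_k -> K) (x : 'I_k -> 'cV[K]_n).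
Hypotheses (p0 : forall i, 0 <= p i) (sx : forall i, sign_vectors (x i)).
Hypothesis pE : forall f, gsw_expect (Mbar M) f = \sum_i p i * f (x i).

Let tilted i := \1_(Bset M) (x i) * tilt M sigma (x i).

Let tilted_ge0 i : 0 <= tilted i.
Proof. by rewrite /tilted mulr_ge0// expR_ge0. Qed.

(** If the normalization vanished, the law of [Y] would be the zero measure. *)
Lemma Wpar_gt0 : 0 < Wpar M sigma.
Proof.
have W0 : 0 <= Wpar M sigma.
  by rewrite /Wpar pE; apply: sumr_ge0 => i _; apply: mulr_ge0 (p0 i) (tilted_ge0 i).
rewrite lt_neqAle W0 andbT eq_sym; apply/eqP => Wz.
have [sY lawY] := Ylaw_Y.
have [_] := lawY (@sign_vectors K n) (@subset_refl _ _).
have -> : Y @^-1` (@sign_vectors K n) = setT.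
  by apply/seteqP; split => // t _; exact: sY.
rewrite probability_setT /Ylaw Wz invr0 mul0r => /eqP.
by rewrite eqe oner_eq0.
Qed.

Lemma Ylaw_set (A : set 'cV[K]_n) :
  Ylaw M sigma A = (Wpar M sigma)^-1 * \sum_i p i * (\1_A (x i) * tilted i).
Proof.
by rewrite /Ylaw pE; congr (_ * _); apply: eq_bigr => i _; rewrite /tilted -!mulrA.
Qed.

(** The tilt is positive, so the support of [Y] is that of the walk intersected
    with [Bset M]. *)
Lemma inner_gt0P (A : set 'cV[K]_n) :
  (0 < P [set t | A (Y t)])%E <-> exists i, [/\ 0 < p i, Bset M (x i) & A (x i)].
Proof.
have [sY lawY] := Ylaw_Y.
pose A' := A `&` @sign_vectors K n.
have -> : [set t | A (Y t)] = Y @^-1` A'.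
  by apply/seteqP; split => t; [split; [|exact: sY]|case].
have [_ ->] := lawY A' (@subIsetr _ _ _).
rewrite lte_fin Ylaw_set pmulr_rgt0 ?invr_gt0 ?Wpar_gt0//.
have term0 i : 0 <= p i * (\1_A' (x i) * tilted i).
  by apply: mulr_ge0 => //; apply: mulr_ge0 (tilted_ge0 i).
split => [H|[i [pi Bi Ai]]].
  apply/not_existsP => noi; move: H; rewrite ltNge => /negP; apply.
  apply: sumr_le0 => i _.
  have := noi i; rewrite /tilted !indicE.
  have [->|/eqP pi] := eqVneq (p i) 0; first by rewrite mul0r.
  case: (boolP (x i \in A')) => [|_]; last by rewrite mul0r mulr0.
  rewrite inE => -[Ai _].
  case: (boolP (x i \in Bset M)) => [|_]; last by rewrite mul0r !mulr0.
  rewrite inE => Bi; case; split => //.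
  by rewrite lt_neqAle p0 andbT eq_sym; apply/eqP.
rewrite (bigD1 i)//= ltr_pwDl//; last by apply: sumr_ge0.
rewrite /tilted !indicE mem_set ?mem_set//= !mul1r mulr_gt0// expR_gt0.
by [].
Qed.

Lemma perturbed_entry w y j :
  ((M + random_matrix R w) *m y) j 0 = (M *m y) j 0 + row_dot R j y w.
Proof.
rewrite mulmxDl !mxE; congr (_ + _); apply: eq_bigr => l _.
by rewrite mxE.
Qed.

(** By [inner_gt0P] the event is a finite union, over the points charged by the
    walk, of finite intersections of events on single entries. *)
Lemma event_measurable : measurable [set w | (0 < P [set w' |
  (`|(M + random_matrix R w) *m Y w'| <= eps)%R])%E].
Proof.
rewrite (_ : [set w | _] = \bigcup_(i in [set i | 0 < p i /\ Bset M (x i)])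
    \bigcap_(j in [set: 'I_d]) [set w | `|(M *m x i) j 0 + row_dot R j (x i) w| <= eps]).
  apply: fin_bigcup_measurable => // i _; apply: fin_bigcap_measurable => // j _.
  have mf : measurable_fun setT (fun w => `|(M *m x i) j 0 + row_dot R j (x i) w|).
    apply: measurableT_comp => //; apply: measurable_funD => //.
    apply: measurable_sum => l; exact: measurable_funM.
  have -> : [set w | `|(M *m x i) j 0 + row_dot R j (x i) w| <= eps] =
      (fun w => `|(M *m x i) j 0 + row_dot R j (x i) w|) @^-1` `]-oo, eps].
    by apply/seteqP; split => t; rewrite /= in_itv.
  by rewrite -[X in measurable X]setTI; exact: mf.
apply/seteqP; split => w /=.
  move=> /(@inner_gt0P (fun y => `|(M + random_matrix R w) *m y| <= eps))[i [pi Bi Ai]].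
  exists i => // j _ /=; rewrite -perturbed_entry.
  by have /(mx_norm_col_le _ eps0) := Ai; apply.
move=> [i [pi Bi] Ai].
apply/(@inner_gt0P (fun y => `|(M + random_matrix R w) *m y| <= eps)).
exists i; split => //; apply/(mx_norm_col_le _ eps0) => j; rewrite perturbed_entry.
exact: Ai.
Qed.

End Support.

(** * The theorem *)

Lemma cvg_inv_sqrt_ln (K : realType) (C : K) :
  C / Num.sqrt (ln (d%:R : K)) @[d --> \oo] --> (0 : K).
Proof.
apply/cvgrPdist_lt => e e0.
(* [sqrt (ln d)] exceeds [C / e] as soon as [ln d >= a]. *)
pose a := (C / e) ^+ 2 + 1.
have a0 : 0 < a by rewrite ltr_wpDl ?sqr_ge0.
near=> d.
have da : expR a <= d%:R by near: d; exact: nbhs_infty_ger.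
have La : a <= ln d%:R.
  by rewrite -(expRK a) ler_ln// posrE ?expR_gt0// (lt_le_trans _ da)// expR_gt0.
have q0 : 0 < Num.sqrt (ln (d%:R : K)) by rewrite sqrtr_gt0 (lt_le_trans a0).
rewrite sub0r normrN normrM normfV (gtr0_norm q0) ltr_pdivrMr//.
rewrite mulrC -ltr_pdivrMr// -[X in _ / X]gtr0_norm// -normfV -normrM.
rewrite -ltr_sqr ?nnegrE ?normr_ge0 ?sqrtr_ge0//.
rewrite real_normK ?num_real// sqr_sqrtr; last by rewrite (le_trans _ La)// ltW.
by rewrite (lt_le_trans _ La)// /a ltrDl.
Unshelve. all: by end_near.
Qed.

Theorem theorem4 (K : realType) :
  exists c : nat -> K,
    c d @[d --> \oo] --> (0 : K) /\
    forall (d n : nat) (kappa sigma : K) (M : 'M[K]_(d, n))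
      (disp : measure_display) (T : measurableType disp)
      (P : probability T K) (R : 'I_d -> 'I_n -> {RV P >-> K})
      (Y : T -> 'cV[K]_n),
    (3 <= d)%N -> 1 <= kappa -> 1 <= sigma ->
    n%:R = kappa * d%:R * ln d%:R ->
    (forall j, l2norm (col j M) <= 1) ->
    iid_gaussian_entries (sigma / Num.sqrt d%:R) R ->
    has_Ylaw P M sigma Y ->
    independent_of_matrix R Y ->
    let eps := sigma * Num.sqrt (ln d%:R) * (d%:R `^ (- kappa / 32)) in
    ((1 - c d)%:E <=
      P [set w | (0 < P [set w' |
        (`|(M + random_matrix R w) *m Y w'| <= eps)%R])%E])%E.
Proof.
exists (fun d => 1000 / Num.sqrt (ln d%:R)); split; first exact: cvg_inv_sqrt_ln.
move=> d n kappa sigma M disp T P R Y d3 kappa1 sigma1 nE colM iidR lawY _.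
lazy zeta; set eps := sigma * _ * _.
have d0 : (0 < d)%N by apply: leq_trans d3.
have L0 : 0 < ln (d%:R : K) by rewrite ln_gt0// ltr1n; apply: leq_trans d3.
have q0 : 0 < Num.sqrt (ln (d%:R : K)) by rewrite sqrtr_gt0.
(* Below this threshold the claimed lower bound is not positive. *)
have [q1000|q1000] := ltP (Num.sqrt (ln (d%:R : K))) 1000.
  apply: (@le_trans _ _ 0%E); last exact: measure_ge0.
  by rewrite lee_fin subr_le0 ler_pdivlMr// mul1r ltW.
have [k [p [x [p0 sx p1 pE]]]] := gsw_law (Mbar M).
have eps0 : 0 <= eps by rewrite ltW//; exact: eps_gt0.
pose Z := weighted_bumps kappa sigma R M p x.
have mZ : measurable_fun setT Z.
  rewrite /Z /weighted_bumps; under eq_fun do rewrite -big_filter.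
  apply: measurable_sum => i; apply: measurable_funM => //.
  exact: measurable_bumps.
have Z0 t : 0 <= Z t.
  apply: sumr_ge0 => i _; rewrite mulr_ge0//; exact: bumps_ge0.
have mean : (\int[P]_t (Z t)%:E =
    (\sum_(i | short_image M x (Num.sqrt (ln d%:R)) i) p i)%:E)%E.
  exact: weighted_bumps_mean.
have second : (\int[P]_t (Z t ^+ 2)%:E <= (1 + 296 / Num.sqrt (ln d%:R))%:E)%E.
  exact: weighted_bumps_second_moment.
have mass := short_image_mass p0 p1 pE q0.
have sub : [set t | (0 < Z t)%R] `<=` [set w | (0 < P [set w' |
        (`|(M + random_matrix R w) *m Y w'| <= eps)%R])%E].
  move=> t Zt; apply/(@inner_gt0P _ _ _ P _ _ sigma M Y lawY k p x p0 sx pE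
    (fun y => `|(M + random_matrix R t) *m y| <= eps)).
  have [i Gi pb] : exists2 i, short_image M x (Num.sqrt (ln d%:R)) i &
      0 < p i * bumps kappa sigma R (x i) (M *m x i) t.
    apply/not_exists2P => noi; move: Zt; rewrite /= ltNge => /negP; apply.
    apply: sumr_le0 => i Gi; rewrite leNgt; apply/negP => H.
    by case: (noi i).
  have pi0 : 0 < p i.
    rewrite lt_neqAle p0 andbT eq_sym; apply/eqP => pz.
    by rewrite pz mul0r ltxx in pb.
  exists i; split => //.
    split; first exact: sx.
    (* Short images satisfy the constraint of [Bset M]: [sqrt (ln d) <= (ln d)^2]. *)
    rewrite l2norm_sqr (le_trans Gi)// mulrAC ler_wpM2r ?(Vpar_ge0 p0 pE)//.
    rewrite ler_wpM2l// /Cpar -[X in _ <= X ^+ 2](sqr_sqrtr (ltW L0)) -exprM.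
    by rewrite ler_eXnr// (le_trans _ q1000)// ler1n.
  apply/(mx_norm_col_le _ eps0) => j; rewrite perturbed_entry.
  have : bumps kappa sigma R (x i) (M *m x i) t != 0.
    by apply: contraTneq pb => ->; rewrite mulr0 ltxx.
  move=> /prodf_neq0/(_ j isT); rewrite /bump mulf_eq0 negb_or => /andP[+ _].
  rewrite indicE mem_setE in_itv/= -ler_norml -/eps.
  by case: (_ <= eps)%R => //=; rewrite eqxx.
have mA := measurable_positive mZ.
apply: (@le_trans _ _ (P [set t | (0 < Z t)%R])); last first.
  apply: le_measure; rewrite ?inE//.
  exact: (event_measurable R eps0 lawY p0 sx pE).
(* [2 (1 - 1/q) - (1 + 296/q) = 1 - 298/q]. *)
have := positive_probability_ge P mZ Z0; rewrite mean -EFinM => H.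
have {}H := le_trans H (leeD2l _ second).
have Pfin : P [set t | (0 < Z t)%R] \is a fin_num by exact: fin_num_measure.
move: H; rewrite -(fineK Pfin) -EFinD !lee_fin => H.
have qi : 0 < (Num.sqrt (ln (d%:R : K)))^-1 by rewrite invr_gt0.
lra.
Qed.
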